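(* Let $A$ be a semicircular Klaus–Shaw potential whose phase and tail integrals are polynomials $\Phi(\lambda)=\sum_{p=0}^{\mathcal P}\Phi_p\lambda^{2p}$, $\Xi(\lambda)=\mathrm i\sum_{q=1}^{\mathcal Q}\Xi_q\lambda^{2q-1}$ of exact degrees $2\mathcal P$, $2\mathcal Q-1$; let $M:=\max\{2\mathcal P,2\mathcal Q-1\}$, $\Phi_p:=0$ for $p>\mathcal P$, $\Xi_q:=0$ for $q>\mathcal Q$, and fix $K\in\mathbb Z$; set $t^\circ_{2p}:=-\tfrac12(2K+1)\Phi_p$, $t^\circ_{2q-1}:=-\tfrac12\Xi_q$ ($2\le m\le M$), $x^\circ:=-\tfrac12\Xi_1$, and $\nu:=\frac1{2\pi}\int_0^{A_{\max}}\Phi(\mathrm is)\,ds$. Fix a flow index $n\in\{2,\dots,M\}$ and a real $t^\circ$, and let $\mathbf t_n^\circ:=(t_2^\circ,\dots,t_{n-1}^\circ,t_n^\circ-t^\circ,t_{n+1}^\circ,\dots,t_M^\circ)$. Let $\mathbf e_n$ be the unit vector in the $t_n$-direction of $\mathbb R^{M-1}$ and $\psi(x,t):=\widetilde\psi(x,\mathbf t_n^\circ+t\mathbf e_n)$; this is the solution of the $n$-th pure flow of the focusing NLS hierarchy with initial datum $\psi(x,0)=\widetilde\psi(x,\mathbf t_n^\circ)$. Then $$\psi\Big(x^\circ+\tfrac{\epsilon^2}{\nu}X,\ t^\circ+\tfrac{\epsilon^{n+1}}{\nu^n}T_n\Big)=\mathrm i(-1)^{K+N}\frac{\nu}{\epsilon}\Psi(X,0,\dots,0,T_n,0,\dots,0)+O(1)$$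 (with $T_n$ in the $n$-th time slot of $\Psi$) as $\epsilon=\epsilon_N\downarrow0$, uniformly for bounded $(X,T_n)\in\mathbb R^2$.
   Context: A semicircular Klaus–Shaw potential: $A:\mathbb R\to[0,\infty)$ with support $[X_-,X_+]$ ($X_-<X_+$), of the form $u(x)\sqrt{(X_+-x)(x-X_-)}$ there with $u\ge c>0$ and $u$ analytic on a complex neighborhood of $[X_-,X_+]$, $A\in L^1\cap C^2$, unique maximizer $x_0$, $A''(x_0)<0$, $A_{\max}=A(x_0)$. With $x_-(s)<x_+(s)$ solving $A(x)=s$, $\Phi(\mathrm is):=\int_{x_-}^{x_+}\sqrt{A^2-s^2}dx$, $\Xi(\mathrm is):=(x_++x_-)s+\int_{-\infty}^{x_-}(\sqrt{s^2-A^2}-s)dx-\int_{x_+}^\infty(\sqrt{s^2-A^2}-s)dx$ ($0<s<A_{\max}$), as functions of $\lambda=\mathrm is$, analytically continued. Semiclassical soliton ensemble: $\epsilon=\epsilon_N:=\frac1{N\pi}\int A$; $\Phi(\mathrm i\tilde s_n)=(n+\tfrac12)\epsilon\pi$, $n=0,\dots,N-1$; $\tilde\tau_n:=(-1)^{n+1}e^{\Xi(\mathrm i\tilde s_n)/\epsilon}$; $\mathbf t=(t_2,\dots,t_M)$, $Q(\lambda;x,\mathbf t):=\lambda x+\sum_{m=2}^M\lambda^mt_m$; $c_n:=\tilde\tau_n\frac{\prod_j(\mathrm i\tilde s_n+\mathrm i\tilde s_j)}{\prod_{j\ne n}(\mathrm i\tilde s_n-\mathrm i\tilde s_j)}e^{2\mathrm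 iQ(\mathrm i\tilde s_n;x,\mathbf t)/\epsilon}$; $\widetilde{\mathbf M}$ the unique $2\times2$ matrix meromorphic in $\lambda$ with simple poles only at $\pm\mathrm i\tilde s_n$, $\operatorname{Res}_{\mathrm i\tilde s_n}\widetilde{\mathbf M}=\lim\widetilde{\mathbf M}\begin{pmatrix}0&0\\c_n&0\end{pmatrix}$, $\operatorname{Res}_{-\mathrm i\tilde s_n}\widetilde{\mathbf M}=\lim\widetilde{\mathbf M}\begin{pmatrix}0&-c_n^*\\0&0\end{pmatrix}$, $\widetilde{\mathbf M}\to\mathbb I$; $\widetilde\psi(x,\mathbf t):=2\mathrm i\lim_{\lambda\to\infty}\lambda\widetilde M_{12}$; it solves simultaneously the first $M-1$ flows of the focusing NLS hierarchy. $\Psi(X,T_2,\dots,T_M):=2\mathrm i\lim_{\Lambda\to\infty}\Lambda R_{12}$, with $\mathbf R$ the unique $2\times2$ matrix analytic in $|\Lambda|\ne1$, $\mathbf R_+=\mathbf R_-e^{-\mathrm i\theta\sigma_3}\mathbf Q^{-1}e^{\mathrm i\theta\sigma_3}$ on $|\Lambda|=1$ ($\mathbf R_-$ interior, $\mathbf R_+$ exterior), $\theta=\Lambda X+\sum_{m=2}^M\Lambda^mT_m+2\Lambda^{-1}$, $\mathbf Q=\frac1{\sqrt2}\begin{pmatrix}1&-1\\1&1\end{pmatrix}$, $\mathbf R\to\mathbb I$. *)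

(* Defs.v *)
From Stdlib Require Import Reals Lra List ClassicalEpsilon.
From Coquelicot Require Import Coquelicot.
Set Implicit Arguments.
Open Scope R_scope.

Definition cexp (z : C) : C := (exp (fst z) * cos (snd z), exp (fst z) * sin (snd z)).
Fixpoint cpow (z : C) (k : nat) : C :=
  match k with O => RtoC 1 | S k' => Cmult z (cpow z k') end.
Definition csum (f : nat -> C) (n : nat) : C :=
  fold_right Cplus (RtoC 0) (map f (seq 0 n)).
Definition cprod (f : nat -> C) (n : nat) : C :=
  fold_right Cmult (RtoC 1) (map f (seq 0 n)).
Definition cprod_ne (f : nat -> C) (n k : nat) : C :=
  fold_right Cmult (RtoC 1) (map f (filter (fun j => negb (Nat.eqb j k)) (seq 0 n))).

Definition clim_in (D : C -> Prop) (f : C -> C) (p l : C) : Prop :=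
  forall eps, 0 < eps -> exists del, 0 < del /\
    forall z, D z -> z <> p -> Cmod (Cminus z p) < del -> Cmod (Cminus (f z) l) < eps.
Definition clim (f : C -> C) (p l : C) : Prop := clim_in (fun _ => True) f p l.
Definition clim_inf (f : C -> C) (l : C) : Prop :=
  forall eps, 0 < eps -> exists r, forall z, r < Cmod z -> Cmod (Cminus (f z) l) < eps.
Definition cdiff (f : C -> C) (z : C) : Prop :=
  exists d, clim (fun w => Cdiv (Cminus (f w) (f z)) (Cminus w z)) z d.
Definition open_C (D : C -> Prop) : Prop :=
  forall z, D z -> exists r, 0 < r /\ forall w, Cmod (Cminus w z) < r -> D w.

Record M2 := mk2 { m11 : C; m12 : C; m21 : C; m22 : C }.
Definition mI : M2 := mk2 (RtoC 1) (RtoC 0) (RtoC 0) (RtoC 1).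
Definition mmul (a b : M2) : M2 :=
  mk2 (Cplus (Cmult (m11 a) (m11 b)) (Cmult (m12 a) (m21 b)))
      (Cplus (Cmult (m11 a) (m12 b)) (Cmult (m12 a) (m22 b)))
      (Cplus (Cmult (m21 a) (m11 b)) (Cmult (m22 a) (m21 b)))
      (Cplus (Cmult (m21 a) (m12 b)) (Cmult (m22 a) (m22 b))).
Definition mscal (c : C) (a : M2) : M2 :=
  mk2 (Cmult c (m11 a)) (Cmult c (m12 a)) (Cmult c (m21 a)) (Cmult c (m22 a)).
Definition entries (a : M2) : list C := m11 a :: m12 a :: m21 a :: m22 a :: nil.
Definition mlim_in (D : C -> Prop) (F : C -> M2) (p : C) (L : M2) : Prop :=
  clim_in D (fun z => m11 (F z)) p (m11 L) /\ clim_in D (fun z => m12 (F z)) p (m12 L) /\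
  clim_in D (fun z => m21 (F z)) p (m21 L) /\ clim_in D (fun z => m22 (F z)) p (m22 L).
Definition mlim F p L := mlim_in (fun _ => True) F p L.
Definition mlim_inf (F : C -> M2) (L : M2) : Prop :=
  clim_inf (fun z => m11 (F z)) (m11 L) /\ clim_inf (fun z => m12 (F z)) (m12 L) /\
  clim_inf (fun z => m21 (F z)) (m21 L) /\ clim_inf (fun z => m22 (F z)) (m22 L).
Definition mholo_at (F : C -> M2) (z : C) : Prop :=
  cdiff (fun w => m11 (F w)) z /\ cdiff (fun w => m12 (F w)) z /\
  cdiff (fun w => m21 (F w)) z /\ cdiff (fun w => m22 (F w)) z.

Definition analytic_near_interval (u : R -> R) (Xm Xp : R) : Prop :=
  exists del, 0 < del /\ exists U : C -> C,
    (forall z, (exists x, Xm <= x <= Xp /\ Cmod (Cminus z (RtoC x)) < del) -> cdiff U z) /\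
    (forall x, Xm <= x <= Xp -> U (RtoC x) = RtoC (u x)).

Definition int_R (f : R -> R) : R :=
  RInt_gen f (Rbar_locally m_infty) (Rbar_locally p_infty).

(* Phi(i s) for 0 < s < A_max, with x_-(s) = xm s, x_+(s) = xp s *)
Definition Phi_is (A xm xp : R -> R) (s : R) : R :=
  RInt (fun x => sqrt (A x ^ 2 - s ^ 2)) (xm s) (xp s).
Definition Xi_is (A xm xp : R -> R) (s : R) : R :=
  (xp s + xm s) * s
  + RInt_gen (fun x => sqrt (s ^ 2 - A x ^ 2) - s) (Rbar_locally m_infty) (at_point (xm s))
  - RInt_gen (fun x => sqrt (s ^ 2 - A x ^ 2) - s) (at_point (xp s)) (Rbar_locally p_infty).

Definition epsN (A : R -> R) (N : nat) : R := / (INR N * PI) * int_R A.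

Definition Qphase (Mdeg : nat) (lam : C) (x : R) (t : nat -> R) : C :=
  Cplus (Cmult lam (RtoC x))
        (csum (fun k => Cmult (cpow lam (k + 2)) (RtoC (t (k + 2)%nat))) (Mdeg - 1)).

(* norming constant c_n; s = (s~_j)_j, Xis = Xi(i .), eps = epsilon_N *)
Definition cnorm (Mdeg N : nat) (eps : R) (Xis : R -> R) (s : nat -> R)
    (x : R) (t : nat -> R) (n : nat) : C :=
  let lam j := Cmult Ci (RtoC (s j)) in
  let tau := (-1) ^ (n + 1) * exp (Xis (s n) / eps) in
  Cmult (RtoC tau)
   (Cmult (Cdiv (cprod (fun j => Cplus (lam n) (lam j)) N)
                (cprod_ne (fun j => Cminus (lam n) (lam j)) N n))
          (cexp (Cdiv (Cmult (RtoC 2) (Cmult Ci (Qphase Mdeg (lam n) x t))) (RtoC eps)))).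

(* M is meromorphic with (at most) simple poles only at +-i s_n (n < N),
   with the prescribed residue conditions and M -> I at infinity *)
Definition dRHP_sol (N : nat) (s : nat -> R) (c : nat -> C) (M : C -> M2) : Prop :=
  let pole z := exists n, (n < N)%nat /\
                 (z = Cmult Ci (RtoC (s n)) \/ z = Copp (Cmult Ci (RtoC (s n)))) in
  (forall z, ~ pole z -> mholo_at M z) /\
  (forall n, (n < N)%nat ->
     let p := Cmult Ci (RtoC (s n)) in
     exists Res, mlim (fun z => mscal (Cminus z p) (M z)) p Res /\
                 mlim (fun z => mmul (M z) (mk2 (RtoC 0) (RtoC 0) (c n) (RtoC 0))) p Res) /\
  (forall n, (n < N)%nat ->
     let p := Copp (Cmult Ci (RtoC (s n))) in
     exists Res, mlim (fun z => mscal (Cminus z p) (M z)) p Res /\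
                 mlim (fun z => mmul (M z) (mk2 (RtoC 0) (Copp (Cconj (c n))) (RtoC 0) (RtoC 0))) p Res) /\
  mlim_inf M mI.

(* 2 i lim_{lambda -> oo} lambda M_12, for "the" (unique) solution M *)
Definition recover_val (sol : (C -> M2) -> Prop) : C :=
  epsilon (inhabits (RtoC 0)) (fun v => exists M, sol M /\
     exists L, clim_inf (fun z => Cmult z (m12 (M z))) L /\ v = Cmult (RtoC 2) (Cmult Ci L)).

Definition psi_tilde (A xm xp : R -> R) (Mdeg N : nat) (s : nat -> R) (x : R) (t : nat -> R) : C :=
  recover_val (dRHP_sol N s (cnorm Mdeg N (epsN A N) (Xi_is A xm xp) s x t)).

Definition Qmat : M2 :=
  mscal (RtoC (/ sqrt 2)) (mk2 (RtoC 1) (RtoC (-1)) (RtoC 1) (RtoC 1)).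
Definition Qinv : M2 :=
  mscal (RtoC (/ sqrt 2)) (mk2 (RtoC 1) (RtoC 1) (RtoC (-1)) (RtoC 1)).
Definition expsig3 (w : C) : M2 := mk2 (cexp w) (RtoC 0) (RtoC 0) (cexp (Copp w)).
Definition theta (Mdeg : nat) (X : R) (T : nat -> R) (L : C) : C :=
  Cplus (Qphase Mdeg L X T) (Cdiv (RtoC 2) L).
Definition jumpV (Mdeg : nat) (X : R) (T : nat -> R) (L : C) : M2 :=
  let th := theta Mdeg X T L in
  mmul (mmul (expsig3 (Copp (Cmult Ci th))) Qinv) (expsig3 (Cmult Ci th)).

Definition RHP_sol (Mdeg : nat) (X : R) (T : nat -> R) (Rm : C -> M2) : Prop :=
  (forall z, Cmod z <> 1 -> mholo_at Rm z) /\
  (forall z0, Cmod z0 = 1 -> exists Rminus Rplus,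
      mlim_in (fun z => Cmod z < 1) Rm z0 Rminus /\
      mlim_in (fun z => 1 < Cmod z) Rm z0 Rplus /\
      Rplus = mmul Rminus (jumpV Mdeg X T z0)) /\
  mlim_inf Rm mI.

Definition Psi (Mdeg : nat) (X : R) (T : nat -> R) : C :=
  recover_val (RHP_sol Mdeg X T).

Definition cutP (P : nat) (a : nat -> R) (p : nat) : R := if (p <=? P)%nat then a p else 0.
Definition tcirc (P Q : nat) (PhiC XiC : nat -> R) (K : Z) (m : nat) : R :=
  if Nat.even m then - / 2 * (2 * IZR K + 1) * cutP P PhiC (m / 2)
  else - / 2 * cutP Q XiC ((m + 1) / 2).
Definition xcirc (XiC : nat -> R) : R := - / 2 * XiC 1%nat.
Definition evec (n : nat) (t : R) : nat -> R := fun m => if (m =? n)%nat then t else 0.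
Definition tcirc_n (P Q : nat) (PhiC XiC : nat -> R) (K : Z) (n : nat) (t0 : R) : nat -> R :=
  fun m => tcirc P Q PhiC XiC K m - evec n t0 m.
Definition psi_flow (A xm xp : R -> R) (Mdeg N : nat) (s : nat -> R)
    (P Q : nat) (PhiC XiC : nat -> R) (K : Z) (n : nat) (t0 : R) (x t : R) : C :=
  psi_tilde A xm xp Mdeg N s x (fun m => tcirc_n P Q PhiC XiC K n t0 m + evec n t m).

(* Main.v *)
Require Import Defs.
From Stdlib Require Import Reals Lra Lia List ClassicalEpsilon ZArith.
From Coquelicot Require Import Coquelicot.
Open Scope R_scope.

(* At the base point (x^o, t^o) the exponential exp(2iQ/eps) cancels exp(Xi/eps) and, because
   Phi(i s_j) is quantized, turns the alternating signs into the constant i(-1)^(K+N).  In the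
   variable Lambda = lambda eps/nu the ensemble is therefore a pole problem with residues
   i(-1)^(K+N) Res(1/a) exp(2i(Lambda X + Lambda^n T)), a = prod (Lambda - i sigma_j)/(Lambda + i
       sigma_j),
   sigma_j = eps s_j/nu.  Monotonicity of Phi gives sum sigma_j = 2 + O(eps) and
   sum sigma_j^2 = O(eps), so a = exp(-4i/Lambda) + O(eps) on circles around 0.

   Any such pole problem is solved by a product of Blaschke-Potapov factors, which are
   contractions in the upper half-plane; this bounds the solution on |Lambda| >= 1/2
   uniformly in N, and no invertibility theory is needed: if M, M' solve two pole problems,
   M M'^(-1) outside |Lambda| = 1/2 and its analytic analogue inside differ on the circle by
   O(|a - a'|), and Cauchy's formula bounds M - M'.  The same estimate produces the solution R
   as a limit of pole problems.  Uniqueness in both problems follows by Liouville from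
   M(z) M'(z-bar)^* = I; since only pointwise complex differentiability is assumed, Cauchy's
   formula is derived from Goursat's bisection argument. *)

(** * Limits and complex derivatives *)

(** The residue data themselves have no limit: the number of poles grows and all of them collapse to
    the origin. What converges is the function [phi = om / bl], whose residues at the upper poles
    are, up to sign, the prescribed data and which tends to 0 at the lower poles. Multiplying the
    solution inside a circle on the right by the matrix with rows (1, -1/phi) and (phi, 1) therefore
    clears both families of poles by one factor; its determinant is 2, and normalizing it by 1/sqrt
    2 is where the constant matrix [Qmat] of the limit comes from. From then on only the values of
    [phi] on a circle matter. The radii are kept apart: the poles lie within 1/8, the comparison
    takes place on 1/2, and the unit circle of the limiting problem sits inside an annulus where
    exterior and interior data are both analytic. The error is linear in [defect], which is O(eps);
    undoing the rescaling multiplies it by [nu / eps], and this is exactly the O(1) of the claim.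
    The constants depend on (X, T) only through a bound on exp(2iQ) for |Lambda| <= 2, which gives
    the uniformity. *)

Definition tends {T : Type} (F : (T -> Prop) -> Prop) (f : T -> C) (l : C) : Prop :=
  forall eps, 0 < eps -> F (fun x => Cmod (f x - l) < eps).

(** [nb] serves continuity. [pnb D p] and [nbinf] are set up so that [tends] over them unfolds to
    [clim_in D] and [clim_inf] of the statement; the limit algebra is then proved once for all
    filters. *)
Definition nb (z : C) : (C -> Prop) -> Prop :=
  fun A => exists del, 0 < del /\ forall w, Cmod (w - z) < del -> A w.
Definition pnb (D : C -> Prop) (p : C) : (C -> Prop) -> Prop :=
  fun A => exists del, 0 < del /\
    forall z, D z -> z <> p -> Cmod (z - p) < del -> A z.
Notation punct := (pnb (fun _ : C => True)).
Definition nbinf : (C -> Prop) -> Prop :=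
  fun A => exists r, forall z, r < Cmod z -> A z.

Global Instance nb_filter z : Filter (nb z).
Proof.
  constructor.
  - exists 1; split; [lra|auto].
  - intros P Q (d1 & H1 & HP) (d2 & H2 & HQ).
    exists (Rmin d1 d2); split; [apply Rmin_glb_lt; auto|].
    intros w Hw; split; [apply HP|apply HQ]; eapply Rlt_le_trans; eauto;
      [apply Rmin_l|apply Rmin_r].
  - intros P Q HPQ (d & H & HP); exists d; split; auto.
Qed.

Global Instance pnb_filter D z : Filter (pnb D z).
Proof.
  constructor.
  - exists 1; split; [lra|auto].
  - intros P Q (d1 & H1 & HP) (d2 & H2 & HQ).
    exists (Rmin d1 d2); split; [apply Rmin_glb_lt; auto|].
    intros w Hw Hn Hd; split; [apply HP|apply HQ]; auto; eapply Rlt_le_trans; eauto;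
      [apply Rmin_l|apply Rmin_r].
  - intros P Q HPQ (d & H & HP); exists d; split; auto.
Qed.

Global Instance nbinf_proper : ProperFilter nbinf.
Proof.
  constructor; [|constructor].
  - intros P (r & H). exists (RtoC (Rabs r + 1)). apply H.
    rewrite Cmod_R. generalize (Rle_abs r) (Rle_abs (Rabs r + 1)). lra.
  - exists 0; auto.
  - intros P Q (d1 & HP) (d2 & HQ). exists (Rmax d1 d2). intros z Hz; split.
    + apply HP; eapply Rle_lt_trans; eauto; apply Rmax_l.
    + apply HQ; eapply Rle_lt_trans; eauto; apply Rmax_r.
  - intros P Q HPQ (d & H); exists d; auto.
Qed.

Global Instance pnb_proper z : ProperFilter (punct z).
Proof.
  constructor; [|apply pnb_filter].
  intros P (d & Hd & H). exists (z + RtoC (d / 2))%C. apply H; auto.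
  - intros E. assert (RtoC (d/2) = RtoC 0).
    { replace (RtoC (d/2)) with (z + RtoC (d/2) - z)%C by ring.
      rewrite E. ring. }
    apply RtoC_inj in H0. lra.
  - replace (z + RtoC (d/2) - z)%C with (RtoC (d/2)) by ring.
    rewrite Cmod_R, Rabs_right; lra.
Qed.

Lemma filter_conj {T} {F : (T -> Prop) -> Prop} (P Q : T -> Prop) :
  F P -> F Q -> forall {FF : Filter F}, F (fun x => P x /\ Q x).
Proof. intros HP HQ FF. now apply filter_and. Qed.

Lemma Cmod_minus_sym (a b : C) : Cmod (a - b) = Cmod (b - a).
Proof. rewrite <- (Cmod_opp (b - a)%C). f_equal. ring. Qed.

Lemma Cmod_minus_le (a b c : C) :
  Cmod (a - c) <= Cmod (a - b) + Cmod (b - c).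
Proof.
  replace (a - c)%C with (a - b + (b - c))%C by ring.
  apply Cmod_triangle.
Qed.

Lemma Cmod_le_minus (a b : C) : Cmod a <= Cmod b + Cmod (a - b).
Proof.
  replace a with (b + (a - b))%C at 1 by ring. apply Cmod_triangle.
Qed.

Section Tends.
Context {T : Type} {F : (T -> Prop) -> Prop} {FF : Filter F}.

Lemma tends_const (c : C) : tends F (fun _ => c) c.
Proof.
  intros eps He. apply filter_forall. intros _.
  replace (c - c)%C with (RtoC 0) by ring. rewrite Cmod_0. exact He.
Qed.

Lemma tends_eq (f : T -> C) l l' : tends F f l -> l = l' -> tends F f l'.
Proof. intros H <-. exact H. Qed.

Lemma tends_ext_loc (f g : T -> C) l :
  F (fun x => f x = g x) -> tends F f l -> tends F g l.
Proof.
  intros H Hf eps He. generalize (filter_conj _ _ H (Hf eps He)).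
  apply filter_imp. intros x (E & Hx). rewrite <- E. exact Hx.
Qed.

Lemma tends_ext (f g : T -> C) l :
  (forall x, f x = g x) -> tends F f l -> tends F g l.
Proof. intros H. apply tends_ext_loc, filter_forall, H. Qed.

Lemma tends_plus f g a b :
  tends F f a -> tends F g b -> tends F (fun x => (f x + g x)%C) (a + b)%C.
Proof.
  intros Hf Hg eps He.
  generalize (filter_conj _ _ (Hf (eps/2) ltac:(lra)) (Hg (eps/2) ltac:(lra))).
  apply filter_imp. intros x (H1 & H2).
  replace (f x + g x - (a + b))%C
    with (f x - a + (g x - b))%C by ring.
  eapply Rle_lt_trans; [apply Cmod_triangle|lra].
Qed.

Lemma tends_opp f a : tends F f a -> tends F (fun x => (- f x)%C) (- a)%C.
Proof.
  intros Hf eps He. generalize (Hf eps He). apply filter_imp. intros x H.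
  replace (- f x - - a)%C with (- (f x - a))%C by ring.
  rewrite Cmod_opp. exact H.
Qed.

Lemma tends_minus f g a b :
  tends F f a -> tends F g b -> tends F (fun x => (f x - g x)%C) (a - b)%C.
Proof. intros Hf Hg. apply (tends_plus _ _ _ _ Hf (tends_opp _ _ Hg)). Qed.

Lemma tends_conj f a : tends F f a -> tends F (fun x => Cconj (f x)) (Cconj a).
Proof.
  intros Hf eps He. generalize (Hf eps He). apply filter_imp. intros x H.
  rewrite <- Cminus_conj, Cmod_conj. exact H.
Qed.

Lemma tends_bounded f a : tends F f a -> F (fun x => Cmod (f x) <= Cmod a + 1).
Proof.
  intros Hf. generalize (Hf 1 ltac:(lra)). apply filter_imp. intros x H.
  generalize (Cmod_le_minus (f x) a). lra.
Qed.

Lemma tends_zero_bounded f g M :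
  tends F f (RtoC 0) -> F (fun x => Cmod (g x) <= M) ->
  tends F (fun x => (f x * g x)%C) (RtoC 0).
Proof.
  intros Hf Hg eps He.
  assert (HM : 0 < Rabs M + 1) by (generalize (Rabs_pos M); lra).
  generalize (filter_conj _ _ (Hf (eps / (Rabs M + 1)) ltac:(apply Rdiv_lt_0_compat; lra)) Hg).
  apply filter_imp. intros x (H1 & H2).
  replace (f x - RtoC 0)%C with (f x) in H1 by ring.
  replace (f x * g x - RtoC 0)%C with (f x * g x)%C by ring.
  rewrite Cmod_mult.
  apply Rle_lt_trans with (Cmod (f x) * (Rabs M + 1)).
  - apply Rmult_le_compat_l; [apply Cmod_ge_0|]. generalize (Rle_abs M). lra.
  - apply Rmult_lt_reg_r with (/ (Rabs M + 1)); [apply Rinv_0_lt_compat; lra|].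
    rewrite Rmult_assoc, Rinv_r by lra. rewrite Rmult_1_r. exact H1.
Qed.

Lemma tends_mult f g a b :
  tends F f a -> tends F g b -> tends F (fun x => (f x * g x)%C) (a * b)%C.
Proof.
  intros Hf Hg.
  apply tends_ext with (fun x => ((f x - a) * g x + ((g x - b) * a + a * b))%C).
  { intros x. ring. }
  apply tends_eq with (RtoC 0 + (RtoC 0 + a * b))%C; [|ring].
  assert (Z : forall h l, tends F h l -> tends F (fun x => (h x - l)%C) (RtoC 0)).
  { intros h l Hh. replace (RtoC 0) with (l - l)%C by ring.
    apply tends_minus; [exact Hh|apply tends_const]. }
  apply tends_plus; [|apply tends_plus; [|apply tends_const]].
  - apply tends_zero_bounded with (Cmod b + 1); [now apply Z|now apply tends_bounded].
  - apply tends_zero_bounded with (Cmod a); [now apply Z|].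
    apply filter_forall. intros _. lra.
Qed.

Lemma tends_nonzero f a :
  a <> RtoC 0 -> tends F f a -> F (fun x => Cmod a / 2 < Cmod (f x)).
Proof.
  intros Ha Hf. assert (0 < Cmod a) by now apply Cmod_gt_0.
  generalize (Hf (Cmod a / 2) ltac:(lra)). apply filter_imp. intros x H1.
  generalize (Cmod_le_minus a (f x)). rewrite Cmod_minus_sym. lra.
Qed.

Lemma tends_inv f a :
  a <> RtoC 0 -> tends F f a -> tends F (fun x => (/ f x)%C) (/ a)%C.
Proof.
  intros Ha Hf. assert (Hp : 0 < Cmod a) by now apply Cmod_gt_0.
  assert (Hb := tends_nonzero _ _ Ha Hf).
  assert (H0 : tends F (fun x => ((a - f x) * / (f x * a))%C) (RtoC 0)).
  { apply tends_zero_bounded with (/ (Cmod a / 2 * Cmod a)).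
    - replace (RtoC 0) with (a - a)%C by ring.
      apply tends_minus; [apply tends_const|exact Hf].
    - generalize Hb. apply filter_imp. intros x Hx.
      rewrite Cmod_inv, Cmod_mult.
      + apply Rinv_le_contravar; [apply Rmult_lt_0_compat; lra|].
        apply Rmult_le_compat_r; lra.
      + apply Cmult_neq_0; auto. apply Cmod_gt_0. lra. }
  apply tends_eq with (RtoC 0 + / a)%C; [|ring].
  apply tends_ext_loc with
    (fun x => ((a - f x) * / (f x * a) + / a)%C).
  - generalize Hb. apply filter_imp. intros x Hx.
    field. split; auto. apply Cmod_gt_0. lra.
  - apply tends_plus; [exact H0|apply tends_const].
Qed.

Lemma tends_div f g a b : b <> RtoC 0 ->
  tends F f a -> tends F g b -> tends F (fun x => (f x / g x)%C) (a / b)%C.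
Proof. intros Hb Hf Hg. apply tends_mult; auto. now apply tends_inv. Qed.

Lemma tends_comp {U} (G : (U -> Prop) -> Prop) (h : T -> U) (f : U -> C) l :
  (forall P, G P -> F (fun x => P (h x))) ->
  tends G f l -> tends F (fun x => f (h x)) l.
Proof. intros H Hf eps He. apply (H _ (Hf eps He)). Qed.

Lemma tends_le (f : T -> C) l (g : T -> R) :
  F (fun x => Cmod (f x - l) <= g x) ->
  (forall eps, 0 < eps -> F (fun x => g x < eps)) -> tends F f l.
Proof.
  intros H Hg eps He. generalize (filter_conj _ _ H (Hg eps He)).
  apply filter_imp. intros x (H1 & H2). lra.
Qed.

Lemma tends_Cmod_le (f : T -> C) l M {PF : ProperFilter F} :
  tends F f l -> F (fun x => Cmod (f x) <= M) -> Cmod l <= M.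
Proof.
  intros Hf HM. apply le_epsilon. intros eps He.
  destruct (filter_ex _ (filter_conj _ _ (Hf eps He) HM)) as (x & H1 & H2).
  generalize (Cmod_le_minus l (f x)). rewrite Cmod_minus_sym. lra.
Qed.

End Tends.

Lemma tends_unique {T} (F : (T -> Prop) -> Prop) {PF : ProperFilter F} f a b :
  tends F f a -> tends F f b -> a = b.
Proof.
  intros Ha Hb.
  assert (H : Cmod (a - b) <= 0).
  { apply le_epsilon. intros eps He.
    destruct (filter_ex _ (filter_conj _ _ (Ha (eps/2) ltac:(lra)) (Hb (eps/2) ltac:(lra))))
      as (x & H1 & H2).
    generalize (Cmod_minus_le a (f x) b). rewrite (Cmod_minus_sym a (f x)). lra. }
  assert (E : (a - b)%C = RtoC 0)
    by (apply Cmod_eq_0; generalize (Cmod_ge_0 (a - b)%C); lra).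
  replace a with (a - b + b)%C by ring. rewrite E. ring.
Qed.

Lemma nb_pnb D p (P : C -> Prop) : nb p P -> pnb D p P.
Proof. intros (d & Hd & H). exists d; split; auto. Qed.

Lemma pnb_neq D p : pnb D p (fun z => z <> p).
Proof. exists 1; split; [lra|auto]. Qed.

Lemma pnb_nb p (P : C -> Prop) : punct p P -> P p -> nb p P.
Proof.
  intros (d & Hd & H) Hp. exists d; split; auto. intros w Hw.
  destruct (excluded_middle_informative (w = p)) as [->|Hn]; auto.
Qed.

Lemma nb_neq (p q : C) : p <> q -> nb p (fun z => z <> q).
Proof.
  intros H. exists (Cmod (p - q)); split.
  - apply Cmod_gt_0. intros E. apply H.
    replace p with (p - q + q)%C by ring. rewrite E. ring.
  - intros w Hw ->. rewrite Cmod_minus_sym in Hw. lra.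
Qed.

Lemma Cminus_neq_0 (a b : C) : a <> b -> (a - b)%C <> RtoC 0.
Proof.
  intros H E. apply H. replace a with (a - b + b)%C by ring. rewrite E. ring.
Qed.

Lemma tends_id_nb p : tends (nb p) (fun z => z) p.
Proof. intros eps He. exists eps; split; auto. Qed.

Lemma tends_nb_pnb D p f l : tends (nb p) f l -> tends (pnb D p) f l.
Proof. intros H eps He. apply nb_pnb, H, He. Qed.

Lemma tends_id_pnb D p : tends (pnb D p) (fun z => z) p.
Proof. apply tends_nb_pnb, tends_id_nb. Qed.

Lemma tends_inv_inf : tends nbinf (fun z => (/ z)%C) (RtoC 0).
Proof.
  intros eps He. exists (/ eps). intros z Hz.
  assert (0 < / eps) by (apply Rinv_0_lt_compat; lra).
  assert (Hz0 : z <> RtoC 0) by (apply Cmod_gt_0; lra).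
  replace (/ z - RtoC 0)%C with (/ z)%C by ring.
  rewrite Cmod_inv by auto.
  replace eps with (/ / eps) by (field; lra).
  apply Rinv_lt_contravar; auto. apply Rmult_lt_0_compat; lra.
Qed.

Lemma nbinf_neq (q : C) : nbinf (fun z => z <> q).
Proof. exists (Cmod q). intros z Hz ->. lra. Qed.

Lemma nbinf_conj (P : C -> Prop) : nbinf P -> nbinf (fun z => P (Cconj z)).
Proof. intros (r & H). exists r. intros z Hz. apply H. now rewrite Cmod_conj. Qed.

Lemma pnb_conj p (P : C -> Prop) :
  punct (Cconj p) P -> punct p (fun z => P (Cconj z)).
Proof.
  intros (r & Hr & H). exists r; split; auto. intros z _ Hz Hd. apply H; auto.
  - intros E. apply Hz. rewrite <- (Cconj_conj z), E. apply Cconj_conj.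
  - now rewrite <- Cminus_conj, Cmod_conj.
Qed.

Definition ccont (f : C -> C) (z : C) : Prop := tends (nb z) f (f z).

Lemma ccont_ext_loc f g z : nb z (fun w => f w = g w) -> ccont f z -> ccont g z.
Proof.
  intros H Hf. unfold ccont. replace (g z) with (f z).
  - now apply tends_ext_loc with f.
  - destruct H as (d & Hd & H). apply H.
    replace (z - z)%C with (RtoC 0) by ring. now rewrite Cmod_0.
Qed.

Lemma ccont_const c z : ccont (fun _ => c) z.
Proof. apply (tends_const (F := nb z)). Qed.
Lemma ccont_id z : ccont (fun w => w) z.
Proof. apply tends_id_nb. Qed.
Lemma ccont_plus f g z : ccont f z -> ccont g z -> ccont (fun w => (f w + g w)%C) z.
Proof. apply tends_plus. Qed.
Lemma ccont_minus f g z : ccont f z -> ccont g z -> ccont (fun w => (f w - g w)%C) z.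
Proof. apply tends_minus. Qed.
Lemma ccont_mult f g z : ccont f z -> ccont g z -> ccont (fun w => (f w * g w)%C) z.
Proof. apply tends_mult. Qed.
Lemma ccont_div f g z : g z <> RtoC 0 ->
  ccont f z -> ccont g z -> ccont (fun w => (f w / g w)%C) z.
Proof. apply tends_div. Qed.

Lemma ccont_nb f z : ccont f z -> forall P, nb (f z) P -> nb z (fun w => P (f w)).
Proof.
  intros Hf P (d & Hd & H). generalize (Hf d Hd). apply filter_imp. intros w. apply H.
Qed.

Lemma ccont_comp f g z : ccont f z -> ccont g (f z) -> ccont (fun w => g (f w)) z.
Proof. intros Hf Hg. apply (tends_comp (nb (f z)) f g); auto. now apply ccont_nb. Qed.

(** Division is total, so a quotient has a meaningless value at [p]; overwriting it by the limit
    turns a punctured limit into continuity at [p]. *)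
Definition upd (f : C -> C) (p v : C) : C -> C :=
  fun z => if excluded_middle_informative (z = p) then v else f z.

Lemma upd_eq f p v : upd f p v p = v.
Proof. unfold upd. destruct (excluded_middle_informative (p = p)); tauto. Qed.
Lemma upd_neq f p v z : z <> p -> upd f p v z = f z.
Proof. unfold upd. destruct (excluded_middle_informative (z = p)); tauto. Qed.
Lemma upd_nb f p v z : z <> p -> nb z (fun w => f w = upd f p v w).
Proof.
  intros H. generalize (nb_neq z p H). apply filter_imp. intros w Hw. now rewrite upd_neq.
Qed.

Lemma ccont_upd f p v : tends (punct p) f v -> ccont (upd f p v) p.
Proof.
  intros H eps He. rewrite upd_eq. apply pnb_nb.
  - generalize (filter_conj _ _ (pnb_neq (fun _ => True) p) (H eps He)). apply filter_imp.
    intros z (Hz & Hd). now rewrite upd_neq.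
  - rewrite upd_eq. replace (v - v)%C with (RtoC 0) by ring. now rewrite Cmod_0.
Qed.

Lemma tends_quotient_cont f z d :
  tends (punct z) (fun w => ((f w - f z) / (w - z))%C) d ->
  ccont f z.
Proof.
  intros H.
  assert (tends (punct z) f (f z)).
  { apply tends_ext_loc with
      (fun w => ((f w - f z) / (w - z) * (w - z) + f z)%C).
    - generalize (pnb_neq (fun _ => True) z). apply filter_imp. intros w Hw.
      field. now apply Cminus_neq_0.
    - apply tends_eq with (d * (z - z) + f z)%C; [|ring].
      apply tends_plus; [|apply tends_const]. apply tends_mult; auto.
      apply tends_minus; [apply tends_id_pnb|apply tends_const]. }
  intros eps He. apply pnb_nb; auto.
  replace (f z - f z)%C with (RtoC 0) by ring. now rewrite Cmod_0.
Qed.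

Lemma cdiff_cont f z : cdiff f z -> ccont f z.
Proof. intros (d & H). now apply tends_quotient_cont with d. Qed.

Lemma cdiff_ext_loc f g z : nb z (fun w => f w = g w) -> cdiff f z -> cdiff g z.
Proof.
  intros H (d & Hd). exists d.
  assert (E : f z = g z).
  { destruct H as (e & He & H). apply H.
    replace (z - z)%C with (RtoC 0) by ring. now rewrite Cmod_0. }
  apply (tends_ext_loc (F := punct z)
    (fun w => ((f w - f z) / (w - z))%C)); auto.
  generalize (nb_pnb (fun _ => True) _ _ H). apply filter_imp. intros w Hw. now rewrite Hw, E.
Qed.

Lemma cdiff_ext f g z : (forall w, f w = g w) -> cdiff f z -> cdiff g z.
Proof. intros H. apply cdiff_ext_loc, filter_forall, H. Qed.

Lemma cdiff_const c z : cdiff (fun _ => c) z.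
Proof.
  exists (RtoC 0). apply (tends_ext (F := punct z) (fun _ => RtoC 0)).
  - intros w. unfold Cdiv. ring.
  - apply (tends_const (F := punct z)).
Qed.

Lemma cdiff_id z : cdiff (fun w => w) z.
Proof.
  exists (RtoC 1). apply (tends_ext_loc (F := punct z) (fun _ => RtoC 1)).
  - generalize (pnb_neq (fun _ => True) z). apply filter_imp. intros w Hw. symmetry.
    apply Cinv_r. now apply Cminus_neq_0.
  - apply (tends_const (F := punct z)).
Qed.

Lemma cdiff_plus f g z : cdiff f z -> cdiff g z -> cdiff (fun w => (f w + g w)%C) z.
Proof.
  intros (a & Ha) (b & Hb). exists (a + b)%C.
  eapply (tends_ext (F := punct z)); [|apply (tends_plus _ _ _ _ Ha Hb)].
  intros w. simpl. unfold Cdiv. ring.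
Qed.

Lemma cdiff_mult f g z : cdiff f z -> cdiff g z -> cdiff (fun w => (f w * g w)%C) z.
Proof.
  intros Hf Hg. assert (Hc := tends_nb_pnb (fun _ => True) _ _ _ (cdiff_cont _ _ Hg)).
  destruct Hf as (a & Ha), Hg as (b & Hb).
  exists (a * g z + f z * b)%C.
  eapply (tends_ext (F := punct z));
    [|apply tends_plus; [apply (tends_mult _ _ _ _ Ha Hc)|
       apply (tends_mult _ _ _ _ (tends_const (f z)) Hb)]].
  intros w. simpl. unfold Cdiv. ring.
Qed.

Lemma cdiff_opp f z : cdiff f z -> cdiff (fun w => (- f w)%C) z.
Proof.
  intros H. apply cdiff_ext with (fun w => (RtoC (-1) * f w)%C).
  - intros w. apply injective_projections; simpl; ring.
  - apply cdiff_mult; auto. apply cdiff_const.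
Qed.

Lemma cdiff_minus f g z : cdiff f z -> cdiff g z -> cdiff (fun w => (f w - g w)%C) z.
Proof. intros Hf Hg. apply (cdiff_plus f (fun w => (- g w)%C)); auto. now apply cdiff_opp. Qed.

Lemma cdiff_inv f z : f z <> RtoC 0 -> cdiff f z -> cdiff (fun w => (/ f w)%C) z.
Proof.
  intros H0 Hf. assert (Hc := tends_nb_pnb (fun _ => True) _ _ _ (cdiff_cont _ _ Hf)).
  destruct Hf as (a & Ha).
  exists (- a * / (f z * f z))%C.
  eapply (tends_ext_loc (F := punct z));
    [|apply tends_mult; [apply (tends_opp _ _ Ha)|
       apply tends_inv; [|apply (tends_mult _ _ _ _ Hc (tends_const (f z)))]]].
  - generalize (filter_conj _ _ (pnb_neq (fun _ => True) z) (tends_nonzero _ _ H0 Hc)).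
    apply filter_imp. intros w (Hw & Hm). simpl.
    assert (Hf0 : f w <> RtoC 0).
    { apply Cmod_gt_0. generalize (Cmod_ge_0 (f z)). lra. }
    assert (Hw0 := Cminus_neq_0 _ _ Hw). field. auto.
  - now apply Cmult_neq_0.
Qed.

Lemma cdiff_div f g z : g z <> RtoC 0 -> cdiff f z -> cdiff g z ->
  cdiff (fun w => (f w / g w)%C) z.
Proof. intros H0 Hf Hg. apply (cdiff_mult f (fun w => (/ g w)%C)); auto. now apply cdiff_inv. Qed.

Lemma cdiff_comp f g z : cdiff f z -> cdiff g (f z) -> cdiff (fun w => g (f w)) z.
Proof.
  intros Hf (b & Hb). assert (Hc := cdiff_cont _ _ Hf). destruct Hf as (a & Ha).
  exists (b * a)%C.
  (* Points with [f w = f z] may accumulate at [z]; the difference quotient of [g], completed by [b]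
     at [f z], is defined at them too and is continuous. *)
  set (psi := upd (fun y => ((g y - g (f z)) / (y - f z))%C) (f z) b).
  apply (tends_ext_loc (F := punct z)
    (fun w => (psi (f w) * ((f w - f z) / (w - z)))%C)).
  - generalize (pnb_neq (fun _ => True) z). apply filter_imp. intros w Hw.
    assert (Hw0 := Cminus_neq_0 _ _ Hw).
    destruct (excluded_middle_informative (f w = f z)) as [E|E].
    + rewrite E. unfold Cdiv. ring.
    + unfold psi. rewrite upd_neq by auto. assert (E0 := Cminus_neq_0 _ _ E).
      field. auto.
  - apply tends_mult; auto. apply tends_nb_pnb.
    assert (Hp : ccont psi (f z)) by (apply ccont_upd; exact Hb).
    replace b with (psi (f z)) by apply upd_eq.
    now apply (ccont_comp f psi).
Qed.

(** Schwarz reflection. It preserves holomorphy and swaps upper and lower poles, so half of the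
    matrix entries are obtained from the other half. *)
Definition sch (f : C -> C) : C -> C := fun z => Cconj (f (Cconj z)).

Lemma sch_sch f z : sch (sch f) z = f z.
Proof. unfold sch. now rewrite !Cconj_conj. Qed.

Lemma cdiff_sch f z : cdiff f (Cconj z) -> cdiff (sch f) z.
Proof.
  intros (d & H). exists (Cconj d).
  apply (tends_ext_loc (F := punct z) (fun w => Cconj
    ((f (Cconj w) - f (Cconj z)) / (Cconj w - Cconj z))%C)).
  - generalize (pnb_neq (fun _ => True) z). apply filter_imp. intros w Hw.
    rewrite Cdiv_conj, !Cminus_conj, !Cconj_conj; [reflexivity|].
    rewrite <- Cminus_conj. intros E. apply (Cminus_neq_0 _ _ Hw).
    rewrite <- (Cconj_conj (w - z)%C), E.
    apply injective_projections; simpl; ring.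
  - apply tends_conj.
    apply (tends_comp (punct (Cconj z)) Cconj
      (fun y => ((f y - f (Cconj z)) / (y - Cconj z))%C)); auto.
    apply pnb_conj.
Qed.

Lemma RtoC_conj (r : R) : Cconj (RtoC r) = RtoC r.
Proof. apply injective_projections; simpl; ring. Qed.

(** * The complex exponential: algebra, second-order estimate, derivative *)

Lemma cexp_plus (z w : C) : cexp (z + w)%C = (cexp z * cexp w)%C.
Proof.
  unfold cexp. simpl. rewrite exp_plus, cos_plus, sin_plus.
  apply injective_projections; simpl; ring.
Qed.

Lemma cexp_0 : cexp (RtoC 0) = RtoC 1.
Proof. unfold cexp; simpl. rewrite exp_0, cos_0, sin_0. apply injective_projections; simpl; ring. Qed.

Lemma Cmod_cexp (z : C) : Cmod (cexp z) = exp (fst z).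
Proof.
  unfold Cmod, cexp. simpl.
  replace (exp (fst z) * cos (snd z) * (exp (fst z) * cos (snd z) * 1) +
    exp (fst z) * sin (snd z) * (exp (fst z) * sin (snd z) * 1))
    with (Rsqr (exp (fst z)) * (Rsqr (sin (snd z)) + Rsqr (cos (snd z)))) by (unfold Rsqr; ring).
  rewrite sin2_cos2, Rmult_1_r. apply sqrt_Rsqr. left. apply exp_pos.
Qed.

Lemma cexp_neq_0 (z : C) : cexp z <> RtoC 0.
Proof. apply Cmod_gt_0. rewrite Cmod_cexp. apply exp_pos. Qed.

Lemma cexp_opp (z : C) : cexp (- z)%C = (/ cexp z)%C.
Proof.
  assert (H := cexp_neq_0 z).
  assert (E : (cexp z * cexp (- z)%C)%C = RtoC 1).
  { rewrite <- cexp_plus. replace (z + - z)%C with (RtoC 0) by ring. apply cexp_0. }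
  replace (cexp (- z)%C) with (cexp z * cexp (- z)%C * / cexp z)%C
    by (field; auto).
  rewrite E. ring.
Qed.

Lemma cexp_conj (z : C) : cexp (Cconj z) = Cconj (cexp z).
Proof.
  unfold cexp, Cconj; simpl. rewrite cos_neg, sin_neg.
  apply injective_projections; simpl; ring.
Qed.

Lemma Rabs_sin_le (y : R) : Rabs (sin y) <= Rabs y.
Proof.
  destruct (MVT_gen sin 0 y cos) as (c & _ & Hc).
  - intros x _. auto_derive; auto. ring.
  - intros x _. apply continuity_pt_filterlim, continuous_sin.
  - rewrite sin_0, !Rminus_0_r in Hc. rewrite Hc, Rabs_mult.
    assert (Rabs (cos c) <= 1) by (apply Rabs_le, COS_bound).
    generalize (Rabs_pos y). nra.
Qed.

Lemma one_minus_cos_le (y : R) : 0 <= 1 - cos y <= y ^ 2 / 2.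
Proof.
  replace y with (2 * (y / 2)) at 1 2 by field. rewrite cos_2a_sin.
  assert (H := Rabs_sin_le (y/2)).
  assert (Rsqr (sin (y/2)) <= Rsqr (y/2)) by now apply Rsqr_le_abs_1.
  unfold Rsqr in *. generalize (Rle_0_sqr (sin (y/2))). unfold Rsqr. nra.
Qed.

Lemma Rabs_sin_minus_le (y : R) : Rabs y <= 1 -> Rabs (sin y - y) <= y ^ 2.
Proof.
  intros Hy.
  destruct (MVT_gen (fun t => sin t - t) 0 y (fun t => cos t - 1)) as (c & Hc1 & Hc).
  - intros x _. auto_derive; auto. ring.
  - intros x _. apply continuity_pt_filterlim.
    apply (continuous_minus (fun t => sin t) (fun t => t)); [apply continuous_sin|apply continuous_id].
  - rewrite sin_0, !Rminus_0_r in Hc. rewrite Hc, Rabs_mult.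
    generalize (one_minus_cos_le c). intros (H1 & H2).
    assert (Hcy : Rabs c <= Rabs y).
    { revert Hc1. unfold Rmin, Rmax, Rabs. destruct (Rle_dec 0 y);
      repeat destruct Rcase_abs; lra. }
    rewrite Rabs_left1 by lra.
    assert (c ^ 2 <= y ^ 2).
    { rewrite <- (pow2_abs c), <- (pow2_abs y). apply pow_incr. split; auto. apply Rabs_pos. }
    assert (0 <= Rabs y) by apply Rabs_pos.
    rewrite <- (pow2_abs y) in *. nra.
Qed.

(** The upper bound comes from [1 - x <= exp (- x)], hence [exp x <= 1 / (1 - x)], which is at most
    [1 + x + 2 * x ^ 2] for [x <= 1/2]. *)
Lemma exp_second_order (x : R) : Rabs x <= / 2 -> 0 <= exp x - 1 - x <= 2 * x ^ 2.
Proof.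
  intros H. assert (Hx := Rabs_def2 x (3/4) ltac:(lra)).
  assert (Hb : - / 2 <= x <= / 2) by (apply Rabs_le_between; auto).
  split; [generalize (exp_ineq1_le x); lra|].
  assert (H1 := exp_ineq1_le (- x)). rewrite exp_Ropp in H1.
  assert (He := exp_pos x).
  assert (exp x * (1 - x) <= 1).
  { replace 1 with (exp x * / exp x) at 2 by (field; lra).
    apply Rmult_le_compat_l; lra. }
  assert (exp x <= / (1 - x)).
  { apply Rmult_le_reg_r with (1 - x); [lra|]. rewrite Rinv_l by lra. lra. }
  assert (/ (1 - x) <= 1 + x + 2 * x ^ 2).
  { apply Rmult_le_reg_r with (1 - x); [lra|]. rewrite Rinv_l by lra. nra. }
  lra.
Qed.

(** Real and imaginary parts contribute [4 * Cmod z ^ 2] each. The estimate yields the derivative of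
    [cexp] and later the comparison of a Blaschke product with its exponential limit. *)
Lemma cexp_second_order (z : C) : Cmod z <= / 2 ->
  Cmod (cexp z - (RtoC 1 + z)) <= 8 * Cmod z ^ 2.
Proof.
  intros H. destruct z as (x, y).
  assert (Hm := Rmax_Cmod (x, y)). simpl in Hm.
  assert (Hx : Rabs x <= Cmod (x, y)) by (eapply Rle_trans; [|exact Hm]; apply Rmax_l).
  assert (Hy : Rabs y <= Cmod (x, y)) by (eapply Rle_trans; [|exact Hm]; apply Rmax_r).
  set (m := Cmod (x, y)) in *.
  assert (E1 := exp_second_order x ltac:(lra)).
  assert (E2 := one_minus_cos_le y).
  assert (E3 := Rabs_sin_minus_le y ltac:(lra)).
  assert (E4 := Rabs_sin_le y).
  assert (X2 : x ^ 2 <= m ^ 2).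
  { rewrite <- (pow2_abs x). apply pow_incr. split; auto. apply Rabs_pos. }
  assert (Y2 : y ^ 2 <= m ^ 2).
  { rewrite <- (pow2_abs y). apply pow_incr. split; auto. apply Rabs_pos. }
  assert (Hxb : - / 2 <= x <= / 2) by (apply Rabs_le_between; lra).
  assert (M0 : 0 <= m ^ 2) by (apply pow2_ge_0).
  assert (Hc := COS_bound y).
  set (u := exp x * cos y - (1 + x)). set (v := exp x * sin y - (0 + y)).
  assert (Hu : Rabs u <= 4 * m ^ 2).
  { unfold u. replace (exp x * cos y - (1 + x))
      with ((exp x - 1 - x) * cos y + (1 + x) * (cos y - 1)) by ring.
    eapply Rle_trans; [apply Rabs_triang|]. rewrite !Rabs_mult.
    rewrite (Rabs_right (exp x - 1 - x)) by lra. rewrite (Rabs_left1 (cos y - 1)) by lra.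
    rewrite (Rabs_right (1 + x)) by lra.
    assert (Rabs (cos y) <= 1) by (apply Rabs_le; lra). nra. }
  assert (Hv : Rabs v <= 4 * m ^ 2).
  { unfold v. replace (exp x * sin y - (0 + y))
      with ((exp x - 1 - x) * sin y + x * sin y + (sin y - y)) by ring.
    eapply Rle_trans; [apply Rabs_triang|].
    assert (Rabs ((exp x - 1 - x) * sin y) <= 2 * m ^ 2).
    { rewrite Rabs_mult, (Rabs_right (exp x - 1 - x)) by lra.
      assert (Rabs (sin y) <= 1) by (apply Rabs_le, SIN_bound).
      generalize (Rabs_pos (sin y)). nra. }
    assert (Rabs (x * sin y) <= m ^ 2).
    { rewrite Rabs_mult. generalize (Rabs_pos x) (Rabs_pos (sin y)). nra. }
    generalize (Rabs_triang ((exp x - 1 - x) * sin y) (x * sin y)). lra. }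
  replace (cexp (x, y) - (RtoC 1 + (x, y)%R))%C with (u, v).
  - replace (u, v) with (RtoC u + Ci * RtoC v)%C.
    + eapply Rle_trans; [apply Cmod_triangle|].
      rewrite Cmod_mult, Cmod_Ci, !Cmod_R. lra.
    + apply injective_projections; simpl; ring.
  - unfold u, v, cexp. apply injective_projections; simpl; ring.
Qed.

Lemma cdiff_cexp (z : C) : cdiff cexp z.
Proof.
  exists (cexp z).
  apply (tends_le (F := punct z) _ _
    (fun w => Cmod (cexp z) * (8 * Cmod (w - z)))).
  - exists (/ 2). split; [lra|]. intros w _ Hw Hd.
    assert (Hw0 := Cminus_neq_0 _ _ Hw).
    assert (Hp : 0 < Cmod (w - z)) by now apply Cmod_gt_0.
    replace ((cexp w - cexp z) / (w - z) - cexp z)%C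
      with (cexp z * ((cexp (w - z)%C - (RtoC 1 + (w - z))) / (w - z)))%C.
    + rewrite Cmod_mult, Cmod_div by auto. apply Rmult_le_compat_l; [apply Cmod_ge_0|].
      apply Rmult_le_reg_r with (Cmod (w - z)); auto.
      unfold Rdiv. rewrite Rmult_assoc, Rinv_l by lra.
      generalize (cexp_second_order (w - z)%C ltac:(lra)). lra.
    + replace (cexp w) with (cexp z * cexp (w - z)%C)%C.
      * field. auto.
      * rewrite <- cexp_plus. f_equal. ring.
  - intros eps He. assert (Hc : 0 < Cmod (cexp z)) by (apply Cmod_gt_0, cexp_neq_0).
    exists (eps / (8 * Cmod (cexp z))). split; [apply Rdiv_lt_0_compat; lra|].
    intros w _ _ Hd. apply Rmult_lt_compat_r with (r := 8 * Cmod (cexp z)) in Hd; [|lra].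
    unfold Rdiv in Hd. rewrite Rmult_assoc, Rinv_l in Hd by lra. lra.
Qed.

(** * Path integrals and Goursat's lemma *)

Definition pcont (g : R -> C) (t : R) : Prop := tends (locally t) g (g t).

Lemma Cmod_le_sum (z : C) : Cmod z <= Rabs (fst z) + Rabs (snd z).
Proof.
  replace z with (RtoC (fst z) + Ci * RtoC (snd z))%C at 1.
  - eapply Rle_trans; [apply Cmod_triangle|]. rewrite Cmod_mult, Cmod_Ci, !Cmod_R. lra.
  - apply injective_projections; simpl; ring.
Qed.

Lemma Rabs_fst_le (z : C) : Rabs (fst z) <= Cmod z.
Proof. eapply Rle_trans; [|apply Rmax_Cmod]. apply Rmax_l. Qed.
Lemma Rabs_snd_le (z : C) : Rabs (snd z) <= Cmod z.
Proof. eapply Rle_trans; [|apply Rmax_Cmod]. apply Rmax_r. Qed.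

Lemma pcont_fst g t : pcont g t -> continuous (fun t => fst (g t)) t.
Proof.
  intros H. apply filterlim_locally. intros eps. generalize (H eps (cond_pos eps)).
  apply filter_imp. intros x Hx. eapply Rle_lt_trans; [|exact Hx].
  apply (Rabs_fst_le (g x - g t)%C).
Qed.
Lemma pcont_snd g t : pcont g t -> continuous (fun t => snd (g t)) t.
Proof.
  intros H. apply filterlim_locally. intros eps. generalize (H eps (cond_pos eps)).
  apply filter_imp. intros x Hx. eapply Rle_lt_trans; [|exact Hx].
  apply (Rabs_snd_le (g x - g t)%C).
Qed.

Lemma pcont_pair (x y : R -> R) t :
  continuous x t -> continuous y t -> pcont (fun s => (x s, y s)) t.
Proof.
  intros Hx Hy eps He.
  assert (He2 : 0 < eps / 2) by lra.
  generalize (filter_conj _ _ (proj1 (filterlim_locally x (x t)) Hx (mkposreal _ He2))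
                              (proj1 (filterlim_locally y (y t)) Hy (mkposreal _ He2))).
  apply filter_imp. intros s (H1 & H2).
  eapply Rle_lt_trans; [apply Cmod_le_sum|]. simpl.
  change (Rabs (x s - x t) < eps / 2) in H1. change (Rabs (y s - y t) < eps / 2) in H2.
  unfold Rminus in *. lra.
Qed.

Lemma pcont_comp (f : C -> C) g t : pcont g t -> ccont f (g t) -> pcont (fun s => f (g s)) t.
Proof.
  intros Hg Hf. apply (tends_comp (nb (g t)) g f); auto.
  intros P (d & Hd & H). generalize (Hg d Hd). apply filter_imp. intros s. apply H.
Qed.

Definition is_CI (g : R -> C) (a b : R) (I : C) : Prop :=
  is_RInt (fun t => fst (g t)) a b (fst I) /\ is_RInt (fun t => snd (g t)) a b (snd I).
Definition CI (g : R -> C) (a b : R) : C :=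
  (RInt (fun t => fst (g t)) a b, RInt (fun t => snd (g t)) a b).

Lemma is_CI_unique g a b I : is_CI g a b I -> CI g a b = I.
Proof.
  intros (H1 & H2). unfold CI. apply injective_projections; simpl; now apply is_RInt_unique.
Qed.

Lemma CI_correct g a b : a <= b -> (forall t, a <= t <= b -> pcont g t) ->
  is_CI g a b (CI g a b).
Proof.
  intros Hab H. split; simpl; apply (RInt_correct (V := R_CompleteNormedModule));
    apply (ex_RInt_continuous (V := R_CompleteNormedModule)); intros t;
    rewrite Rmin_left, Rmax_right by lra; intros Ht.
  - now apply pcont_fst, H.
  - now apply pcont_snd, H.
Qed.

Lemma is_CI_plus f g a b I J : is_CI f a b I -> is_CI g a b J ->
  is_CI (fun t => (f t + g t)%C) a b (I + J)%C.
Proof.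
  intros (H1 & H2) (H3 & H4).
  split; simpl; apply (is_RInt_plus (V := R_NormedModule)); auto.
Qed.

Lemma is_CI_scal c f a b I : is_CI f a b I ->
  is_CI (fun t => (c * f t)%C) a b (c * I)%C.
Proof.
  intros (H1 & H2). split; simpl.
  - apply (is_RInt_minus (V := R_NormedModule)); apply (is_RInt_scal (V := R_NormedModule)); auto.
  - apply (is_RInt_plus (V := R_NormedModule)); apply (is_RInt_scal (V := R_NormedModule)); auto.
Qed.

Lemma is_CI_minus f g a b I J : is_CI f a b I -> is_CI g a b J ->
  is_CI (fun t => (f t - g t)%C) a b (I - J)%C.
Proof.
  intros (H1 & H2) (H3 & H4).
  split; simpl; apply (is_RInt_minus (V := R_NormedModule)); auto.
Qed.

Lemma is_CI_const c a b : is_CI (fun _ => c) a b (c * RtoC (b - a))%C.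
Proof.
  split; simpl.
  - replace (fst c * (b - a) - snd c * 0) with ((b - a) * fst c) by ring.
    apply (is_RInt_const (V := R_NormedModule)).
  - replace (fst c * 0 + snd c * (b - a)) with ((b - a) * snd c) by ring.
    apply (is_RInt_const (V := R_NormedModule)).
Qed.

Lemma CI_ext f g a b : a <= b -> (forall t, a <= t <= b -> f t = g t) -> CI f a b = CI g a b.
Proof.
  intros Hab E. unfold CI. f_equal; apply RInt_ext; intros t;
    rewrite Rmin_left, Rmax_right by lra; intros Ht; rewrite E; auto; lra.
Qed.

Lemma is_CI_Chasles f a b c I J : is_CI f a b I -> is_CI f b c J ->
  is_CI f a c (I + J)%C.
Proof.
  intros (H1 & H2) (H3 & H4). split; simpl.
  - apply (is_RInt_Chasles (V := R_NormedModule)) with b; auto.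
  - apply (is_RInt_Chasles (V := R_NormedModule)) with b; auto.
Qed.

Lemma CI_Chasles f a b c : a <= b <= c -> (forall t, a <= t <= c -> pcont f t) ->
  CI f a c = (CI f a b + CI f b c)%C.
Proof.
  intros Habc H. apply is_CI_unique, is_CI_Chasles with b; apply CI_correct;
    try lra; intros t Ht; apply H; lra.
Qed.

(** The factor 2 is the price of bounding real and imaginary parts separately; it reappears as
    [4 * PI] in the bounds on circles. *)
Lemma is_CI_bound f a b I m : a <= b -> is_CI f a b I ->
  (forall t, a <= t <= b -> Cmod (f t) <= m) -> Cmod I <= 2 * (b - a) * m.
Proof.
  intros Hab (H1 & H2) Hm.
  assert (B1 : Rabs (fst I) <= (b - a) * m).
  { apply (norm_RInt_le_const (V := R_NormedModule) (fun t => fst (f t)) a b); auto.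
    intros t Ht. eapply Rle_trans; [apply Rabs_fst_le|]. auto. }
  assert (B2 : Rabs (snd I) <= (b - a) * m).
  { apply (norm_RInt_le_const (V := R_NormedModule) (fun t => snd (f t)) a b); auto.
    intros t Ht. eapply Rle_trans; [apply Rabs_snd_le|]. auto. }
  eapply Rle_trans; [apply Cmod_le_sum|]. lra.
Qed.

Lemma is_CI_id a b : is_CI (fun t => RtoC t) a b (RtoC ((b ^ 2 - a ^ 2) / 2)).
Proof.
  split; simpl.
  - replace ((b * (b * 1) - a * (a * 1)) / 2) with (minus (b ^ 2 / 2) (a ^ 2 / 2)).
    + apply (is_RInt_derive (V := R_CompleteNormedModule) (fun t => t ^ 2 / 2)).
      * intros t _. auto_derive; auto. field.
      * intros t _. apply continuous_id.
    + unfold minus, plus, opp; simpl; unfold Rdiv; ring.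
  - generalize (is_RInt_const (V := R_NormedModule) a b 0).
    unfold scal; simpl; unfold mult; simpl. now rewrite Rmult_0_r.
Qed.

(** Counterclockwise boundary integral of a rectangle: bottom minus top, and [dz = i dy] on the
    vertical sides. *)
Definition RI (F : C -> C) (a b c d : R) : C :=
  (CI (fun x => F (x, c)) a b - CI (fun x => F (x, d)) a b + Ci * (CI (fun y => F (b, y)) c d - CI
      (fun y => F (a, y)) c d))%C.

Lemma continuous_R_const (c t : R) : continuous (fun _ : R => c) t.
Proof. apply (continuous_const (U := R_UniformSpace) (V := R_UniformSpace)). Qed.
Lemma continuous_R_id (t : R) : continuous (fun s : R => s) t.
Proof. apply (continuous_id (U := R_UniformSpace)). Qed.

Lemma pcont_horiz F x c : ccont F (x, c) -> pcont (fun s => F (s, c)) x.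
Proof.
  intros H. apply (pcont_comp F (fun s => (s, c))); auto.
  apply pcont_pair; [apply continuous_R_id|apply continuous_R_const].
Qed.
Lemma pcont_vert F x c : ccont F (x, c) -> pcont (fun s => F (x, s)) c.
Proof.
  intros H. apply (pcont_comp F (fun s => (x, s))); auto.
  apply pcont_pair; [apply continuous_R_const|apply continuous_R_id].
Qed.

Definition rcont (F : C -> C) a b c d : Prop :=
  forall x y, a <= x <= b -> c <= y <= d -> ccont F (x, y).

Lemma RI_split_x F a m b c d : a <= m <= b -> c <= d -> rcont F a b c d ->
  RI F a b c d = (RI F a m c d + RI F m b c d)%C.
Proof.
  intros Hm Hcd HF. unfold RI.
  rewrite (CI_Chasles (fun x => F (x, c)) a m b), (CI_Chasles (fun x => F (x, d)) a m b); auto.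
  - ring.
  - intros t Ht. apply pcont_horiz, HF; lra.
  - intros t Ht. apply pcont_horiz, HF; lra.
Qed.

Lemma RI_split_y F a b c m d : a <= b -> c <= m <= d -> rcont F a b c d ->
  RI F a b c d = (RI F a b c m + RI F a b m d)%C.
Proof.
  intros Hab Hm HF. unfold RI.
  rewrite (CI_Chasles (fun y => F (b, y)) c m d), (CI_Chasles (fun y => F (a, y)) c m d); auto.
  - ring.
  - intros t Ht. apply pcont_vert, HF; lra.
  - intros t Ht. apply pcont_vert, HF; lra.
Qed.

Lemma is_CI_affine (A B : C) a b :
  is_CI (fun t => (A + B * RtoC t)%C) a b
    (A * RtoC (b - a) + B * RtoC ((b ^ 2 - a ^ 2) / 2))%C.
Proof. apply is_CI_plus; [apply is_CI_const|apply is_CI_scal, is_CI_id]. Qed.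

(* Subtracting the affine part, whose boundary integral vanishes, leaves the error term. *)
Lemma RI_local F A B p eta a b c d : a <= b -> c <= d -> rcont F a b c d ->
  0 <= eta ->
  (forall x y, a <= x <= b -> c <= y <= d ->
     Cmod (F (x, y) - (A + B * ((x, y)%R - p))) <= eta) ->
  Cmod (RI F a b c d) <= 4 * ((b - a) + (d - c)) * eta.
Proof.
  intros Hab Hcd HF He H.
  assert (Hh : forall y, c <= y <= d -> exists e,
    CI (fun x => F (x, y)) a b =
      ((A + B * ((0, y)%R - p)) * RtoC (b - a) + B * RtoC ((b ^ 2 - a ^ 2) / 2) + e)%C /\ Cmod e <= 2
          * (b - a) * eta).
  { intros y Hy.
    assert (Hc := CI_correct (fun x => F (x, y)) a b Hab
       ltac:(intros t Ht; apply pcont_horiz, HF; lra)).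
    assert (Ha := is_CI_affine (A + B * ((0, y)%R - p))%C B a b).
    eexists (_ - _)%C. split; [|refine (is_CI_bound _ a b _ eta Hab (is_CI_minus _ _ _ _ _ _ Hc Ha) _)].
    - ring.
    - intros t Ht. simpl.
      replace (A + B * ((0, y)%R - p) + B * RtoC t)%C
        with (A + B * ((t, y)%R - p))%C; [apply H; auto|].
      apply injective_projections; simpl; ring. }
  assert (Hv : forall x, a <= x <= b -> exists e,
    CI (fun y => F (x, y)) c d =
      ((A + B * ((x, 0)%R - p)) * RtoC (d - c) + B * Ci * RtoC ((d ^ 2 - c ^ 2) / 2) + e)%C /\ Cmod e
          <= 2 * (d - c) * eta).
  { intros x Hx.
    assert (Hc := CI_correct (fun y => F (x, y)) c d Hcd
       ltac:(intros t Ht; apply pcont_vert, HF; lra)).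
    assert (Ha := is_CI_affine (A + B * ((x, 0)%R - p))%C (B * Ci)%C c d).
    eexists (_ - _)%C. split; [|refine (is_CI_bound _ c d _ eta Hcd (is_CI_minus _ _ _ _ _ _ Hc Ha) _)].
    - ring.
    - intros t Ht. simpl.
      replace (A + B * ((x, 0)%R - p) + B * Ci * RtoC t)%C
        with (A + B * ((x, t)%R - p))%C; [apply H; auto|].
      apply injective_projections; simpl; ring. }
  destruct (Hh c ltac:(lra)) as (e1 & E1 & B1), (Hh d ltac:(lra)) as (e2 & E2 & B2),
    (Hv b ltac:(lra)) as (e3 & E3 & B3), (Hv a ltac:(lra)) as (e4 & E4 & B4).
  unfold RI. rewrite E1, E2, E3, E4.
  match goal with |- Cmod ?X <= _ =>
    replace X with (e1 - e2 + Ci * (e3 - e4))%C end.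
  - eapply Rle_trans; [apply Cmod_triangle|]. rewrite Cmod_mult, Cmod_Ci.
    assert (Cmod (e1 - e2) <= Cmod e1 + Cmod e2)
      by (unfold Cminus; rewrite <- (Cmod_opp e2); apply Cmod_triangle).
    assert (Cmod (e3 - e4) <= Cmod e3 + Cmod e4)
      by (unfold Cminus; rewrite <- (Cmod_opp e4); apply Cmod_triangle).
    lra.
  - apply injective_projections; simpl; field.
Qed.

Lemma cdiff_affine_bound F p : cdiff F p -> forall eta, 0 < eta ->
  exists B del, 0 < del /\ forall z, Cmod (z - p) < del ->
    Cmod (F z - (F p + B * (z - p))) <= eta * Cmod (z - p).
Proof.
  intros (B & HB) eta He. exists B. destruct (HB eta He) as (d & Hd & H).
  exists d; split; auto. intros z Hz.
  destruct (excluded_middle_informative (z = p)) as [->|Hn].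
  - replace (F p - (F p + B * (p - p)))%C with (RtoC 0) by ring.
    rewrite Cmod_0. apply Rmult_le_pos; [lra|apply Cmod_ge_0].
  - specialize (H z I Hn Hz). assert (Hz0 := Cminus_neq_0 _ _ Hn).
    replace (F z - (F p + B * (z - p)))%C with
      (((F z - F p) / (z - p) - B) * (z - p))%C
      by (field; auto).
    rewrite Cmod_mult. apply Rmult_le_compat_r; [apply Cmod_ge_0|]. lra.
Qed.

(** The point is the supremum of the left ends. The lemma is applied to each coordinate of the
    shrinking rectangles in Goursat's bisection. *)
Lemma nested_limit (a : nat -> R) (h : R) : 0 <= h ->
  (forall n, a n <= a (S n)) ->
  (forall n, a (S n) + h / 2 ^ (S n) <= a n + h / 2 ^ n) ->
  exists p, forall n, a n <= p <= a n + h / 2 ^ n.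
Proof.
  intros Hh H1 H2.
  assert (Hm : forall n k, a n <= a (n + k)%nat /\ a (n + k)%nat + h / 2 ^ (n + k) <= a n + h / 2 ^ n).
  { intros n. induction k as [|k IH].
    - rewrite Nat.add_0_r; lra.
    - rewrite Nat.add_succ_r. generalize (H1 (n + k)%nat) (H2 (n + k)%nat). lra. }
  assert (P : forall n, 0 <= h / 2 ^ n).
  { intros n. apply Rdiv_le_0_compat; auto. apply pow_lt; lra. }
  assert (Hall : forall n m, a m <= a n + h / 2 ^ n).
  { intros n m. destruct (Nat.le_ge_cases n m) as [L|L].
    - replace m with (n + (m - n))%nat by lia. generalize (Hm n (m - n)%nat) (P (n + (m - n))%nat). lra.
    - replace n with (m + (n - m))%nat by lia. generalize (Hm m (n - m)%nat) (P (m + (n - m))%nat).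
        lra. }
  destruct (completeness (fun x => exists n, x = a n)) as (p & Hp1 & Hp2).
  - exists (a 0%nat + h / 2 ^ 0). intros x (n & ->). apply Hall.
  - exists (a 0%nat), 0%nat; auto.
  - exists p. intros n; split.
    + apply Hp1. now exists n.
    + apply Hp2. intros x (m & ->). apply Hall.
Qed.

Lemma Goursat F a b c d : a <= b -> c <= d ->
  (forall x y, a <= x <= b -> c <= y <= d -> cdiff F (x, y)) -> RI F a b c d = RtoC 0.
Proof.
  intros Hab Hcd HF.
  set (h := b - a). set (k := d - c).
  assert (Hh : 0 <= h) by (unfold h; lra). assert (Hk : 0 <= k) by (unfold k; lra).
  (* [q] is the lower left corner of a rectangle of generation [n] that still carries at least the
     fraction 4^(-n) of the whole boundary integral. *)
  set (ok := fun (n : nat) (q : R * R) =>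
    a <= fst q /\ fst q + h / 2 ^ n <= b /\ c <= snd q /\ snd q + k / 2 ^ n <= d /\
    Cmod (RI F a b c d) <= 4 ^ n *
      Cmod (RI F (fst q) (fst q + h / 2 ^ n) (snd q) (snd q + k / 2 ^ n))).
  assert (Hstep : forall n q, ok n q -> exists q', ok (S n) q' /\
     fst q <= fst q' /\ fst q' + h / 2 ^ (S n) <= fst q + h / 2 ^ n /\
     snd q <= snd q' /\ snd q' + k / 2 ^ (S n) <= snd q + k / 2 ^ n).
  { intros n (x, y) (O1 & O2 & O3 & O4 & O5). cbn [fst snd] in *.
    set (hn := h / 2 ^ S n). set (kn := k / 2 ^ S n).
    assert (P2 : 0 < 2 ^ n) by (apply pow_lt; lra).
    assert (Eh : h / 2 ^ n = 2 * hn) by (unfold hn; simpl; field; lra).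
    assert (Ek : k / 2 ^ n = 2 * kn) by (unfold kn; simpl; field; lra).
    assert (Hhn : 0 <= hn) by (apply Rdiv_le_0_compat; auto; apply pow_lt; lra).
    assert (Hkn : 0 <= kn) by (apply Rdiv_le_0_compat; auto; apply pow_lt; lra).
    rewrite Eh, Ek in *.
    assert (HC : rcont F x (x + 2 * hn) y (y + 2 * kn)).
    { intros s t Hs Ht. apply cdiff_cont, HF; lra. }
    assert (Hsum : RI F x (x + 2 * hn) y (y + 2 * kn) =
      (RI F x (x + hn) y (y + kn) + RI F x (x + hn) (y + kn) (y + kn + kn) + (RI F (x + hn) (x + hn +
          hn) y (y + kn) + RI F (x + hn) (x + hn + hn) (y + kn) (y + kn + kn)))%C).
    { replace (x + 2 * hn) with (x + hn + hn) in * by ring.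
      replace (y + 2 * kn) with (y + kn + kn) in * by ring.
      rewrite (RI_split_x F x (x + hn)); [| lra | lra | exact HC].
      rewrite (RI_split_y F x (x + hn) y (y + kn)), (RI_split_y F (x + hn) _ y (y + kn));
        try lra; auto; intros s t Hs Ht; apply HC; lra. }
    assert (P4 : 0 < 4 ^ n) by (apply pow_lt; lra).
    set (m := Cmod (RI F a b c d)) in *.
    (* If all four quarters fell short of their share, the triangle inequality applied to [Hsum]
       would contradict [O5]. *)
    assert (Hex : exists x' y', (x' = x \/ x' = x + hn) /\ (y' = y \/ y' = y + kn) /\
       m <= 4 ^ S n * Cmod (RI F x' (x' + hn) y' (y' + kn))).
    { apply Classical_Prop.NNPP. intros Hno.
      assert (Hlt : forall x' y', (x' = x \/ x' = x + hn) -> (y' = y \/ y' = y + kn) ->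
         4 ^ S n * Cmod (RI F x' (x' + hn) y' (y' + kn)) < m).
      { intros x' y' Hx' Hy'. apply Rnot_le_lt. intros Hle. apply Hno. exists x', y'. auto. }
      assert (L1 := Hlt x y ltac:(auto) ltac:(auto)).
      assert (L2 := Hlt x (y + kn) ltac:(auto) ltac:(auto)).
      assert (L3 := Hlt (x + hn) y ltac:(auto) ltac:(auto)).
      assert (L4 := Hlt (x + hn) (y + kn) ltac:(auto) ltac:(auto)).
      rewrite Hsum in O5.
      revert O5. apply Rlt_not_le. clear Hlt Hno Hsum.
      set (r1 := RI F x (x + hn) y (y + kn)) in *.
      set (r2 := RI F x (x + hn) (y + kn) (y + kn + kn)) in *.
      set (r3 := RI F (x + hn) (x + hn + hn) y (y + kn)) in *.
      set (r4 := RI F (x + hn) (x + hn + hn) (y + kn) (y + kn + kn)) in *.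
      assert (T := Cmod_triangle (r1 + r2)%C (r3 + r4)%C).
      assert (T1 := Cmod_triangle r1 r2). assert (T2 := Cmod_triangle r3 r4).
      simpl pow in L1, L2, L3, L4.
      apply Rle_lt_trans with (4 ^ n * (Cmod r1 + Cmod r2 + Cmod r3 + Cmod r4)); [|lra].
      apply Rmult_le_compat_l; lra. }
    destruct Hex as (x' & y' & Hx' & Hy' & Hm).
    exists (x', y'). unfold ok. cbn [fst snd]. fold hn kn.
    repeat split; auto; destruct Hx' as [->| ->], Hy' as [->| ->]; lra. }
  assert (Hok0 : ok 0%nat (a, c)).
  { unfold ok; simpl. replace (a + h / 1) with b by (unfold h; field).
    replace (c + k / 1) with d by (unfold k; field). repeat split; lra. }
  (* A total choice function: off [ok] it returns [q] itself, and [Hq] shows that the orbit of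
     [(a, c)] stays in [ok]. *)
  set (step := fun n q => match excluded_middle_informative (ok n q) with
     | left Hq => proj1_sig (constructive_indefinite_description _ (Hstep n q Hq))
     | right _ => q end).
  set (q := fix q n := match n with O => (a, c) | S n' => step n' (q n') end).
  assert (Hq : forall n, ok n (q n)).
  { induction n as [|n IH]; [exact Hok0|]. simpl. unfold step.
    destruct (excluded_middle_informative (ok n (q n))); [|contradiction].
    destruct constructive_indefinite_description as (q' & Hq'). apply Hq'. }
  assert (Hqs : forall n, fst (q n) <= fst (q (S n)) /\
     fst (q (S n)) + h / 2 ^ (S n) <= fst (q n) + h / 2 ^ n /\
     snd (q n) <= snd (q (S n)) /\ snd (q (S n)) + k / 2 ^ (S n) <= snd (q n) + k / 2 ^ n).
  { intros n. simpl q. unfold step.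
    destruct (excluded_middle_informative (ok n (q n))) as [Hn|Hn]; [|destruct (Hn (Hq n))].
    destruct constructive_indefinite_description as (q' & Hq'). simpl proj1_sig. apply Hq'. }
  destruct (nested_limit (fun n => fst (q n)) h Hh) as (px & Hpx); try (intros n; apply Hqs).
  destruct (nested_limit (fun n => snd (q n)) k Hk) as (py & Hpy); try (intros n; apply Hqs).
  assert (Hdiff : cdiff F (px, py)).
  { apply HF.
    - generalize (Hpx 0%nat). simpl. unfold h. lra.
    - generalize (Hpy 0%nat). simpl. unfold k. lra. }
  apply Cmod_eq_0, Rle_antisym; [|apply Cmod_ge_0].
  apply le_epsilon. intros eps He.
  set (l := h + k). assert (Hl : 0 <= l) by (unfold l; lra).
  (* The boundary integral of generation [n] is at most [4 * eta * (l / 2 ^ n) ^ 2], and the factor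
     [4 ^ n] undoes the square, so the requirement is [4 * l * l * eta <= eps]. The [+ 1] covers a
     degenerate rectangle with [l = 0]. *)
  set (eta := eps / (4 * l * l + 1)).
  assert (Heta : 0 < eta) by (apply Rdiv_lt_0_compat; auto; nra).
  destruct (cdiff_affine_bound F _ Hdiff eta Heta) as (B & del & Hdel & HB).
  assert (Hn : exists n, l / 2 ^ n < del).
  { destruct (pow_lt_1_zero (/2)) with (y := del / (l + 1)) as (n & Hn).
    - rewrite Rabs_right; lra.
    - apply Rdiv_lt_0_compat; lra.
    - exists n. specialize (Hn n (Nat.le_refl n)).
      rewrite Rabs_right in Hn by (apply Rle_ge, pow_le; lra).
      rewrite pow_inv in Hn.
      apply Rmult_lt_compat_r with (r := l + 1) in Hn; [|lra].
      replace (del / (l + 1) * (l + 1)) with del in Hn by (field; lra).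
      assert (0 < / 2 ^ n) by (apply Rinv_0_lt_compat, pow_lt; lra).
      unfold Rdiv. nra. }
  destruct Hn as (n & Hn).
  destruct (Hq n) as (O1 & O2 & O3 & O4 & O5).
  specialize (Hpx n). specialize (Hpy n). simpl in Hpx, Hpy.
  set (x := fst (q n)) in *. set (y := snd (q n)) in *.
  assert (P2 : 0 < 2 ^ n) by (apply pow_lt; lra).
  assert (Eh : h / 2 ^ n + k / 2 ^ n = l / 2 ^ n) by (unfold l; field; lra).
  assert (Hhn : 0 <= h / 2 ^ n) by (apply Rdiv_le_0_compat; auto).
  assert (Hkn : 0 <= k / 2 ^ n) by (apply Rdiv_le_0_compat; auto).
  assert (HR : Cmod (RI F x (x + h / 2 ^ n) y (y + k / 2 ^ n)) <=
     4 * ((x + h / 2 ^ n - x) + (y + k / 2 ^ n - y)) * (eta * (l / 2 ^ n))).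
  { apply (RI_local F (F (px, py)) B (px, py)); try lra.
    - intros s t Hs Ht. apply cdiff_cont, HF; lra.
    - apply Rmult_le_pos; lra.
    - intros s t Hs Ht.
      assert (Hd : Cmod ((s, t)%R - (px, py)%R) <= l / 2 ^ n).
      { eapply Rle_trans; [apply Cmod_le_sum|]. simpl. rewrite <- Eh.
        apply Rplus_le_compat; apply Rabs_le; lra. }
      eapply Rle_trans; [apply HB; lra|]. apply Rmult_le_compat_l; lra. }
  replace (x + h / 2 ^ n - x + (y + k / 2 ^ n - y)) with (l / 2 ^ n) in HR by (rewrite <- Eh; ring).
  assert (E4 : 4 ^ n = 2 ^ n * 2 ^ n) by (rewrite <- Rpow_mult_distr; f_equal; lra).
  assert (HF4 : 4 ^ n * (4 * (l / 2 ^ n) * (eta * (l / 2 ^ n))) = 4 * l * l * eta).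
  { rewrite E4. field. lra. }
  assert (4 * l * l * eta <= eps).
  { unfold eta. apply Rle_trans with ((4 * l * l + 1) * (eps / (4 * l * l + 1))).
    - apply Rmult_le_compat_r; [apply Rlt_le; exact Heta|lra].
    - right. field. nra. }
  assert (P4 : 0 <= 4 ^ n) by (apply pow_le; lra).
  apply Rmult_le_compat_l with (r := 4 ^ n) in HR; auto. lra.
Qed.

(** * Circle means, Cauchy's formula, removable singularities *)

Definition circ (r t : R) : C := (r * cos t, r * sin t).
(** This is the integral of f(z) dz / (i z) over the circle. In this normalization a constant
    integrates to [2 * PI] times itself at every radius, radius 0 included, and the Cauchy kernel
    becomes [ker w z = z / (z - w)]. *)
Definition Cm (f : C -> C) (r : R) : C := CI (fun t => f (circ r t)) 0 (2 * PI).

Lemma two_PI_pos : 0 < 2 * PI.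
Proof. generalize PI_RGT_0. lra. Qed.

Lemma Cmod_circ r t : 0 <= r -> Cmod (circ r t) = r.
Proof.
  intros Hr. unfold Cmod, circ. simpl.
  replace (r * cos t * (r * cos t * 1) + r * sin t * (r * sin t * 1))
    with (Rsqr r * (Rsqr (sin t) + Rsqr (cos t))) by (unfold Rsqr; ring).
  rewrite sin2_cos2, Rmult_1_r. now apply sqrt_Rsqr.
Qed.

Lemma pcont_circ r t : pcont (circ r) t.
Proof.
  apply pcont_pair; apply (continuous_scal_r (V := R_NormedModule) r).
  - apply continuous_cos.
  - apply continuous_sin.
Qed.

Lemma pcont_on_circ f r t : ccont f (circ r t) -> pcont (fun t => f (circ r t)) t.
Proof. apply (pcont_comp f (circ r)). apply pcont_circ. Qed.

Definition circ_cont (f : C -> C) (r : R) : Prop := forall z, Cmod z = r -> ccont f z.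

Lemma is_CI_Cm f r : 0 <= r -> circ_cont f r ->
  is_CI (fun t => f (circ r t)) 0 (2 * PI) (Cm f r).
Proof.
  intros Hr H. apply CI_correct; [generalize two_PI_pos; lra|].
  intros t _. apply pcont_on_circ, H, Cmod_circ, Hr.
Qed.

Lemma Cm_ext f g r : 0 <= r -> (forall z, Cmod z = r -> f z = g z) -> Cm f r = Cm g r.
Proof.
  intros Hr H. apply CI_ext; [generalize two_PI_pos; lra|]. intros t _. apply H, Cmod_circ, Hr.
Qed.

Lemma Cm_plus f g r : 0 <= r -> circ_cont f r -> circ_cont g r ->
  Cm (fun z => (f z + g z)%C) r = (Cm f r + Cm g r)%C.
Proof.
  intros Hr Hf Hg. apply is_CI_unique.
  apply (is_CI_plus (fun t => f (circ r t)) (fun t => g (circ r t))); now apply is_CI_Cm.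
Qed.

Lemma Cm_minus f g r : 0 <= r -> circ_cont f r -> circ_cont g r ->
  Cm (fun z => (f z - g z)%C) r = (Cm f r - Cm g r)%C.
Proof.
  intros Hr Hf Hg. apply is_CI_unique.
  apply (is_CI_minus (fun t => f (circ r t)) (fun t => g (circ r t))); now apply is_CI_Cm.
Qed.

Lemma Cm_scal c f r : 0 <= r -> circ_cont f r ->
  Cm (fun z => (c * f z)%C) r = (c * Cm f r)%C.
Proof.
  intros Hr Hf. apply is_CI_unique.
  apply (is_CI_scal c (fun t => f (circ r t))); now apply is_CI_Cm.
Qed.

Lemma Cm_const c r : Cm (fun _ => c) r = (c * RtoC (2 * PI))%C.
Proof.
  apply is_CI_unique. replace (2 * PI) with (2 * PI - 0) at 2 by ring. apply is_CI_const.
Qed.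

Lemma Cm_0 f : Cm f 0 = (f (RtoC 0) * RtoC (2 * PI))%C.
Proof.
  rewrite <- (Cm_const (f (RtoC 0)) 0). apply Cm_ext; [lra|].
  intros z Hz. now rewrite (Cmod_eq_0 z Hz).
Qed.

Lemma Cm_bound f r m : 0 <= r -> circ_cont f r -> (forall z, Cmod z = r -> Cmod (f z) <= m) ->
  Cmod (Cm f r) <= 4 * PI * m.
Proof.
  intros Hr Hc Hm. replace (4 * PI * m) with (2 * (2 * PI - 0) * m) by ring.
  apply is_CI_bound with (fun t => f (circ r t)).
  - generalize two_PI_pos; lra.
  - now apply is_CI_Cm.
  - intros t _. apply Hm, Cmod_circ, Hr.
Qed.

(* Goursat for f(exp(u+iv)): the horizontal sides cancel by periodicity. *)
Lemma Cm_annulus f r1 r2 : 0 < r1 <= r2 ->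
  (forall z, r1 <= Cmod z <= r2 -> cdiff f z) -> Cm f r1 = Cm f r2.
Proof.
  intros Hr Hf.
  assert (L : ln r1 <= ln r2).
  { destruct (Req_dec r1 r2) as [->|E]; [lra|]. left. apply ln_increasing; lra. }
  assert (G : RI (fun z => f (cexp z)) (ln r1) (ln r2) 0 (2 * PI) = RtoC 0).
  { apply Goursat; auto; [generalize two_PI_pos; lra|]. intros x y Hx _.
    apply (cdiff_comp cexp f); [apply cdiff_cexp|]. apply Hf. rewrite Cmod_cexp. simpl.
    rewrite <- (exp_ln r1), <- (exp_ln r2) by lra.
    split; [destruct (proj1 Hx) as [H|H]|destruct (proj2 Hx) as [H|H]];
      try (left; now apply exp_increasing); right; congruence. }
  unfold RI in G.
  rewrite (CI_ext (fun x => f (cexp (x, 2 * PI))) (fun x => f (cexp (x, 0)))) in G; auto.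
  2: { intros t _. unfold cexp; simpl. rewrite cos_2PI, sin_2PI, cos_0, sin_0. reflexivity. }
  assert (E : forall r, 0 < r -> CI (fun y => f (cexp (ln r, y))) 0 (2 * PI) = Cm f r).
  { intros r H. unfold Cm, circ, cexp; simpl. rewrite exp_ln by auto. reflexivity. }
  rewrite !E in G by lra.
  assert (G2 : (Cm f r2 - Cm f r1)%C = RtoC 0).
  { replace (Cm f r2 - Cm f r1)%C with
      (- Ci * ((CI (fun x => f (cexp (x, 0))) (ln r1) (ln r2)) - (CI (fun x => f (cexp (x, 0))) (ln
          r1) (ln r2)) + Ci * (Cm f r2 - Cm f r1)))%C.
    - rewrite G. ring.
    - apply injective_projections; simpl; ring. }
  replace (Cm f r1) with (Cm f r2 - (Cm f r2 - Cm f r1))%C by ring.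
  rewrite G2. ring.
Qed.

Lemma circ_continuity_2d f (p : C -> R) r t : (forall z, Rabs (p z) <= Cmod z) ->
  (forall a b, p (a - b)%C = p a - p b) ->
  ccont f (circ r t) -> continuity_2d_pt (fun t r => p (f (circ r t))) t r.
Proof.
  intros Hp Hl Hf eps. destruct (Hf eps (cond_pos eps)) as (d & Hd & H).
  assert (Hd2 : 0 < d / 2) by lra.
  assert (C1 : continuity_2d_pt (fun t r => r * cos t) t r).
  { apply continuity_2d_pt_mult; [apply continuity_2d_pt_id2|].
    apply (continuity_1d_2d_pt_comp cos (fun t _ => t)); [apply continuity_cos|apply
        continuity_2d_pt_id1]. }
  assert (C2 : continuity_2d_pt (fun t r => r * sin t) t r).
  { apply continuity_2d_pt_mult; [apply continuity_2d_pt_id2|].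
    apply (continuity_1d_2d_pt_comp sin (fun t _ => t)); [apply continuity_sin|apply
        continuity_2d_pt_id1]. }
  destruct (C1 (mkposreal _ Hd2)) as (d1 & H1). destruct (C2 (mkposreal _ Hd2)) as (d2 & H2).
  assert (Hd12 : 0 < Rmin d1 d2) by (apply Rmin_glb_lt; apply cond_pos).
  exists (mkposreal _ Hd12). simpl. intros u v Hu Hv.
  rewrite <- Hl. eapply Rle_lt_trans; [apply Hp|]. apply H.
  eapply Rle_lt_trans; [apply Cmod_le_sum|]. simpl.
  specialize (H1 u v ltac:(eapply Rlt_le_trans; [exact Hu|apply Rmin_l])
                     ltac:(eapply Rlt_le_trans; [exact Hv|apply Rmin_l])).
  specialize (H2 u v ltac:(eapply Rlt_le_trans; [exact Hu|apply Rmin_r])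
                     ltac:(eapply Rlt_le_trans; [exact Hv|apply Rmin_r])).
  simpl in H1, H2. unfold Rminus in *. lra.
Qed.

(** Continuity in the plane at the points of one circle becomes uniform over the compact range of
    angles. Real and imaginary parts are treated separately, and [eps / (16 * PI)] leaves room for
    both. *)
Lemma Cm_cont f r : 0 <= r -> circ_cont f r -> forall eps, 0 < eps ->
  exists d, 0 < d /\ forall r', 0 <= r' -> Rabs (r' - r) < d -> circ_cont f r' ->
    Cmod (Cm f r' - Cm f r) < eps.
Proof.
  intros Hr Hf eps He.
  assert (HP := PI_RGT_0).
  assert (He2 : 0 < eps / (16 * PI)) by (apply Rdiv_lt_0_compat; lra).
  assert (K : forall p : C -> R, (forall z, Rabs (p z) <= Cmod z) ->
     (forall a b, p (a - b)%C = p a - p b) ->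
     exists d, 0 < d /\ forall r', Rabs (r' - r) < d ->
       forall t, 0 <= t <= 2 * PI ->
         Rabs (p (f (circ r' t) - f (circ r t))%C) < eps / (16 * PI)).
  { intros p P1 P2.
    destruct (uniform_continuity_2d_1d (fun t r => p (f (circ r t))) 0 (2 * PI) r) with
      (eps := mkposreal _ He2) as (d & Hd).
    - intros t _. apply circ_continuity_2d; auto. apply Hf, Cmod_circ, Hr.
    - exists d. split; [apply cond_pos|]. intros r' Hr' t Ht. simpl in Hd.
      assert (Hb := Rabs_def2 _ _ Hr'). assert (Hp := cond_pos d).
      rewrite P2. apply (Hd t r t r'); auto; try lra.
      replace (t - t) with 0 by ring. now rewrite Rabs_R0. }
  destruct (K fst Rabs_fst_le (fun a b => eq_refl)) as (d1 & Hd1 & H1).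
  destruct (K snd Rabs_snd_le (fun a b => eq_refl)) as (d2 & Hd2 & H2).
  exists (Rmin d1 d2). split; [now apply Rmin_glb_lt|]. intros r' Hr' Hd Hc.
  assert (Hd1' : Rabs (r' - r) < d1) by (eapply Rlt_le_trans; [exact Hd|apply Rmin_l]).
  assert (Hd2' : Rabs (r' - r) < d2) by (eapply Rlt_le_trans; [exact Hd|apply Rmin_r]).
  apply Rle_lt_trans with (2 * (2 * PI - 0) * (eps / (8 * PI))).
  - apply is_CI_bound with (fun t => (f (circ r' t) - f (circ r t))%C).
    + lra.
    + apply is_CI_minus; now apply is_CI_Cm.
    + intros t Ht. eapply Rle_trans; [apply Cmod_le_sum|].
      specialize (H1 r' Hd1' t Ht). specialize (H2 r' Hd2' t Ht).
      replace (eps / (8 * PI)) with (eps / (16 * PI) + eps / (16 * PI)) by (field; lra). lra.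
  - replace (2 * (2 * PI - 0) * (eps / (8 * PI))) with (eps / 2) by (field; lra). lra.
Qed.

(** Induction on the exceptional radii: on intervals avoiding the first one, [e], the shorter list
    suffices, and continuity carries the value up to [e] from both sides. *)
Lemma const_except (J : R -> C) (E : list R) : forall a b, a <= b ->
  (forall r, a <= r <= b -> forall eps, 0 < eps -> exists d, 0 < d /\
     forall r', a <= r' <= b -> Rabs (r' - r) < d -> Cmod (J r' - J r) < eps) ->
  (forall r1 r2, a <= r1 <= r2 -> r2 <= b ->
     (forall e, In e E -> ~ (r1 <= e <= r2)) -> J r1 = J r2) ->
  J a = J b.
Proof.
  induction E as [|e E IH]; intros a b Hab Hc HJ.
  { apply HJ; try lra. intros e []. }
  assert (Hlim : forall x y, a <= x <= b -> a <= y <= b ->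
    (forall d, 0 < d -> exists y', a <= y' <= b /\ Rabs (y' - y) < d /\ J y' = J x) -> J x = J y).
  { intros x y Hx Hy H.
    assert (Hz : Cmod (J x - J y) <= 0).
    { apply le_epsilon. intros eps He. destruct (Hc y Hy eps He) as (d & Hd & Hd').
      destruct (H d Hd) as (y' & Y1 & Y2 & Y3). rewrite <- Y3.
      generalize (Hd' y' Y1 Y2). lra. }
    replace (J x) with (J x - J y + J y)%C by ring.
    rewrite (Cmod_eq_0 (J x - J y)%C); [ring|].
    generalize (Cmod_ge_0 (J x - J y)%C). lra. }
  assert (Hsub : forall x y, a <= x <= y -> y <= b -> (e < x \/ y < e) -> J x = J y).
  { intros x y Hx Hy Hexy. apply IH; [lra| |].
    - intros r Hr eps He. destruct (Hc r ltac:(lra) eps He) as (d & Hd & H).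
      exists d; split; auto. intros r' Hr'. apply H. lra.
    - intros r1 r2 H1 H2 Hn. apply HJ; try lra. intros e' [<-|He']; [lra|now apply Hn]. }
  destruct (Rle_lt_dec a e) as [L1|L1]; [|apply Hsub; lra].
  destruct (Rle_lt_dec e b) as [L2|L2]; [|apply Hsub; lra].
  transitivity (J e).
  - destruct (Req_dec a e) as [<-|Hn]; auto.
    apply Hlim; try lra. intros d Hd. exists (Rmax a (e - d / 2)).
    assert (a <= Rmax a (e - d/2)) by apply Rmax_l.
    assert (e - d/2 <= Rmax a (e - d/2)) by apply Rmax_r.
    assert (Rmax a (e - d/2) < e) by (apply Rmax_lub_lt; lra).
    repeat split; try lra.
    + rewrite Rabs_left; lra.
    + symmetry. apply Hsub; lra.
  - destruct (Req_dec b e) as [->|Hn]; auto. symmetry.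
    apply Hlim; try lra. intros d Hd. exists (Rmin b (e + d / 2)).
    assert (Rmin b (e + d/2) <= b) by apply Rmin_l.
    assert (Rmin b (e + d/2) <= e + d / 2) by apply Rmin_r.
    assert (e < Rmin b (e + d/2)) by (apply Rmin_glb_lt; lra).
    repeat split; try lra.
    + rewrite Rabs_right; lra.
    + apply Hsub; lra.
Qed.

Lemma Cm_const_except f E a b : 0 <= a <= b ->
  (forall z, a <= Cmod z <= b -> ccont f z) ->
  (forall z, a <= Cmod z <= b -> 0 < Cmod z -> ~ In (Cmod z) E -> cdiff f z) ->
  Cm f a = Cm f b.
Proof.
  (* Radius 0 joins the exceptional radii because the logarithmic polar coordinates of [Cm_annulus]
     miss the origin. *)
  intros Hab Hc Hd. apply (const_except (Cm f) (0 :: E)); [lra| |].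
  - intros r Hr eps He. destruct (Cm_cont f r ltac:(lra)) with (eps := eps) as (d & Hd0 & H); auto.
    + intros z Hz. apply Hc. lra.
    + exists d; split; auto. intros r' Hr' Hrr. apply H; auto; [lra|].
      intros z Hz. apply Hc. lra.
  - intros r1 r2 H1 H2 Hn. apply Cm_annulus.
    + generalize (Hn 0 ltac:(now left)). lra.
    + intros z Hz. apply Hd; [lra| |].
      * generalize (Hn 0 ltac:(now left)). lra.
      * intros Hin. apply (Hn (Cmod z) ltac:(now right)). lra.
Qed.

(** The circles are shrunk to radius 0, where the mean degenerates to the value at the origin.
    Exceptional radii make this usable for a function that is merely continuous on some circle. *)
Lemma Cm_center f E r : 0 <= r ->
  (forall z, Cmod z <= r -> ccont f z) ->
  (forall z, Cmod z <= r -> 0 < Cmod z -> ~ In (Cmod z) E -> cdiff f z) ->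
  Cm f r = (f (RtoC 0) * RtoC (2 * PI))%C.
Proof.
  intros Hr Hc Hd. rewrite <- Cm_0. symmetry.
  apply (Cm_const_except f E); [lra| |]; intros z Hz; [apply Hc|apply Hd]; lra.
Qed.

(** The mean is the same at all larger radii, and on very large circles [f] is uniformly close to
    [L]. *)
Lemma Cm_infinity f E R L : 0 <= R -> tends nbinf f L ->
  (forall z, R <= Cmod z -> ccont f z) ->
  (forall z, R <= Cmod z -> 0 < Cmod z -> ~ In (Cmod z) E -> cdiff f z) ->
  Cm f R = (L * RtoC (2 * PI))%C.
Proof.
  intros HR HL Hc Hd.
  assert (HP := PI_RGT_0).
  assert (Hz : Cmod (Cm f R - L * RtoC (2 * PI)) <= 0).
  { apply le_epsilon. intros eps He.
    destruct (HL (eps / (4 * PI)) ltac:(apply Rdiv_lt_0_compat; lra)) as (r & Hr).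
    set (r' := Rmax R (Rabs r + 1)).
    assert (R <= r') by apply Rmax_l. assert (Rabs r + 1 <= r') by apply Rmax_r.
    assert (r < r') by (generalize (Rle_abs r); lra).
    rewrite (Cm_const_except f E R r'); [|lra| |]; try (intros z Hz; apply Hc || apply Hd; lra).
    rewrite <- (Cm_const L r'), <- Cm_minus; try lra.
    - replace (0 + eps) with (4 * PI * (eps / (4 * PI))) by (field; lra).
      apply Cm_bound; [lra| |].
      + intros z Hz. apply ccont_minus; [apply Hc; lra|apply ccont_const].
      + intros z Hz. left. apply Hr. lra.
    - intros z Hz. apply Hc; lra.
    - intros z Hz. apply ccont_const. }
  replace (Cm f R) with (Cm f R - L * RtoC (2 * PI) + L * RtoC (2 * PI))%C by ring.
  rewrite (Cmod_eq_0 (Cm f R - L * RtoC (2 * PI))%C); [ring|].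
  generalize (Cmod_ge_0 (Cm f R - L * RtoC (2 * PI))%C). lra.
Qed.

(** * The Cauchy kernel, Cauchy's formula inside and outside a circle, Liouville's theorem *)

Definition ker (w z : C) : C := (z / (z - w))%C.

Lemma cdiff_ker w z : z <> w -> cdiff (ker w) z.
Proof.
  intros H. apply (cdiff_div (fun z => z) (fun z => (z - w)%C)).
  - now apply Cminus_neq_0.
  - apply cdiff_id.
  - apply cdiff_minus; [apply cdiff_id|apply cdiff_const].
Qed.

Lemma ker_inf w : tends nbinf (ker w) (RtoC 1).
Proof.
  apply (tends_ext_loc (fun z => (/ (RtoC 1 - w * / z))%C)).
  - generalize (filter_conj _ _ (nbinf_neq (RtoC 0)) (nbinf_neq w)).
    apply filter_imp. intros z (H1 & H2). unfold ker.
    assert (H3 := Cminus_neq_0 _ _ H2). field. auto.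
  - apply tends_eq with (/ (RtoC 1 - w * RtoC 0))%C.
    + apply tends_inv.
      * replace (RtoC 1 - w * RtoC 0)%C with (RtoC 1) by ring.
        intros E. apply RtoC_inj in E. lra.
      * apply tends_minus; [apply tends_const|apply tends_mult; [apply tends_const|]].
        apply tends_inv_inf.
    + replace (RtoC 1 - w * RtoC 0)%C with (RtoC 1) by ring.
      field.
Qed.

Lemma RtoC_2PI_neq_0 : RtoC (2 * PI) <> RtoC 0.
Proof. intros E. apply RtoC_inj in E. generalize two_PI_pos. lra. Qed.

Lemma Cm_ker_out w r : 0 <= r -> Cmod w < r -> Cm (ker w) r = RtoC (2 * PI).
Proof.
  intros Hr Hw. rewrite (Cm_infinity (ker w) nil r (RtoC 1)); auto.
  - ring.
  - apply ker_inf.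
  - intros z Hz. apply cdiff_cont, cdiff_ker. intros ->. lra.
  - intros z Hz _ _. apply cdiff_ker. intros ->. lra.
Qed.

(** The integrand of the classical proof of Cauchy's formula, completed at [w]. It vanishes at 0, so
    [Cm_center] gives it mean 0. At [w] only continuity is known, which is why the radius [Cmod w]
    is passed on as exceptional. *)
Definition dker (f : C -> C) (w d : C) : C -> C :=
  upd (fun z => ((f z - f w) * ker w z)%C) w (d * w)%C.

Lemma dker_diff f w d z : z <> w -> cdiff f z -> cdiff (dker f w d) z.
Proof.
  intros Hz Hf. eapply cdiff_ext_loc; [apply upd_nb; exact Hz|].
  apply cdiff_mult; [|now apply cdiff_ker].
  apply cdiff_minus; [exact Hf|apply cdiff_const].
Qed.

Lemma dker_cont f w d z : z <> w -> ccont f z -> ccont (dker f w d) z.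
Proof.
  intros Hz Hf. eapply ccont_ext_loc; [apply upd_nb; exact Hz|].
  apply ccont_mult; [|now apply cdiff_cont, cdiff_ker].
  apply ccont_minus; [exact Hf|apply ccont_const].
Qed.

Lemma dker_cont_at f w d :
  tends (punct w) (fun z => ((f z - f w) / (z - w))%C) d ->
  ccont (dker f w d) w.
Proof.
  intros H. apply ccont_upd.
  apply (tends_ext (F := punct w)
    (fun z => ((f z - f w) / (z - w) * z)%C)).
  - intros z. unfold ker, Cdiv. ring.
  - apply tends_mult; auto. apply tends_id_pnb.
Qed.

Lemma dker_0 f w d : dker f w d (RtoC 0) = RtoC 0.
Proof.
  destruct (excluded_middle_informative (RtoC 0 = w)) as [<-|H].
  - unfold dker. rewrite upd_eq. ring.
  - unfold dker. rewrite upd_neq by auto. unfold ker, Cdiv. ring.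
Qed.

Lemma Cm_dker f w d r : 0 <= r -> Cmod w <> r -> circ_cont f r ->
  Cm (dker f w d) r = (Cm (fun z => (f z * ker w z)%C) r - f w * Cm (ker w) r)%C.
Proof.
  intros Hr Hw Hf.
  assert (Hz : forall z, Cmod z = r -> z <> w) by (intros z Hz ->; auto).
  assert (Hk : circ_cont (ker w) r) by (intros z Hz'; apply cdiff_cont, cdiff_ker, Hz, Hz').
  rewrite <- Cm_scal, <- Cm_minus; auto.
  - apply Cm_ext; auto. intros z Hz'. unfold dker. rewrite upd_neq by auto. ring.
  - intros z Hz'. apply ccont_mult; auto.
  - intros z Hz'. apply ccont_mult; auto. apply ccont_const.
Qed.

Lemma Cauchy_formula f r w : Cmod w < r -> (forall z, Cmod z <= r -> cdiff f z) ->
  Cm (fun z => (f z * ker w z)%C) r = (f w * RtoC (2 * PI))%C.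
Proof.
  intros Hw Hf. assert (Hr : 0 <= r) by (generalize (Cmod_ge_0 w); lra).
  assert (Hfw := Hf w ltac:(lra)). destruct Hfw as (d & Hd).
  assert (H := Cm_center (dker f w d) (Cmod w :: nil) r Hr).
  rewrite dker_0, Cm_dker, Cm_ker_out in H; try lra.
  - assert (H' : (Cm (fun z => (f z * ker w z)%C) r - f w * RtoC (2 * PI))%C = RtoC 0).
    { rewrite H; [ring| |].
      - intros z Hz. destruct (excluded_middle_informative (z = w)) as [->|Hn].
        + now apply dker_cont_at.
        + apply dker_cont; auto. now apply cdiff_cont, Hf.
      - intros z Hz _ Hn. apply dker_diff; [|now apply Hf]. intros ->. apply Hn. now left. }
    replace (Cm (fun z => (f z * ker w z)%C) r) with
      (Cm (fun z => (f z * ker w z)%C) r - f w * RtoC (2 * PI) + f w * RtoC (2 * PI))%C by ring.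
    rewrite H'. ring.
  - intros z Hz. apply cdiff_cont, Hf. lra.
Qed.

Lemma dker_inf f w d L : tends nbinf f L -> tends nbinf (dker f w d) (L - f w)%C.
Proof.
  intros HL. apply (tends_ext_loc (fun z => ((f z - f w) * ker w z)%C)).
  - generalize (nbinf_neq w). apply filter_imp. intros z Hz. unfold dker. now rewrite upd_neq.
  - apply tends_eq with ((L - f w) * RtoC 1)%C; [|ring].
    apply tends_mult; [|apply ker_inf]. apply tends_minus; [exact HL|apply tends_const].
Qed.

(** The mean of [dker] is now evaluated from infinity, where [dker] tends to [L - f w]. The kernel
    itself has mean 0 on a circle that leaves [w] outside, because [ker w] vanishes at 0. *)
Lemma Cauchy_exterior f r w L : 0 <= r < Cmod w -> tends nbinf f L ->
  (forall z, r <= Cmod z -> cdiff f z) ->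
  Cm (fun z => (f z * ker w z)%C) r = ((L - f w) * RtoC (2 * PI))%C.
Proof.
  intros Hw HL Hf. destruct (Hf w ltac:(lra)) as (d & Hd).
  assert (H := Cm_infinity (dker f w d) (Cmod w :: nil) r (L - f w)%C ltac:(lra)
    (dker_inf _ _ _ _ HL)).
  rewrite <- H.
  - rewrite Cm_dker; try lra.
    + rewrite (Cm_center (ker w) nil r); try lra.
      * replace (ker w (RtoC 0)) with (RtoC 0) by (unfold ker, Cdiv; ring). ring.
      * intros z Hz. apply cdiff_cont, cdiff_ker. intros ->. lra.
      * intros z Hz _ _. apply cdiff_ker. intros ->. lra.
    + intros z Hz. apply cdiff_cont, Hf. lra.
  - intros z Hz. destruct (excluded_middle_informative (z = w)) as [->|Hn].
    + now apply dker_cont_at.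
    + apply dker_cont; auto. now apply cdiff_cont, Hf.
  - intros z Hz _ Hn. apply dker_diff; [|now apply Hf]. intros ->. apply Hn. now left.
Qed.

(* E lists the radii of circles on which f is only required to be continuous. *)
Lemma Liouville_except f E L : tends nbinf f L -> (forall z, ccont f z) ->
  (forall z, ~ In (Cmod z) E -> cdiff f z) -> forall w, ~ In (Cmod w) E -> f w = L.
Proof.
  intros HL Hc Hf w Hw. destruct (Hf w Hw) as (d & Hd).
  assert (C0 : forall z, ccont (dker f w d) z).
  { intros z. destruct (excluded_middle_informative (z = w)) as [->|Hn].
    + now apply dker_cont_at.
    + now apply dker_cont. }
  assert (D0 : forall z, ~ In (Cmod z) (Cmod w :: E) -> cdiff (dker f w d) z).
  { intros z Hz. apply dker_diff; [intros ->; apply Hz; now left|].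
    apply Hf. intros H. apply Hz. now right. }
  (* Radius 0 is compared with infinity: on one side stands [dker] at the origin, which is 0, on the
     other the limit [L - f w]. *)
  assert (H := Cm_infinity (dker f w d) (Cmod w :: E) 0 _ (Rle_refl 0) (dker_inf _ _ d _ HL)
    (fun z _ => C0 z) (fun z _ _ => D0 z)).
  rewrite Cm_0, dker_0 in H.
  assert (H0 : (L - f w)%C = RtoC 0).
  { replace (L - f w)%C with ((L - f w) * RtoC (2 * PI) * / RtoC (2 * PI))%C.
    - rewrite <- H. ring.
    - field. apply RtoC_2PI_neq_0. }
  replace L with (L - f w + f w)%C by ring. rewrite H0. ring.
Qed.

(** * From Cauchy integrals back to differentiability: removable singularities and uniform limits *)

Lemma circ_bounded phi r : 0 <= r -> circ_cont phi r ->
  exists m, 0 < m /\ forall t, 0 <= t <= 2 * PI -> Cmod (phi (circ r t)) <= m.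
Proof.
  intros Hr Hc.
  destruct (continuity_ab_maj (fun t => Cmod (phi (circ r t))) 0 (2 * PI)) as (tm & Hm & _).
  - generalize two_PI_pos; lra.
  - intros t _. apply continuity_pt_filterlim, filterlim_locally. intros eps.
    generalize (pcont_on_circ phi r t (Hc _ (Cmod_circ r t Hr)) eps (cond_pos eps)).
    apply filter_imp. intros s Hs.
    change (Rabs (Cmod (phi (circ r s)) - Cmod (phi (circ r t))) < eps).
    generalize (Cmod_le_minus (phi (circ r s)) (phi (circ r t))).
    generalize (Cmod_le_minus (phi (circ r t)) (phi (circ r s))).
    rewrite (Cmod_minus_sym (phi (circ r t))). intros. apply Rabs_def1; lra.
  - exists (Cmod (phi (circ r tm)) + 1). split; [generalize (Cmod_ge_0 (phi (circ r tm))); lra|].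
    intros t Ht. generalize (Hm t Ht). lra.
Qed.

(** Differentiation under the integral sign, done by hand at the centre only: the derivative is the
    normalized mean of [phi / z]. Translation by [cdiff_translate_0] transports the conclusion to
    other points. *)
Lemma Cauchy_integral_diff_0 phi f r : 0 < r -> circ_cont phi r ->
  (forall w, Cmod w < r -> Cm (fun z => (phi z * ker w z)%C) r = (f w * RtoC (2 * PI))%C) ->
  cdiff f (RtoC 0).
Proof.
  intros Hr Hc H.
  assert (HP := PI_RGT_0).
  set (D := Cm (fun z => (phi z / z)%C) r).
  assert (Hz0 : forall z, Cmod z = r -> z <> RtoC 0).
  { intros z Hz. apply Cmod_gt_0. lra. }
  destruct (circ_bounded phi r ltac:(lra) Hc) as (m & Hm & B).
  exists (D / RtoC (2 * PI))%C.
  apply (tends_le (F := punct (RtoC 0)) _ _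
    (fun w => 4 * m * Cmod w / (r * r))).
  - exists (r / 2). split; [lra|]. intros w _ Hw Hwr.
    replace (w - RtoC 0)%C with w in * by ring.
    assert (Hwp : 0 < Cmod w) by now apply Cmod_gt_0.
    assert (Hzw : forall z, Cmod z = r -> z <> w) by (intros z Hz ->; lra).
    assert (Hkc : forall v, Cmod v < r -> circ_cont (fun z => (phi z * ker v z)%C) r).
    { intros v Hv z Hz. apply ccont_mult; auto. apply cdiff_cont, cdiff_ker. intros ->. lra. }
    assert (Hdc : circ_cont (fun z => (phi z / z)%C) r).
    { intros z Hz. apply ccont_div; auto. apply ccont_id. }
    (* The kernel satisfies [ker w - ker 0 - w / z = w * (w / (z * (z - w)))], and [g] is [phi]
       times the second factor; it is O(|w|) uniformly on the circle. *)
    set (g := fun z => (w * (phi z / (z * (z - w))))%C).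
    assert (Hg : circ_cont g r).
    { intros z Hz. apply ccont_mult; [apply ccont_const|]. apply ccont_div; auto.
      - apply Cmult_neq_0; auto. apply Cminus_neq_0; auto.
      - apply ccont_mult; [apply ccont_id|]. apply ccont_minus; [apply ccont_id|apply ccont_const]. }
    assert (E1 : (Cm (fun z => (phi z * ker w z)%C) r - (Cm (fun z => (phi z * ker (RtoC 0) z)%C)
        r))%C = (w * (D + Cm g r))%C).
    { unfold D. rewrite <- Cm_plus, <- Cm_minus, <- Cm_scal; auto; try lra.
      - apply Cm_ext; [lra|]. intros z Hz. unfold g, ker.
        assert (Z1 := Hz0 z Hz). assert (Z2 := Cminus_neq_0 _ _ (Hzw z Hz)).
        replace (z - RtoC 0)%C with z by ring. field. auto.
      - intros z Hz. apply ccont_plus; auto.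
      - apply Hkc. rewrite ?Cmod_0; lra.
      - apply Hkc. rewrite ?Cmod_0; lra. }
    rewrite !H in E1 by (rewrite ?Cmod_0; lra).
    assert (P0 := RtoC_2PI_neq_0).
    replace ((f w - f (RtoC 0)) / w - D / RtoC (2 * PI))%C
      with (Cm g r / RtoC (2 * PI))%C.
    + rewrite Cmod_div, Cmod_R, Rabs_right by (auto; lra).
      apply Rmult_le_reg_r with (2 * PI); [lra|]. unfold Rdiv at 1.
      rewrite Rmult_assoc, Rinv_l, Rmult_1_r by lra.
      replace (4 * m * Cmod w / (r * r) * (2 * PI)) with
        (2 * (2 * PI - 0) * (Cmod w * (m * / (r * (r / 2))))) by (field; lra).
      apply is_CI_bound with (fun t => g (circ r t)); [lra|apply is_CI_Cm; auto; lra|].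
      intros t Ht. unfold g. rewrite Cmod_mult. apply Rmult_le_compat_l; [lra|].
      assert (Hct := Cmod_circ r t ltac:(lra)).
      assert (Z1 := Hz0 _ Hct). assert (Z2 := Cminus_neq_0 _ _ (Hzw _ Hct)).
      rewrite Cmod_div by now apply Cmult_neq_0.
      apply Rmult_le_compat; auto; [apply Cmod_ge_0| |].
      * apply Rlt_le, Rinv_0_lt_compat, Cmod_gt_0, Cmult_neq_0; auto.
      * apply Rinv_le_contravar; [apply Rmult_lt_0_compat; lra|]. rewrite Cmod_mult, Hct.
        apply Rmult_le_compat_l; [lra|].
        generalize (Cmod_le_minus (circ r t) w). lra.
    + replace (f w - f (RtoC 0))%C with
        (w * (D + Cm g r) / RtoC (2 * PI))%C.
      * field. auto.
      * rewrite <- E1. field. auto.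
  - intros eps He. exists (eps * (r * r) / (4 * m)).
    split; [apply Rdiv_lt_0_compat; [apply Rmult_lt_0_compat; nra|lra]|]. intros w _ _ Hw.
    replace (w - RtoC 0)%C with w in * by ring.
    apply Rmult_lt_compat_r with (r := 4 * m / (r * r)) in Hw.
    + replace (eps * (r * r) / (4 * m) * (4 * m / (r * r))) with eps in Hw by (field; lra).
      replace (4 * m * Cmod w / (r * r)) with (Cmod w * (4 * m / (r * r))) by (field; lra). lra.
    + apply Rdiv_lt_0_compat; nra.
Qed.

Lemma cdiff_translate f p z : cdiff f (p + z)%C -> cdiff (fun w => f (p + w)%C) z.
Proof.
  apply (cdiff_comp (fun w => (p + w)%C) f). apply cdiff_plus; [apply cdiff_const|apply cdiff_id].
Qed.

Lemma cdiff_translate_0 f p : cdiff (fun w => f (p + w)%C) (RtoC 0) -> cdiff f p.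
Proof.
  intros H. apply cdiff_ext with (fun z => f (p + (z - p))%C).
  - intros w. f_equal. ring.
  - apply (cdiff_comp (fun z => (z - p)%C) (fun w => f (p + w)%C)).
    + apply cdiff_minus; [apply cdiff_id|apply cdiff_const].
    + replace (p - p)%C with (RtoC 0) by ring. exact H.
Qed.

(** Dividing [f - f 0] by [z] in Cauchy's formula yields a Cauchy integral again, with density
    [f / z]; the mean of this density, normalized, is the value to be filled in at 0. *)
Lemma quotient_diff_0 f r : 0 < r -> (forall z, Cmod z < r -> cdiff f z) ->
  exists v, cdiff (upd (fun z => ((f z - f (RtoC 0)) / z)%C) (RtoC 0) v) (RtoC 0).
Proof.
  intros Hr Hf.
  set (r' := r / 2).
  assert (Hz0 : forall z, Cmod z = r' -> z <> RtoC 0).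
  { intros z Hz. apply Cmod_gt_0. unfold r' in Hz. lra. }
  assert (Hfc : forall z, Cmod z = r' -> ccont f z).
  { intros z Hz. apply cdiff_cont, Hf. unfold r' in Hz. lra. }
  set (phi := fun z => (f z / z)%C).
  assert (Hphi : circ_cont phi r').
  { intros z Hz. apply ccont_div; auto. apply ccont_id. }
  assert (P0 := RtoC_2PI_neq_0).
  exists (Cm phi r' / RtoC (2 * PI))%C.
  apply (Cauchy_integral_diff_0 phi _ r'); auto; [unfold r'; lra|].
  assert (Hr' : 0 < r') by (unfold r'; lra).
  intros w Hw. destruct (excluded_middle_informative (w = RtoC 0)) as [->|Hn].
  - rewrite upd_eq. replace (Cm phi r' / RtoC (2 * PI) * RtoC (2 * PI))%C
      with (Cm phi r') by (field; auto).
    apply Cm_ext; [lra|]. intros z Hz. unfold ker. assert (Z := Hz0 z Hz).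
    replace (z - RtoC 0)%C with z by ring. field. auto.
  - rewrite upd_neq by auto.
    assert (C1 := Cauchy_formula f r' w Hw
      ltac:(intros z Hz; apply Hf; unfold r' in Hz; lra)).
    assert (C2 := Cauchy_formula f r' (RtoC 0) ltac:(rewrite Cmod_0; lra)
      ltac:(intros z Hz; apply Hf; unfold r' in Hz; lra)).
    assert (Hkc : forall v, Cmod v < r' -> circ_cont (ker v) r').
    { intros v Hv z Hz. apply cdiff_cont, cdiff_ker. intros ->. lra. }
    replace (Cm (fun z => (phi z * ker w z)%C) r') with
      ((Cm (fun z => (f z * ker w z)%C) r' - (Cm (fun z => (f z * ker (RtoC 0) z)%C) r')) / w)%C.
    + rewrite C1, C2. field. auto.
    + assert (K0 : Cmod (RtoC 0) < r') by (rewrite Cmod_0; lra).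
      rewrite <- Cm_minus; try lra;
        try (intros z Hz; apply ccont_mult; [now apply Hfc|now apply (Hkc _)]).
      assert (E : Cm (fun z => (f z * ker w z - f z * ker (RtoC 0) z)%C) r' =
        (w * Cm (fun z => (phi z * ker w z)%C) r')%C).
      { rewrite <- Cm_scal; try lra.
        - apply Cm_ext; [lra|]. intros z Hz. unfold phi, ker.
          assert (Z := Hz0 z Hz).
          assert (Z2 : (z - w)%C <> RtoC 0) by (apply Cminus_neq_0; intros ->; lra).
          replace (z - RtoC 0)%C with z by ring. field. auto.
        - intros z Hz. apply ccont_mult; [now apply Hphi|now apply (Hkc w)]. }
      rewrite E. field. auto.
Qed.

(** Riemann's argument: [z * z * k z] is differentiable at 0 with value and derivative 0, so the
    quotient by [z] can be taken twice. *)
Lemma removable_0 k r : 0 < r -> (forall z, 0 < Cmod z < r -> cdiff k z) ->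
  tends (punct (RtoC 0)) (fun z => (z * k z)%C) (RtoC 0) ->
  exists v, cdiff (upd k (RtoC 0) v) (RtoC 0).
Proof.
  intros Hr Hk Ht.
  set (g := fun z => (z * z * k z)%C).
  assert (G0 : g (RtoC 0) = RtoC 0) by (unfold g; ring).
  assert (Hz : forall z, 0 < Cmod z -> z <> RtoC 0) by (intros z Hz; now apply Cmod_gt_0).
  assert (Hg : forall z, Cmod z < r -> cdiff g z).
  { intros z Hz'. destruct (excluded_middle_informative (z = RtoC 0)) as [->|Hn].
    - exists (RtoC 0).
      apply (tends_ext_loc (F := punct (RtoC 0)) (fun z => (z * k z)%C)); auto.
      generalize (pnb_neq (fun _ => True) (RtoC 0)). apply filter_imp. intros w Hw.
      rewrite G0. unfold g. replace (w - RtoC 0)%C with w by ring. field. auto.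
    - apply cdiff_mult.
      + apply cdiff_mult; apply cdiff_id.
      + apply Hk. split; auto. now apply Cmod_gt_0. }
  destruct (quotient_diff_0 g r Hr Hg) as (v & Hv).
  set (g1 := upd (fun z => ((g z - g (RtoC 0)) / z)%C) (RtoC 0) v) in *.
  assert (Hg1 : forall z, z <> RtoC 0 -> g1 z = (z * k z)%C).
  { intros z Hz'. unfold g1. rewrite upd_neq, G0 by auto. unfold g. field. auto. }
  assert (V0 : g1 (RtoC 0) = RtoC 0).
  { apply (tends_unique (punct (RtoC 0)) g1).
    - apply tends_nb_pnb, cdiff_cont, Hv.
    - apply tends_ext_loc with (fun z => (z * k z)%C); auto.
      generalize (pnb_neq (fun _ => True) (RtoC 0)). apply filter_imp. intros w Hw.
      symmetry. auto. }
  destruct (quotient_diff_0 g1 r Hr) as (v2 & Hv2).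
  - intros z Hzr. destruct (excluded_middle_informative (z = RtoC 0)) as [->|Hn]; auto.
    apply cdiff_ext_loc with (fun z => (z * k z)%C).
    + generalize (nb_neq _ _ Hn). apply filter_imp. intros w Hw. symmetry. auto.
    + apply cdiff_mult; [apply cdiff_id|]. apply Hk. split; auto. now apply Cmod_gt_0.
  - exists v2. eapply cdiff_ext; [|exact Hv2]. intros w.
    destruct (excluded_middle_informative (w = RtoC 0)) as [->|Hn].
    + now rewrite !upd_eq.
    + rewrite !upd_neq, V0, Hg1 by auto. field. auto.
Qed.

Lemma removable_point k p : nb p (fun z => z <> p -> cdiff k z) ->
  tends (punct p) (fun z => ((z - p) * k z)%C) (RtoC 0) ->
  exists v, cdiff (upd k p v) p.
Proof.
  intros (r & Hr & Hk) Ht.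
  assert (Ep : forall z, (p + z - p)%C = z) by (intros z; ring).
  destruct (removable_0 (fun w => k (p + w)%C) r Hr) as (v & Hv).
  - intros z Hz. apply cdiff_translate, Hk; rewrite ?Ep; [lra|].
    intros E. apply (proj2 (Cmod_gt_0 z) (proj1 Hz)). rewrite <- (Ep z), E. ring.
  - apply (tends_ext (F := punct (RtoC 0))
      (fun w => ((p + w - p) * k (p + w)%C)%C)).
    + intros w. now rewrite Ep.
    + apply (tends_comp (punct p) (fun w => (p + w)%C)
        (fun z => ((z - p) * k z)%C)); auto.
      intros P (d & Hd & H). exists d; split; auto. intros z _ Hz Hzd. apply H; auto.
      * intros E. apply Hz. rewrite <- (Ep z), E. ring.
      * rewrite Ep. now replace z with (z - RtoC 0)%C by ring.
  - exists v. apply cdiff_translate_0. eapply cdiff_ext; [|exact Hv]. intros w.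
    destruct (excluded_middle_informative (w = RtoC 0)) as [->|Hn].
    + replace (p + RtoC 0)%C with p by ring. now rewrite !upd_eq.
    + rewrite !upd_neq; auto. intros E. apply Hn. rewrite <- (Ep w), E. ring.
Qed.

Lemma removable_finite (P : list C) : forall k, NoDup P ->
  (forall z, ~ In z P -> cdiff k z) ->
  (forall p, In p P -> tends (punct p) (fun z => ((z - p) * k z)%C) (RtoC 0)) ->
  exists K, (forall z, cdiff K z) /\ (forall z, ~ In z P -> K z = k z).
Proof.
  induction P as [|p P IH]; intros k HN Hk Ht.
  - exists k. split; auto.
  - inversion HN as [|? ? HpP HN']; subst.
    assert (Hsep : forall (P : list C) q, nb q (fun z => z <> q -> ~ In z P)).
    { clear. induction P as [|p P IH]; intros q.
      - apply filter_forall. auto.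
      - destruct (excluded_middle_informative (q = p)) as [->|Hn].
        + generalize (IH p). apply filter_imp. intros z H Hz [E|Hi]; [now apply Hz|now apply H].
        + generalize (filter_conj _ _ (IH q) (nb_neq q p Hn)). apply filter_imp.
          intros z (H1 & H2) Hz [E|Hi]; [now apply H2|now apply H1]. }
    destruct (removable_point k p) as (v & Hv).
    + generalize (Hsep (p :: P) p). apply filter_imp. intros z H Hz. apply Hk. auto.
    + apply Ht. now left.
    + destruct (IH (upd k p v) HN') as (K & HK1 & HK2).
      * intros z Hz. destruct (excluded_middle_informative (z = p)) as [->|Hn]; auto.
        eapply cdiff_ext_loc; [apply upd_nb; exact Hn|]. apply Hk. intros [E|Hi]; auto.
      * intros q Hq. assert (q <> p) by (intros ->; contradiction).
        apply (tends_ext_loc (F := punct q) (fun z => ((z - q) * k z)%C)).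
        -- apply nb_pnb. generalize (nb_neq q p H). apply filter_imp.
           intros z Hz. now rewrite upd_neq.
        -- apply Ht. now right.
      * exists K. split; auto. intros z Hz. rewrite HK2.
        -- apply upd_neq. intros ->. apply Hz. now left.
        -- intros Hi. apply Hz. now right.
Qed.

(** Cauchy's formula survives uniform approximation, and [Cauchy_integral_diff_0] turns it back into
    differentiability, so that no estimate of derivatives is involved. *)
Lemma Weierstrass f p r : 0 < r ->
  (forall eps, 0 < eps -> exists g, (forall z, Cmod (z - p) < r -> cdiff g z) /\
     forall z, Cmod (z - p) < r -> Cmod (g z - f z) <= eps) ->
  cdiff f p.
Proof.
  intros Hr H. apply cdiff_translate_0.
  assert (Ep : forall z, (p + z - p)%C = z) by (intros z; ring).
  set (F := fun w => f (p + w)%C).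
  assert (HF : forall eps, 0 < eps -> exists g, (forall z, Cmod z < r -> cdiff g z) /\
     forall z, Cmod z < r -> Cmod (g z - F z) <= eps).
  { intros eps He. destruct (H eps He) as (g & G1 & G2). exists (fun w => g (p + w)%C).
    split; intros z Hz; [apply cdiff_translate, G1|apply G2]; now rewrite Ep. }
  clearbody F. clear H f.
  assert (HFc : forall z, Cmod z < r -> ccont F z).
  { intros z Hz eps He. destruct (HF (eps / 4) ltac:(lra)) as (g & G1 & G2).
    assert (Hn : nb z (fun w => Cmod w < r)).
    { exists (r - Cmod z). split; [lra|]. intros w Hw. generalize (Cmod_le_minus w z). lra. }
    generalize (filter_conj _ _ Hn (cdiff_cont g z (G1 z Hz) (eps / 4) ltac:(lra))).
    apply filter_imp. intros w (W1 & W2).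
    generalize (G2 w W1) (G2 z Hz) (Cmod_minus_le (F w) (g w) (F z)) (Cmod_minus_le (g w) (g z) (F z)).
    rewrite (Cmod_minus_sym (F w) (g w)). lra. }
  set (r' := r / 2). assert (Hr' : 0 < r' < r) by (unfold r'; lra).
  apply (Cauchy_integral_diff_0 F F r'); [lra| |].
  - intros z Hz. apply HFc. lra.
  - intros w Hw.
    assert (HP := PI_RGT_0).
    assert (Hk : circ_cont (ker w) r').
    { intros z Hz. apply cdiff_cont, cdiff_ker. intros ->. lra. }
    set (m := r' / (r' - Cmod w)).
    assert (Hm0 : 0 < m) by (apply Rdiv_lt_0_compat; lra).
    assert (Hm : forall z, Cmod z = r' -> Cmod (ker w z) <= m).
    { intros z Hz. unfold ker. rewrite Cmod_div.
      - rewrite Hz. apply Rmult_le_compat_l; [lra|]. apply Rinv_le_contravar; [lra|].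
        generalize (Cmod_le_minus z w). lra.
      - apply Cminus_neq_0. intros ->. lra. }
    set (X := Cm (fun z => (F z * ker w z)%C) r').
    set (Y := (F w * RtoC (2 * PI))%C).
    assert (Hz : Cmod (X - Y) <= 0).
    { apply le_epsilon. intros eps He.
      (* Accounts for both replacements of [F] by [g]: [4 * PI * m] under the integral against the
         kernel, [2 * PI] in the value at [w]. *)
      set (K := 4 * PI * m + 2 * PI).
      assert (HK : 0 < K) by (assert (0 < PI * m) by (apply Rmult_lt_0_compat; lra); unfold K; lra).
      destruct (HF (eps / K) ltac:(now apply Rdiv_lt_0_compat)) as (g & G1 & G2).
      assert (Cg := Cauchy_formula g r' w Hw ltac:(intros z Hz; apply G1; lra)).
      assert (HX : Cmod (Cm (fun z => (g z * ker w z)%C) r' - X) <= 4 * PI * (eps / K * m)).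
      { unfold X. rewrite <- Cm_minus; try lra.
        - apply Cm_bound; [lra| |].
          + intros z Hz. apply ccont_minus; apply ccont_mult; auto;
              [apply cdiff_cont, G1|apply HFc]; lra.
          + intros z Hz. replace (g z * ker w z - F z * ker w z)%C
              with ((g z - F z) * ker w z)%C by ring.
            rewrite Cmod_mult. apply Rmult_le_compat; try apply Cmod_ge_0; auto.
            apply G2. lra.
        - intros z Hz. apply ccont_mult; auto. apply cdiff_cont, G1. lra.
        - intros z Hz. apply ccont_mult; auto. apply HFc. lra. }
      rewrite Cg in HX.
      assert (HY : Cmod (g w * RtoC (2 * PI) - Y) <= eps / K * (2 * PI)).
      { unfold Y. replace (g w * RtoC (2 * PI) - F w * RtoC (2 * PI))%C
          with ((g w - F w) * RtoC (2 * PI))%C by ring.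
        rewrite Cmod_mult, Cmod_R, (Rabs_right (2 * PI)) by lra.
        apply Rmult_le_compat_r; [lra|]. apply G2. lra. }
      generalize (Cmod_minus_le X (g w * RtoC (2 * PI))%C Y).
      rewrite (Cmod_minus_sym X (g w * RtoC (2 * PI))%C).
      assert (Ee : 4 * PI * (eps / K * m) + eps / K * (2 * PI) = eps / K * K) by (unfold K; ring).
      replace (eps / K * K) with eps in Ee by (field; lra). lra. }
    replace X with (X - Y + Y)%C by ring.
    rewrite (Cmod_eq_0 (X - Y)%C); [ring|]. generalize (Cmod_ge_0 (X - Y)%C). lra.
Qed.

(** * The pole problem: dressing construction *)

Lemma cprod_S f n : cprod f (S n) = (cprod f n * f n)%C.
Proof.
  unfold cprod. rewrite seq_S, map_app, fold_right_app. simpl.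
  generalize (map f (seq 0 n)). induction l as [|a l IH]; simpl; [ring|]. rewrite IH. ring.
Qed.

Lemma csum_S f n : csum f (S n) = (csum f n + f n)%C.
Proof.
  unfold csum. rewrite seq_S, map_app, fold_right_app. simpl.
  generalize (map f (seq 0 n)). induction l as [|a l IH]; simpl; [ring|]. rewrite IH. ring.
Qed.

Lemma cprod_ext f g n : (forall j, (j < n)%nat -> f j = g j) -> cprod f n = cprod g n.
Proof.
  induction n as [|n IH]; intros H; [reflexivity|].
  rewrite !cprod_S, IH, H; auto.
Qed.

Lemma csum_ext f g n : (forall j, (j < n)%nat -> f j = g j) -> csum f n = csum g n.
Proof.
  induction n as [|n IH]; intros H; [reflexivity|].
  rewrite !csum_S, IH, H; auto.
Qed.

Lemma cprod_neq_0 f n : (forall j, (j < n)%nat -> f j <> RtoC 0) -> cprod f n <> RtoC 0.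
Proof.
  induction n as [|n IH]; intros H.
  - unfold cprod; simpl. intros E. apply RtoC_inj in E. lra.
  - rewrite cprod_S. apply Cmult_neq_0; auto.
Qed.

Lemma cprod_div f g n : (forall j, (j < n)%nat -> g j <> RtoC 0) ->
  cprod (fun j => (f j / g j)%C) n = (cprod f n / cprod g n)%C.
Proof.
  induction n as [|n IH]; intros H.
  - unfold cprod; simpl. field.
  - rewrite !cprod_S, IH by auto. field. split; [apply H; lia|]. apply cprod_neq_0. auto.
Qed.

Lemma tends_cprod {F : (C -> Prop) -> Prop} {FF : Filter F} (f : nat -> C -> C) l n :
  (forall j, (j < n)%nat -> tends F (f j) (l j)) ->
  tends F (fun z => cprod (fun j => f j z) n) (cprod l n).
Proof.
  induction n as [|n IH]; intros H.
  - unfold cprod; simpl. apply tends_const.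
  - rewrite cprod_S. apply tends_ext with (fun z => (cprod (fun j => f j z) n * f n z)%C).
    + intros z. now rewrite cprod_S.
    + apply tends_mult; auto.
Qed.

Lemma cdiff_cprod (f : nat -> C -> C) n z :
  (forall j, (j < n)%nat -> cdiff (f j) z) -> cdiff (fun z => cprod (fun j => f j z) n) z.
Proof.
  induction n as [|n IH]; intros H.
  - apply (cdiff_const (RtoC 1)).
  - apply cdiff_ext with (fun z => (cprod (fun j => f j z) n * f n z)%C).
    + intros w. now rewrite cprod_S.
    + apply cdiff_mult; auto.
Qed.

Definition cprodl (f : nat -> C) (l : list nat) : C := fold_right Cmult (RtoC 1) (map f l).

Lemma cprodl_remove f (l : list nat) k : NoDup l -> In k l ->
  cprodl f l = (f k * (cprodl f (filter (fun j => negb (Nat.eqb j k)) l)))%C.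
Proof.
  unfold cprodl. induction l as [|a l IH]; intros HN Hin; [destruct Hin|].
  inversion HN as [|? ? Ha HN']; subst. simpl.
  destruct (Nat.eqb_spec a k) as [->|Hn]; simpl.
  - f_equal. assert (E : filter (fun j => negb (Nat.eqb j k)) l = l).
    { clear IH HN HN' Hin. induction l as [|b l IH]; auto. simpl.
      destruct (Nat.eqb_spec b k) as [->|Hn]; simpl.
      - destruct Ha. now left.
      - f_equal. apply IH. intros H. apply Ha. now right. }
    now rewrite E.
  - destruct Hin as [->|Hin]; [contradiction|]. rewrite IH by auto. ring.
Qed.

Lemma cprod_remove f n k : (k < n)%nat -> cprod f n = (f k * cprod_ne f n k)%C.
Proof.
  intros H. apply (cprodl_remove f (seq 0 n)); [apply seq_NoDup|]. apply in_seq. lia.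
Qed.

Lemma cprodl_neq_0 f l : (forall j, In j l -> f j <> RtoC 0) -> cprodl f l <> RtoC 0.
Proof.
  unfold cprodl. induction l as [|a l IH]; intros H; simpl.
  - intros E. apply RtoC_inj in E. lra.
  - apply Cmult_neq_0; [apply H; now left|]. apply IH. intros j Hj. apply H. now right.
Qed.

Lemma cprod_ne_neq_0 f n k : (forall j, (j < n)%nat -> j <> k -> f j <> RtoC 0) ->
  cprod_ne f n k <> RtoC 0.
Proof.
  intros H. apply cprodl_neq_0. intros j Hj. apply filter_In in Hj. destruct Hj as (H1 & H2).
  apply in_seq in H1. apply H; [lia|]. intros ->. now rewrite Nat.eqb_refl in H2.
Qed.

Lemma tends_cprod_ne {F : (C -> Prop) -> Prop} {FF : Filter F} (f : nat -> C -> C) l n k :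
  (forall j, tends F (f j) (l j)) ->
  tends F (fun z => cprod_ne (fun j => f j z) n k) (cprod_ne l n k).
Proof.
  intros H. unfold cprod_ne.
  generalize (filter (fun j => negb (Nat.eqb j k)) (seq 0 n)). intros li.
  induction li as [|a li IH]; simpl.
  - apply tends_const.
  - apply tends_mult; auto.
Qed.

Definition pole (s : nat -> R) (j : nat) : C := (Ci * RtoC (s j))%C.

(* The Blaschke product of the upper half-plane with zeros i s_j. *)
Definition bl (s : nat -> R) (N : nat) (z : C) : C :=
  cprod (fun j => ((z - pole s j) / (z + pole s j))%C) N.

(** Residue of [1 / bl] at [pole s n], written as the quotient of products that occurs in [cnorm];
    the numerator includes [j = n], which contributes twice the pole. *)
Definition rho (s : nat -> R) (N n : nat) : C :=
  (cprod (fun j => (pole s n + pole s j)%C) N / cprod_ne (fun j => (pole s n - pole s j)%C) N n)%C.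

Definition pos_distinct (s : nat -> R) (N : nat) : Prop :=
  (forall j, (j < N)%nat -> 0 < s j) /\
  (forall j k, (j < N)%nat -> (k < N)%nat -> j <> k -> s j <> s k).

Definition off_low (s : nat -> R) (N : nat) (z : C) : Prop :=
  forall j, (j < N)%nat -> z <> (- pole s j)%C.
Definition off_poles (s : nat -> R) (N : nat) (z : C) : Prop :=
  forall j, (j < N)%nat -> z <> pole s j /\ z <> (- pole s j)%C.

Lemma pole_eq s j : pole s j = (0, s j)%R.
Proof. unfold pole. apply injective_projections; simpl; ring. Qed.

Lemma Cconj_pole s j : Cconj (pole s j) = (- pole s j)%C.
Proof. rewrite pole_eq. apply injective_projections; simpl; ring. Qed.

Lemma Cmod_pole s j : Cmod (pole s j) = Rabs (s j).
Proof. unfold pole. rewrite Cmod_mult, Cmod_Ci, Cmod_R. ring. Qed.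

Lemma pole_neq_opp s j k : 0 < s j -> 0 < s k -> pole s j <> (- pole s k)%C.
Proof. intros Hj Hk E. rewrite !pole_eq in E. injection E. lra. Qed.

Lemma pole_inj s j k : pole s j = pole s k -> s j = s k.
Proof. rewrite !pole_eq. intros E. now injection E. Qed.

Lemma Cplus_neq_0 (a b : C) : a <> (- b)%C -> (a + b)%C <> RtoC 0.
Proof.
  intros H E. apply H. replace a with (a + b + - b)%C by ring. rewrite E. ring.
Qed.

Lemma off_poles_low s N z : off_poles s N z -> off_low s N z.
Proof. intros H j Hj. now apply H. Qed.

Lemma off_poles_conj s N z : off_poles s N z -> off_poles s N (Cconj z).
Proof.
  intros H j Hj. destruct (H j Hj) as (H1 & H2).
  split; intros E; [apply H2|apply H1]; rewrite <- (Cconj_conj z), E;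
    rewrite ?Copp_conj, Cconj_pole; ring.
Qed.

Lemma off_poles_pnb s N p : punct p (off_poles s N).
Proof.
  induction N as [|N IH].
  - apply filter_forall. intros w j Hj. lia.
  - assert (K : forall q, punct p (fun z => z <> q)).
    { intros q. destruct (excluded_middle_informative (p = q)) as [->|Hn].
      - apply pnb_neq.
      - now apply nb_pnb, nb_neq. }
    generalize (filter_conj _ _ IH (filter_conj _ _ (K (pole s N)) (K (- pole s N)%C))).
    apply filter_imp. intros w (W1 & W2 & W3) j Hj.
    destruct (Nat.eq_dec j N) as [->|]; auto. apply W1. lia.
Qed.

Lemma bl_S s N z : bl s (S N) z =
  (bl s N z * ((z - pole s N) / (z + pole s N)))%C.
Proof. apply cprod_S. Qed.

Lemma bl_neq_0 s N z : off_poles s N z -> bl s N z <> RtoC 0.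
Proof.
  intros H. apply cprod_neq_0. intros j Hj. destruct (H j Hj) as (H1 & H2).
  apply Cmult_neq_0.
  - now apply Cminus_neq_0.
  - apply Cmod_gt_0. rewrite Cmod_inv by now apply Cplus_neq_0.
    apply Rinv_0_lt_compat, Cmod_gt_0. now apply Cplus_neq_0.
Qed.

Lemma cdiff_bl s N z : off_low s N z -> cdiff (bl s N) z.
Proof.
  intros H. apply (cdiff_cprod (fun j z => ((z - pole s j) / (z + pole s j))%C)).
  intros j Hj. apply (cdiff_div (fun z => (z - pole s j)%C) (fun z => (z + pole s j)%C)).
  - now apply Cplus_neq_0, H.
  - apply cdiff_minus; [apply cdiff_id|apply cdiff_const].
  - apply cdiff_plus; [apply cdiff_id|apply cdiff_const].
Qed.

(** Reflection in the real axis exchanges the zero and the pole of each factor. *)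
Lemma bl_conj s N z : off_poles s N z -> Cconj (bl s N (Cconj z)) = (/ bl s N z)%C.
Proof.
  induction N as [|N IH]; intros H.
  - unfold bl, cprod; simpl. rewrite RtoC_conj. field.
  - assert (H1 : off_poles s N z) by (intros j Hj; apply H; lia).
    destruct (H N (Nat.lt_succ_diag_r N)) as (H2 & H3).
    assert (A1 := Cminus_neq_0 _ _ H2). assert (A2 := Cplus_neq_0 _ _ H3).
    assert (A3 := bl_neq_0 _ _ _ H1).
    destruct (off_poles_conj _ _ _ H N (Nat.lt_succ_diag_r N)) as (H4 & H5).
    assert (A4 := Cplus_neq_0 _ _ H5).
    rewrite !bl_S, Cmult_conj, IH, Cdiv_conj, Cminus_conj, Cplus_conj, !Cconj_conj, Cconj_pole by auto.
    replace (z - - pole s N)%C with (z + pole s N)%C by ring.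
    replace (z + - pole s N)%C with (z - pole s N)%C by ring.
    field. auto.
Qed.

Lemma rho_limit s N n : pos_distinct s N -> (n < N)%nat ->
  tends (punct (pole s n))
    (fun z => ((z - pole s n) / bl s N z)%C) (rho s N n).
Proof.
  intros (Hp & Hd) Hn.
  apply (tends_ext_loc (F := punct (pole s n)) (fun z =>
    (cprod (fun j => (z + pole s j)%C) N / cprod_ne (fun j => (z - pole s j)%C) N n)%C)).
  - generalize (off_poles_pnb s N (pole s n)). apply filter_imp. intros z Hz.
    unfold bl. rewrite cprod_div by (intros j Hj; apply Cplus_neq_0, (Hz j Hj)).
    rewrite (cprod_remove (fun j => (z - pole s j)%C) N n Hn).
    assert (A1 : (z - pole s n)%C <> RtoC 0) by (apply Cminus_neq_0, (Hz n Hn)).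
    assert (A2 : cprod_ne (fun j => (z - pole s j)%C) N n <> RtoC 0).
    { apply cprod_ne_neq_0. intros j Hj _. apply Cminus_neq_0, (Hz j Hj). }
    assert (A3 : cprod (fun j => (z + pole s j)%C) N <> RtoC 0).
    { apply cprod_neq_0. intros j Hj. apply Cplus_neq_0, (Hz j Hj). }
    field. auto.
  - apply tends_div.
    + apply cprod_ne_neq_0. intros j Hj Hjn. apply Cminus_neq_0. intros E.
      apply pole_inj in E. now apply (Hd n j).
    + apply (tends_cprod (fun j z => (z + pole s j)%C)). intros j _.
      apply tends_plus; [apply tends_id_pnb|apply tends_const].
    + apply (tends_cprod_ne (fun j z => (z - pole s j)%C)). intros j.
      apply tends_minus; [apply tends_id_pnb|apply tends_const].
Qed.

Lemma rho_neq_0 s N n : pos_distinct s N -> (n < N)%nat -> rho s N n <> RtoC 0.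
Proof.
  intros (Hp & Hd) Hn.
  assert (A : cprod_ne (fun j => (pole s n - pole s j)%C) N n <> RtoC 0).
  { apply cprod_ne_neq_0. intros j Hj Hjn. apply Cminus_neq_0. intros E.
    apply pole_inj in E. now apply (Hd n j). }
  apply Cmult_neq_0.
  - apply cprod_neq_0. intros j Hj. apply Cplus_neq_0. apply pole_neq_opp; auto.
  - apply Cmod_gt_0. rewrite Cmod_inv by auto. apply Rinv_0_lt_compat, Cmod_gt_0, A.
Qed.

(** The map is I + g P with P the orthogonal projection onto q: it multiplies the component along q
    by [1 + g] and keeps the orthogonal one. Squared norms therefore change by
    [n * |k|^2 * (|1 + g|^2 - 1)], which is nonpositive. *)
Lemma contraction_step (u1 u2 q1 q2 g : C) (n : R) :
  0 < n -> n = Cmod q1 ^ 2 + Cmod q2 ^ 2 -> Cmod (RtoC 1 + g) <= 1 ->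
  let k := (RtoC (/ n) * (Cconj q1 * u1 + Cconj q2 * u2))%C in
  Cmod (u1 + g * (k * q1)) ^ 2 + Cmod (u2 + g * (k * q2)) ^ 2 <=
  Cmod u1 ^ 2 + Cmod u2 ^ 2.
Proof.
  intros Hn En Hg k.
  assert (Hg2 : Cmod (RtoC 1 + g) ^ 2 <= 1).
  { generalize (Cmod_ge_0 (RtoC 1 + g)%C). nra. }
  assert (Hk : (RtoC n * k)%C = (Cconj q1 * u1 + Cconj q2 * u2)%C).
  { unfold k. rewrite Cmult_assoc, <- RtoC_mult, Rinv_r by lra. ring. }
  clearbody k. rewrite !Cmod2_alt in *.
  destruct u1 as (a1, b1), u2 as (a2, b2), q1 as (c1, d1), q2 as (c2, d2), g as (x, y), k as (k1, k2).
  unfold Cmult, Cplus, Cconj, RtoC in Hk. simpl in Hk. injection Hk as E1 E2.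
  unfold Cmult, Cplus, RtoC, Re, Im in *. simpl fst in *. simpl snd in *.
  assert (Hx : 2 * x + x ^ 2 + y ^ 2 <= 0) by nra.
  assert (K : 0 <= n * (k1 ^ 2 + k2 ^ 2)) by nra.
  (* The Pythagoras identity in real coordinates; [2 * x + x ^ 2 + y ^ 2] is [|1 + g|^2 - 1]. *)
  assert (I : (a1 + (x * (k1 * c1 - k2 * d1) - y * (k1 * d1 + k2 * c1))) ^ 2 +
    (b1 + (x * (k1 * d1 + k2 * c1) + y * (k1 * c1 - k2 * d1))) ^ 2 +
    ((a2 + (x * (k1 * c2 - k2 * d2) - y * (k1 * d2 + k2 * c2))) ^ 2 +
    (b2 + (x * (k1 * d2 + k2 * c2) + y * (k1 * c2 - k2 * d2))) ^ 2) =
    a1 ^ 2 + b1 ^ 2 + (a2 ^ 2 + b2 ^ 2) +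
    (n * (k1 ^ 2 + k2 ^ 2)) * (2 * x + x ^ 2 + y ^ 2)).
  { replace (n * (k1 ^ 2 + k2 ^ 2) * (2 * x + x ^ 2 + y ^ 2)) with
     (2 * (x * k1 * (n * k1 - 0 * k2) + x * k2 * (n * k2 + 0 * k1)) +
      n * (k1 ^ 2 + k2 ^ 2) * (x ^ 2 + y ^ 2)) by ring.
    replace (2 * (x * k1 * (n * k1 - 0 * k2) + x * k2 * (n * k2 + 0 * k1)))
      with (2 * ((x * k1 - y * k2) * (n * k1 - 0 * k2) + (x * k2 + y * k1) * (n * k2 + 0 * k1))) by
          ring.
    rewrite E1, E2, En. ring. }
  rewrite I. nra.
Qed.

(** The matrix with columns (w11, w21) and (w12, w22) is the solution of the pole problem with its
    first column multiplied by [bl]. This moves all singularities to the lower half-plane. The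
    residue relations become the linear conditions [dx_int1] and [dx_int2], namely that (1, E j)
    lies in the kernel at [pole s j], and the bound by 1 on the closed upper half-plane becomes an
    invariant of the construction. *)
Record darboux (s : nat -> R) (E : nat -> C) (N : nat) (w11 w12 w21 w22 : C -> C) (L : C) : Prop := {
  dx_diff : forall z, off_low s N z -> cdiff w11 z /\ cdiff w12 z /\ cdiff w21 z /\ cdiff w22 z;
  dx_inf11 : tends nbinf w11 (RtoC 1);
  dx_inf12 : tends nbinf w12 (RtoC 0);
  dx_inf21 : tends nbinf w21 (RtoC 0);
  dx_inf22 : tends nbinf w22 (RtoC 1);
  dx_coef : tends nbinf (fun z => (z * w12 z)%C) L;
  dx_sym1 : forall z, off_poles s N z -> w11 z = (bl s N z * sch w22 z)%C;
  dx_sym2 : forall z, off_poles s N z -> w21 z = (- (bl s N z * sch w12 z))%C;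
  dx_int1 : forall j, (j < N)%nat -> (w11 (pole s j) + E j * w12 (pole s j))%C = RtoC 0;
  dx_int2 : forall j, (j < N)%nat -> (w21 (pole s j) + E j * w22 (pole s j))%C = RtoC 0;
  dx_con1 : forall z, 0 <= snd z -> Cmod (w11 z) ^ 2 + Cmod (w21 z) ^ 2 <= 1;
  dx_con2 : forall z, 0 <= snd z -> Cmod (w12 z) ^ 2 + Cmod (w22 z) ^ 2 <= 1;
  dx_det : forall z, off_low s N z ->
    (w11 z * w22 z - w12 z * w21 z)%C = bl s N z }.

Lemma blaschke_factor_le_1 (a : R) (z : C) : 0 < a -> 0 <= snd z ->
  Cmod ((z - Ci * RtoC a) / (z + Ci * RtoC a)) <= 1.
Proof.
  intros Ha Hz.
  assert (H0 : (z + Ci * RtoC a)%C <> RtoC 0).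
  { intros E. apply (f_equal snd) in E. simpl in E. lra. }
  rewrite Cmod_div by auto.
  assert (Hp : 0 < Cmod (z + Ci * RtoC a)) by now apply Cmod_gt_0.
  apply Rmult_le_reg_r with (Cmod (z + Ci * RtoC a)); auto.
  unfold Rdiv. rewrite Rmult_assoc, Rinv_l by lra. rewrite Rmult_1_r, Rmult_1_l.
  apply Rsqr_incr_0; try apply Cmod_ge_0.
  rewrite !Rsqr_pow2, !Cmod2_alt. unfold Re, Im. destruct z as (x, y). simpl in *. nra.
Qed.

(* One dressing step: multiply on the left by I + g P, where P is the orthogonal
   projection onto q and 1 + g = (z - p)/(z + p). *)
Definition dress_factor (p z : C) : C := (RtoC (-2) * p / (z + p))%C.

Lemma dress_factor_eq p z : z <> (- p)%C ->
  (RtoC 1 + dress_factor p z)%C = ((z - p) / (z + p))%C.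
Proof.
  intros H. assert (H0 := Cplus_neq_0 _ _ H). unfold dress_factor.
  replace (RtoC (-2)) with (- RtoC 2)%C by (apply injective_projections; simpl; ring).
  replace (RtoC 2) with (RtoC 1 + RtoC 1)%C by (apply injective_projections; simpl; ring).
  field. auto.
Qed.

Lemma cdiff_dress_factor p z : z <> (- p)%C -> cdiff (dress_factor p) z.
Proof.
  intros H. apply (cdiff_div (fun _ => (RtoC (-2) * p)%C) (fun z => (z + p)%C)).
  - now apply Cplus_neq_0.
  - apply cdiff_const.
  - apply cdiff_plus; [apply cdiff_id|apply cdiff_const].
Qed.

Lemma z_dress_factor_inf p :
  tends nbinf (fun z => (z * dress_factor p z)%C) (RtoC (-2) * p)%C.
Proof.
  apply tends_ext with (fun z => (RtoC (-2) * p * ker (- p)%C z)%C).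
  - intros z. unfold ker, dress_factor, Cdiv.
    replace (z - - p)%C with (z + p)%C by ring. ring.
  - apply tends_eq with (RtoC (-2) * p * RtoC 1)%C; [|ring].
    apply tends_mult; [apply tends_const|apply ker_inf].
Qed.

Lemma dress_factor_inf p : tends nbinf (dress_factor p) (RtoC 0).
Proof.
  apply tends_ext_loc with (fun z => (/ z * (z * dress_factor p z))%C).
  - generalize (nbinf_neq (RtoC 0)). apply filter_imp. intros z Hz. field. auto.
  - apply tends_eq with (RtoC 0 * (RtoC (-2) * p))%C; [|ring].
    apply tends_mult; [apply tends_inv_inf|apply z_dress_factor_inf].
Qed.

Lemma pole_not_low s N n : pos_distinct s (S N) -> (n <= N)%nat -> off_low s (S N) (pole s n).
Proof. intros (Hp & _) Hn j Hj. apply pole_neq_opp; apply Hp; lia. Qed.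

Lemma darboux_step s E N w11 w12 w21 w22 L : pos_distinct s (S N) ->
  darboux s E N w11 w12 w21 w22 L ->
  exists v11 v12 v21 v22 L', darboux s E (S N) v11 v12 v21 v22 L'.
Proof.
  intros Hs H.
  set (p := pole s N).
  assert (HsN : 0 < s N) by (apply Hs; lia).
  assert (Hp0 : (p + p)%C <> RtoC 0).
  { apply Cplus_neq_0. apply pole_neq_opp; auto. }
  assert (Hplow : off_low s N p).
  { intros j Hj. apply (pole_not_low s N N Hs); lia. }
  assert (Hpoff : off_poles s N p).
  { intros j Hj. split; [|now apply Hplow]. intros Ep. apply pole_inj in Ep.
    apply (proj2 Hs N j); auto; lia. }
  (* q is the image of the prescribed kernel vector (1, E N) under the current matrix. It is nonzero
     because the determinant there is [bl s N p] and [p] differs from the earlier poles. *)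
  set (q1 := (w11 p + E N * w12 p)%C).
  set (q2 := (w21 p + E N * w22 p)%C).
  set (n := Cmod q1 ^ 2 + Cmod q2 ^ 2).
  assert (Hn : 0 < n).
  { assert (B := bl_neq_0 s N p Hpoff).
    destruct (Req_dec n 0) as [E0|E0].
    - assert (Q1 : q1 = RtoC 0).
      { apply Cmod_eq_0. generalize (pow2_ge_0 (Cmod q1)) (pow2_ge_0 (Cmod q2)) (Cmod_ge_0 q1).
        unfold n in E0. nra. }
      assert (Q2 : q2 = RtoC 0).
      { apply Cmod_eq_0. generalize (pow2_ge_0 (Cmod q1)) (pow2_ge_0 (Cmod q2)) (Cmod_ge_0 q2).
        unfold n in E0. nra. }
      destruct B. rewrite <- (dx_det _ _ _ _ _ _ _ _ H p Hplow).
      replace (w11 p * w22 p - w12 p * w21 p)%C with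
        (q1 * w22 p - q2 * w12 p)%C by (unfold q1, q2; ring).
      rewrite Q1, Q2. ring.
    - generalize (pow2_ge_0 (Cmod q1)) (pow2_ge_0 (Cmod q2)). unfold n in *. lra. }
  set (k := fun u1 u2 : C => (RtoC (/ n) * (Cconj q1 * u1 + Cconj q2 * u2))%C).
  set (g := dress_factor p).
  set (top := fun (u1 u2 : C -> C) z => (u1 z + g z * (k (u1 z) (u2 z) * q1))%C).
  set (bot := fun (u1 u2 : C -> C) z => (u2 z + g z * (k (u1 z) (u2 z) * q2))%C).
  assert (Hnk : (RtoC (/ n) * (q1 * Cconj q1 + q2 * Cconj q2))%C = RtoC 1).
  { rewrite <- !Cmod2_conj, <- !RtoC_plus, <- RtoC_mult. f_equal. fold n. field. lra. }
  assert (Hkq : k q1 q2 = RtoC 1).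
  { rewrite <- Hnk. unfold k. ring. }
  assert (Hgc : forall u1 u2 z, cdiff u1 z -> cdiff u2 z -> cdiff g z ->
     cdiff (top u1 u2) z /\ cdiff (bot u1 u2) z).
  { intros u1 u2 z H1 H2 H3.
    assert (cdiff (fun z => k (u1 z) (u2 z)) z).
    { apply cdiff_mult; [apply cdiff_const|].
      apply cdiff_plus; apply cdiff_mult; auto; apply cdiff_const. }
    split; apply cdiff_plus; auto; apply cdiff_mult; auto; apply cdiff_mult; auto; apply cdiff_const. }
  assert (Hkinf : forall u1 u2 l1 l2, tends nbinf u1 l1 -> tends nbinf u2 l2 ->
     tends nbinf (fun z => k (u1 z) (u2 z)) (k l1 l2)).
  { intros u1 u2 l1 l2 H1 H2. apply tends_mult; [apply tends_const|].
    apply tends_plus; apply tends_mult; auto; apply tends_const. }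
  assert (Hinf : forall u1 u2 l1 l2, tends nbinf u1 l1 -> tends nbinf u2 l2 ->
     tends nbinf (top u1 u2) l1 /\ tends nbinf (bot u1 u2) l2).
  { intros u1 u2 l1 l2 H1 H2. split.
    - apply tends_eq with (l1 + RtoC 0 * (k l1 l2 * q1))%C; [|ring].
      apply tends_plus; auto. apply tends_mult; [apply dress_factor_inf|].
      apply tends_mult; [now apply Hkinf|apply tends_const].
    - apply tends_eq with (l2 + RtoC 0 * (k l1 l2 * q2))%C; [|ring].
      apply tends_plus; auto. apply tends_mult; [apply dress_factor_inf|].
      apply tends_mult; [now apply Hkinf|apply tends_const]. }
  (* At [p] the factor is I - P, which annihilates q and so creates the new kernel relation; being
     applied from the left, it preserves the old ones. *)
  assert (Hgp : g p = RtoC (-1)).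
  { unfold g, dress_factor.
    replace (RtoC (-2)) with (RtoC (-1) + RtoC (-1))%C by (apply injective_projections; simpl; ring).
    field. exact Hp0. }
  assert (Hgs : forall z, z <> p -> z <> (- p)%C ->
     Cconj (g (Cconj z)) = (- (RtoC (-2) * p / (z - p)))%C).
  { intros z Z1 Z2. assert (A1 := Cminus_neq_0 _ _ Z1).
    assert (A2 : (Cconj z + p)%C <> RtoC 0).
    { apply Cplus_neq_0. intros Ez. apply Z1. rewrite <- (Cconj_conj z), Ez, Copp_conj.
      unfold p. rewrite Cconj_pole. ring. }
    unfold g, dress_factor. rewrite Cdiv_conj, Cmult_conj, Cplus_conj, Cconj_conj, RtoC_conj by auto.
    unfold p at 1 2. rewrite Cconj_pole. fold p.
    replace (z + - p)%C with (z - p)%C by ring. field. auto. }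
  exists (top w11 w21), (top w12 w22), (bot w11 w21), (bot w12 w22),
    (L + RtoC (-2) * p * (k (RtoC 0) (RtoC 1) * q1))%C.
  destruct H as [dd i11 i12 i21 i22 co sy1 sy2 in1 in2 cn1 cn2 dt]. constructor.
  - intros z Hz.
    assert (Hz1 : off_low s N z) by (intros j Hj; apply Hz; lia).
    assert (Hg : cdiff g z) by (apply cdiff_dress_factor, Hz; lia).
    destruct (dd z Hz1) as (D1 & D2 & D3 & D4).
    destruct (Hgc w11 w21 z D1 D3 Hg), (Hgc w12 w22 z D2 D4 Hg). auto.
  - now apply (Hinf w11 w21 (RtoC 1) (RtoC 0)).
  - now apply (Hinf w12 w22 (RtoC 0) (RtoC 1)).
  - now apply (Hinf w11 w21 (RtoC 1) (RtoC 0)).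
  - now apply (Hinf w12 w22 (RtoC 0) (RtoC 1)).
  - apply tends_ext with (fun z => (z * w12 z + z * g z * (k (w12 z) (w22 z) * q1))%C).
    + intros z. unfold top. ring.
    + apply tends_plus; auto. apply tends_mult; [apply z_dress_factor_inf|].
      apply tends_mult; [now apply Hkinf|apply tends_const].
  - intros z Hz.
    assert (Hz1 : off_poles s N z) by (intros j Hj; apply Hz; lia).
    destruct (Hz N ltac:(lia)) as (Z1 & Z2). fold p in Z1, Z2.
    assert (A1 := Cminus_neq_0 _ _ Z1). assert (A2 := Cplus_neq_0 _ _ Z2).
    rewrite bl_S. fold p. unfold sch, top, bot.
    rewrite Cplus_conj, !Cmult_conj, Hgs by auto.
    rewrite sy1, sy2 by auto. unfold sch.
    unfold k. rewrite Cmult_conj, Cplus_conj, !Cmult_conj, !Cconj_conj, RtoC_conj.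
    set (B := bl s N z). set (x := Cconj (w22 (Cconj z))). set (y := Cconj (w12 (Cconj z))).
    unfold g, dress_factor.
    set (m2 := RtoC (-2)).
    assert (Hm2 : ((z - p) / (z + p))%C = (RtoC 1 + m2 * p / (z + p))%C).
    { symmetry. apply dress_factor_eq. auto. }
    assert (Hb : ((z - p) / (z + p) * - (m2 * p / (z - p)))%C =
      (- (m2 * p / (z + p)))%C) by (field; auto).
    match goal with |- ?lhs = (B * ?bt * (x + ?gs * ?rest))%C =>
      transitivity (B * (bt * x + bt * gs * rest))%C end.
    + rewrite Hb, Hm2. set (G := (m2 * p / (z + p))%C).
      match goal with |- ?lhs = ?rhs =>
        replace lhs with (B * (x + G * (RtoC (/ n) * (q1 * Cconj q1 * x - q1 * Cconj q2 * y))))%C by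
            ring;
        replace rhs with (B * (x + G * (x - RtoC (/ n) * (q2 * Cconj q2 * x) - RtoC (/ n) * (q1 *
            Cconj q2 * y))))%C by ring
      end.
      (* The coefficient 1 of [x] is replaced by the normalization [Hnk] of q: the symmetry survives
         the step because P is the orthogonal projection and its complement is the projection onto
         the orthogonal vector. *)
      rewrite <- (Cmult_1_l x) at 4. rewrite <- Hnk. ring.
    + ring.
  - intros z Hz.
    assert (Hz1 : off_poles s N z) by (intros j Hj; apply Hz; lia).
    destruct (Hz N ltac:(lia)) as (Z1 & Z2). fold p in Z1, Z2.
    assert (A1 := Cminus_neq_0 _ _ Z1). assert (A2 := Cplus_neq_0 _ _ Z2).
    rewrite bl_S. fold p. unfold sch, top, bot.
    rewrite Cplus_conj, !Cmult_conj, Hgs by auto.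
    rewrite sy1, sy2 by auto. unfold sch.
    unfold k. rewrite Cmult_conj, Cplus_conj, !Cmult_conj, !Cconj_conj, RtoC_conj.
    set (B := bl s N z). set (x := Cconj (w22 (Cconj z))). set (y := Cconj (w12 (Cconj z))).
    unfold g, dress_factor.
    set (m2 := RtoC (-2)).
    assert (Hm2 : ((z - p) / (z + p))%C = (RtoC 1 + m2 * p / (z + p))%C).
    { symmetry. apply dress_factor_eq. auto. }
    assert (Hb : ((z - p) / (z + p) * - (m2 * p / (z - p)))%C =
      (- (m2 * p / (z + p)))%C) by (field; auto).
    match goal with |- ?lhs = (- (B * ?bt * (y + ?gs * ?rest)))%C =>
      transitivity (- (B * (bt * y + bt * gs * rest)))%C end.
    + rewrite Hb, Hm2. set (G := (m2 * p / (z + p))%C).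
      match goal with |- ?lhs = ?rhs =>
        replace lhs with (- (B * (y + G * (RtoC (/ n) * (q2 * Cconj q2 * y - q2 * Cconj q1 * x)))))%C
            by ring;
        replace rhs with (- (B * (y + G * (y - RtoC (/ n) * (q1 * Cconj q1 * y) - RtoC (/ n) * (q2 *
            Cconj q1 * x)))))%C by ring
      end.
      rewrite <- (Cmult_1_l y) at 4. rewrite <- Hnk. ring.
    + ring.
  - intros j Hj. unfold top. destruct (Nat.eq_dec j N) as [->|Hn'].
    + fold p. rewrite Hgp.
      replace (w11 p + RtoC (-1) * (k (w11 p) (w21 p) * q1) + E N * (w12 p + RtoC (-1) * (k (w12 p)
          (w22 p) * q1)))%C
        with (q1 + RtoC (-1) * (k q1 q2 * q1))%C by (unfold k, q1, q2; ring).
      rewrite Hkq. apply injective_projections; simpl; ring.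
    + assert (I1 := in1 j ltac:(lia)). assert (I2 := in2 j ltac:(lia)).
      set (z := pole s j) in *.
      replace (w11 z + g z * (k (w11 z) (w21 z) * q1) + E j * (w12 z + g z * (k (w12 z) (w22 z) *
          q1)))%C with
        (w11 z + E j * w12 z + g z * (k (w11 z + E j * w12 z)%C (w21 z + E j * w22 z)%C * q1))%C
        by (unfold k; ring).
      rewrite I1, I2. unfold k. ring.
  - intros j Hj. unfold bot. destruct (Nat.eq_dec j N) as [->|Hn'].
    + fold p. rewrite Hgp.
      replace (w21 p + RtoC (-1) * (k (w11 p) (w21 p) * q2) + E N * (w22 p + RtoC (-1) * (k (w12 p)
          (w22 p) * q2)))%C
        with (q2 + RtoC (-1) * (k q1 q2 * q2))%C by (unfold k, q1, q2; ring).
      rewrite Hkq. apply injective_projections; simpl; ring.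
    + assert (I1 := in1 j ltac:(lia)). assert (I2 := in2 j ltac:(lia)).
      set (z := pole s j) in *.
      replace (w21 z + g z * (k (w11 z) (w21 z) * q2) + E j * (w22 z + g z * (k (w12 z) (w22 z) *
          q2)))%C with
        (w21 z + E j * w22 z + g z * (k (w11 z + E j * w12 z)%C (w21 z + E j * w22 z)%C * q2))%C
        by (unfold k; ring).
      rewrite I1, I2. unfold k. ring.
  - intros z Hz. eapply Rle_trans; [|apply (cn1 z Hz)].
    apply (contraction_step (w11 z) (w21 z) q1 q2 (g z) n); auto.
    unfold g. rewrite dress_factor_eq.
    + now apply blaschke_factor_le_1.
    + unfold p. rewrite pole_eq. intros ->. simpl in Hz. lra.
  - intros z Hz. eapply Rle_trans; [|apply (cn2 z Hz)].
    apply (contraction_step (w12 z) (w22 z) q1 q2 (g z) n); auto.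
    unfold g. rewrite dress_factor_eq.
    + now apply blaschke_factor_le_1.
    + unfold p. rewrite pole_eq. intros ->. simpl in Hz. lra.
  - intros z Hz.
    assert (Hz1 : off_low s N z) by (intros j Hj; apply Hz; lia).
    rewrite bl_S, <- (dt z Hz1). fold p.
    rewrite <- dress_factor_eq by (apply Hz; lia). fold g.
    unfold top, bot.
    transitivity ((w11 z * w22 z - w12 z * w21 z) * (RtoC 1 + g z * (RtoC (/ n) * (q1 * Cconj q1 + q2
        * Cconj q2))))%C.
    + unfold k. ring.
    + rewrite Hnk. ring.
Qed.

Lemma darboux_exists s E N : pos_distinct s N ->
  exists w11 w12 w21 w22 L, darboux s E N w11 w12 w21 w22 L.
Proof.
  induction N as [|N IH]; intros Hs.
  - exists (fun _ => RtoC 1), (fun _ => RtoC 0), (fun _ => RtoC 0), (fun _ => RtoC 1), (RtoC 0).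
    assert (B : forall z, bl s 0 z = RtoC 1) by reflexivity.
    constructor; try (apply tends_const); try (intros j Hj; lia).
    + intros z _. repeat split; apply cdiff_const.
    + apply tends_ext with (fun _ => RtoC 0); [intros z; ring|apply tends_const].
    + intros z _. rewrite B. unfold sch. rewrite RtoC_conj. ring.
    + intros z _. rewrite B. unfold sch. rewrite RtoC_conj. ring.
    + intros z _. rewrite Cmod_1, Cmod_0. lra.
    + intros z _. rewrite Cmod_1, Cmod_0. lra.
    + intros z _. rewrite B. ring.
  - destruct IH as (w11 & w12 & w21 & w22 & L & H).
    + destruct Hs as (H1 & H2). split; intros; [apply H1|apply H2]; lia.
    + now apply (darboux_step s E N w11 w12 w21 w22 L).
Qed.

(* The data of the pole problem in terms of its second column (f, g):
   the matrix is ((g*, f), (-f*, g)) with f* the Schwarz reflection. *)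
Record soldata (s : nat -> R) (N : nat) (c : nat -> C) (f g : C -> C) : Prop := {
  sd_f : forall z, off_low s N z -> cdiff f z;
  sd_g : forall z, off_low s N z -> cdiff g z;
  sd_finf : tends nbinf f (RtoC 0);
  sd_ginf : tends nbinf g (RtoC 1);
  sd_det : forall z, off_poles s N z ->
    (f z * sch f z + g z * sch g z)%C = RtoC 1;
  sd_resg : forall j, (j < N)%nat -> tends (punct (pole s j))
    (fun z => ((z - pole s j) * sch g z)%C) (c j * f (pole s j))%C;
  sd_resf : forall j, (j < N)%nat -> tends (punct (pole s j))
    (fun z => ((z - pole s j) * sch f z)%C) (- (c j * g (pole s j)))%C }.

Lemma Cmod_le_of_sq (a b : C) m : 0 <= m -> Cmod a ^ 2 + Cmod b ^ 2 <= m ^ 2 ->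
  Cmod a <= m /\ Cmod b <= m.
Proof.
  intros Hm H. generalize (Cmod_ge_0 a) (Cmod_ge_0 b). intros. split; nra.
Qed.

Lemma soldata_exists s N E : pos_distinct s N -> exists f g L,
  soldata s N (fun j => (- (E j * rho s N j))%C) f g /\
  tends nbinf (fun z => (z * f z)%C) L /\
  (forall z, 0 <= snd z -> Cmod (f z) <= 1 /\ Cmod (g z) <= 1) /\
  (forall z, off_poles s N z -> snd z <= 0 ->
     Cmod (f z) <= / Cmod (bl s N (Cconj z)) /\ Cmod (g z) <= / Cmod (bl s N (Cconj z))).
Proof.
  intros Hs. destruct (darboux_exists s E N Hs) as (w11 & w12 & w21 & w22 & L & H).
  destruct H as [dd i11 i12 i21 i22 co sy1 sy2 in1 in2 cn1 cn2 dt]. exists w12, w22, L.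
  assert (Hg : forall z, off_poles s N z -> sch w22 z = (w11 z / bl s N z)%C).
  { intros z Hz. rewrite sy1 by auto. assert (B := bl_neq_0 s N z Hz). field. auto. }
  assert (Hf : forall z, off_poles s N z -> sch w12 z = (- (w21 z / bl s N z))%C).
  { intros z Hz. rewrite sy2 by auto. assert (B := bl_neq_0 s N z Hz). field. auto. }
  assert (Hpl : forall j, (j < N)%nat -> off_low s N (pole s j)).
  { intros j Hj k Hk. apply pole_neq_opp; now apply Hs. }
  split; [constructor; auto|split; [auto|split]].
  - intros z Hz. now apply dd.
  - intros z Hz. now apply dd.
  - intros z Hz. assert (B := bl_neq_0 s N z Hz). rewrite Hg, Hf by auto.
    transitivity ((w11 z * w22 z - w12 z * w21 z) / bl s N z)%C.
    + field. auto.
    + rewrite dt by now apply off_poles_low. field. auto.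
  - intros j Hj. set (p := pole s j).
    apply (tends_ext_loc (F := punct p)
      (fun z => ((z - p) / bl s N z * w11 z)%C)).
    + generalize (off_poles_pnb s N p). apply filter_imp. intros z Hz. rewrite Hg by auto.
      unfold Cdiv. ring.
    + apply tends_eq with (rho s N j * w11 p)%C.
      * apply tends_mult; [now apply rho_limit|]. apply tends_nb_pnb, cdiff_cont, dd. now apply Hpl.
      * replace (w11 p) with (w11 p + E j * w12 p - E j * w12 p)%C by ring.
        unfold p. rewrite in1 by auto. ring.
  - intros j Hj. set (p := pole s j).
    apply (tends_ext_loc (F := punct p)
      (fun z => (- ((z - p) / bl s N z * w21 z))%C)).
    + generalize (off_poles_pnb s N p). apply filter_imp. intros z Hz. rewrite Hf by auto.
      unfold Cdiv. ring.
    + apply tends_eq with (- (rho s N j * w21 p))%C.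
      * apply tends_opp, tends_mult; [now apply rho_limit|].
        apply tends_nb_pnb, cdiff_cont, dd. now apply Hpl.
      * replace (w21 p) with (w21 p + E j * w22 p - E j * w22 p)%C by ring.
        unfold p. rewrite in2 by auto. ring.
  - intros z Hz. apply Cmod_le_of_sq; [lra|]. rewrite pow1. auto.
  - intros z Hz Hs0.
    assert (Hzc := off_poles_conj _ _ _ Hz). assert (B := bl_neq_0 s N _ Hzc).
    assert (Hsn : 0 <= snd (Cconj z)) by (simpl; lra).
    assert (Hpos : 0 < Cmod (bl s N (Cconj z))) by now apply Cmod_gt_0.
    destruct (Cmod_le_of_sq (w11 (Cconj z)) (w21 (Cconj z)) 1 ltac:(lra)) as (B1 & B2).
    { rewrite pow1. auto. }
    split.
    + rewrite <- (sch_sch w12 z). unfold sch at 1. rewrite Cmod_conj, Hf, Cmod_opp, Cmod_div by auto.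
      unfold Rdiv. rewrite <- (Rmult_1_l (/ Cmod (bl s N (Cconj z)))) at 2.
      apply Rmult_le_compat_r; auto. now apply Rlt_le, Rinv_0_lt_compat.
    + rewrite <- (sch_sch w22 z). unfold sch at 1. rewrite Cmod_conj, Hg, Cmod_div by auto.
      unfold Rdiv. rewrite <- (Rmult_1_l (/ Cmod (bl s N (Cconj z)))) at 2.
      apply Rmult_le_compat_r; auto. now apply Rlt_le, Rinv_0_lt_compat.
Qed.

(** * The pole problem: uniqueness *)

(** [recover_val] is an arbitrary choice among the values produced by solutions. One solution with a
    coefficient, together with uniqueness of the (1,2) entry near infinity, pins it down. *)
Lemma recover_val_eq (sol : (C -> M2) -> Prop) (M : C -> M2) (L : C) :
  sol M -> clim_inf (fun z => (z * m12 (M z))%C) L ->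
  (forall M', sol M' -> nbinf (fun z => m12 (M' z) = m12 (M z))) ->
  recover_val sol = (RtoC 2 * (Ci * L))%C.
Proof.
  intros HM HL Hu. unfold recover_val.
  set (P := fun v => exists M, sol M /\
     exists L, clim_inf (fun z => (z * m12 (M z))%C) L /\ v = (RtoC 2 * (Ci * L))%C).
  assert (HP : P (epsilon (inhabits (RtoC 0)) P)).
  { apply epsilon_spec. exists (RtoC 2 * (Ci * L))%C, M. eauto. }
  destruct HP as (M' & HM' & L' & HL' & ->). do 2 f_equal.
  apply (tends_unique nbinf (fun z => (z * m12 (M z))%C)); [|exact HL].
  apply tends_ext_loc with (fun z => (z * m12 (M' z))%C); [|exact HL'].
  generalize (Hu M' HM'). apply filter_imp. intros z ->. reflexivity.
Qed.

Section Pole_problem.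
Context (s : nat -> R) (N : nat) (c : nat -> C) (f g : C -> C).
Context (Hs : pos_distinct s N) (HS : soldata s N c f g).

Lemma pole_off_low j : (j < N)%nat -> off_low s N (pole s j).
Proof. intros Hj k Hk. apply pole_neq_opp; now apply Hs. Qed.

Lemma Cconj_opp_pole j : Cconj (- pole s j) = pole s j.
Proof. rewrite Copp_conj, Cconj_pole. ring. Qed.

Lemma f_at_pole j : (j < N)%nat -> tends (punct (pole s j)) f (f (pole s j)).
Proof. intros Hj. apply tends_nb_pnb, cdiff_cont, (sd_f _ _ _ _ _ HS), pole_off_low, Hj. Qed.
Lemma g_at_pole j : (j < N)%nat -> tends (punct (pole s j)) g (g (pole s j)).
Proof. intros Hj. apply tends_nb_pnb, cdiff_cont, (sd_g _ _ _ _ _ HS), pole_off_low, Hj. Qed.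

Lemma tends_punct_conj h q l : tends (punct (Cconj q)) h l ->
  tends (punct q) (fun z => Cconj (h (Cconj z))) (Cconj l).
Proof.
  intros H. apply tends_conj. apply (tends_comp (punct (Cconj q)) Cconj h); auto.
  apply pnb_conj.
Qed.

Lemma schf_at_low j : (j < N)%nat ->
  tends (punct (- pole s j)%C) (sch f) (Cconj (f (pole s j))).
Proof. intros Hj. apply tends_punct_conj. rewrite Cconj_opp_pole. now apply f_at_pole. Qed.
Lemma schg_at_low j : (j < N)%nat ->
  tends (punct (- pole s j)%C) (sch g) (Cconj (g (pole s j))).
Proof. intros Hj. apply tends_punct_conj. rewrite Cconj_opp_pole. now apply g_at_pole. Qed.

Lemma res_at_low (h : C -> C) j l :
  tends (punct (pole s j)) (fun z => ((z - pole s j) * sch h z)%C) l ->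
  tends (punct (- pole s j)%C)
    (fun z => ((z - - pole s j) * h z)%C) (Cconj l).
Proof.
  intros H. rewrite <- Cconj_opp_pole in H at 1. apply tends_punct_conj in H.
  eapply (tends_ext (F := punct (- pole s j)%C)); [|exact H]. intros z. simpl.
  rewrite Cmult_conj, Cminus_conj, !Cconj_conj, Cconj_pole. f_equal.
  unfold sch. now rewrite !Cconj_conj.
Qed.

Lemma f_res_low j : (j < N)%nat -> tends (punct (- pole s j)%C)
  (fun z => ((z - - pole s j) * f z)%C)
  (- (Cconj (c j) * Cconj (g (pole s j))))%C.
Proof.
  intros Hj. eapply tends_eq; [apply res_at_low, (sd_resf _ _ _ _ _ HS j Hj)|].
  now rewrite Copp_conj, Cmult_conj.
Qed.
Lemma g_res_low j : (j < N)%nat -> tends (punct (- pole s j)%C)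
  (fun z => ((z - - pole s j) * g z)%C)
  (Cconj (c j) * Cconj (f (pole s j)))%C.
Proof.
  intros Hj. eapply tends_eq; [apply res_at_low, (sd_resg _ _ _ _ _ HS j Hj)|].
  now rewrite Cmult_conj.
Qed.

Lemma tends_shift_0 p (h : C -> C) l : tends (punct p) h l ->
  tends (punct p) (fun z => ((z - p) * h z)%C) (RtoC 0).
Proof.
  intros H. apply tends_eq with ((p - p) * l)%C; [|ring].
  apply tends_mult; auto. apply tends_minus; [apply tends_id_pnb|apply tends_const].
Qed.

Definition sol_matrix (z : C) : M2 := mk2 (sch g z) (f z) (- sch f z)%C (g z).

Lemma sch_infty h l : tends nbinf h l -> tends nbinf (sch h) (Cconj l).
Proof.
  intros H. apply tends_conj. apply (tends_comp nbinf Cconj h); auto. apply nbinf_conj.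
Qed.

Lemma off_poles_of_not z :
  ~ (exists n, (n < N)%nat /\ (z = (Ci * RtoC (s n))%C \/ z = (- (Ci * RtoC (s n)))%C)) ->
  off_poles s N z.
Proof. intros H j Hj. split; intros E; apply H; exists j; auto. Qed.

Lemma off_low_conj z : off_poles s N z -> off_low s N (Cconj z).
Proof. intros H. now apply off_poles_low, off_poles_conj. Qed.

Lemma sol_matrix_dRHP : dRHP_sol N s c sol_matrix.
Proof.
  split; [|split; [|split]].
  - intros z Hz. apply off_poles_of_not in Hz.
    assert (H1 := off_poles_low _ _ _ Hz). assert (H2 := off_low_conj _ Hz).
    destruct HS as [hf hg hfi hgi hdet hrg hrf]. split; [|split; [|split]].
    + now apply cdiff_sch, hg.
    + now apply hf.
    + now apply cdiff_opp, cdiff_sch, hf.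
    + now apply hg.
  - intros n Hn. change (Ci * RtoC (s n))%C with (pole s n). set (p := pole s n).
    exists (mk2 (c n * f p)%C (RtoC 0) (c n * g p)%C (RtoC 0)).
    split; (split; [|split; [|split]]); cbn [m11 m12 m21 m22 mscal mmul sol_matrix].
    + apply (sd_resg _ _ _ _ _ HS n Hn).
    + now apply tends_shift_0 with (f p), f_at_pole.
    + apply (tends_ext (F := punct p) (fun z => (- ((z - p) * sch f z))%C)).
      * intros z. ring.
      * apply tends_eq with (- (- (c n * g p)))%C; [|ring].
        apply tends_opp, (sd_resf _ _ _ _ _ HS n Hn).
    + now apply tends_shift_0 with (g p), g_at_pole.
    + apply (tends_ext (F := punct p) (fun z => (c n * f z)%C)).
      * intros z. ring.
      * apply tends_mult; [apply (tends_const (F := punct p))|now apply f_at_pole].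
    + apply (tends_ext (F := punct p) (fun z => RtoC 0)); [intros z; ring|apply (tends_const (F :=
        punct p))].
    + apply (tends_ext (F := punct p) (fun z => (c n * g z)%C)).
      * intros z. ring.
      * apply tends_mult; [apply (tends_const (F := punct p))|now apply g_at_pole].
    + apply (tends_ext (F := punct p) (fun z => RtoC 0)); [intros z; ring|apply (tends_const (F :=
        punct p))].
  - intros n Hn. change (Ci * RtoC (s n))%C with (pole s n). set (p := pole s n).
    exists (mk2 (RtoC 0) (- (Cconj (c n) * Cconj (g p)))%C
                (RtoC 0) (Cconj (c n) * Cconj (f p))%C).
    split; (split; [|split; [|split]]); cbn [m11 m12 m21 m22 mscal mmul sol_matrix].
    + now apply tends_shift_0 with (Cconj (g p)), schg_at_low.
    + now apply f_res_low.
    + apply tends_shift_0 with (- Cconj (f p))%C. apply tends_opp. now apply schf_at_low.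
    + now apply g_res_low.
    + apply (tends_ext (F := punct (- p)%C) (fun z => RtoC 0)); [intros z; ring|apply (tends_const (F
        := punct (- p)%C))].
    + apply (tends_ext (F := punct (- p)%C) (fun z => (- (Cconj (c n) * sch g z))%C)).
      * intros z. ring.
      * apply tends_opp, tends_mult; [apply (tends_const (F := punct (- p)%C))|now apply schg_at_low].
    + apply (tends_ext (F := punct (- p)%C) (fun z => RtoC 0)); [intros z; ring|apply (tends_const (F
        := punct (- p)%C))].
    + apply (tends_ext (F := punct (- p)%C) (fun z => (Cconj (c n) * sch f z)%C)).
      * intros z. ring.
      * apply tends_mult; [apply (tends_const (F := punct (- p)%C))|now apply schf_at_low].
  - destruct HS as [hf hg hfi hgi hdet hrg hrf]. split; [|split; [|split]]; cbn [m11 m12 m21 m22 mI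
      sol_matrix].
    + change (tends nbinf (sch g) (RtoC 1)). rewrite <- (RtoC_conj 1). apply sch_infty, hgi.
    + exact hfi.
    + change (tends nbinf (fun z => (- sch f z)%C) (RtoC 0)).
      apply tends_eq with (- Cconj (RtoC 0))%C; [|rewrite RtoC_conj; ring].
      apply tends_opp. apply sch_infty; exact hfi.
    + exact hgi.
Qed.

Definition pole_list : list C :=
  map (pole s) (seq 0 N) ++ map (fun j => (- pole s j)%C) (seq 0 N).

Lemma in_pole_list z : In z pole_list <->
  exists j, (j < N)%nat /\ (z = pole s j \/ z = (- pole s j)%C).
Proof.
  unfold pole_list. rewrite in_app_iff, !in_map_iff. split.
  - intros [(j & E & H)|(j & E & H)]; apply in_seq in H; exists j; split; auto; lia.
  - intros (j & H & [->| ->]); [left|right]; exists j; split; auto; apply in_seq; lia.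
Qed.

Lemma NoDup_map_inj {A B} (h : A -> B) (l : list A) :
  (forall x y, In x l -> In y l -> h x = h y -> x = y) -> NoDup l -> NoDup (map h l).
Proof.
  induction l as [|a l IH]; intros Hi HN; simpl; [constructor|].
  inversion HN; subst. constructor.
  - rewrite in_map_iff. intros (b & E & Hb). assert (b = a) by (apply Hi; simpl; auto). now subst.
  - apply IH; auto. intros x y Hx Hy. apply Hi; simpl; auto.
Qed.

Lemma NoDup_pole_list : NoDup pole_list.
Proof.
  assert (Hinj : forall x y, In x (seq 0 N) -> In y (seq 0 N) -> pole s x = pole s y -> x = y).
  { intros x y Hx Hy E. apply in_seq in Hx, Hy. apply pole_inj in E.
    destruct (Nat.eq_dec x y) as [|Hn]; auto. destruct (proj2 Hs x y); auto; lia. }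
  apply NoDup_app.
  - apply NoDup_map_inj; [exact Hinj|apply seq_NoDup].
  - apply NoDup_map_inj; [|apply seq_NoDup]. intros x y Hx Hy E. apply Hinj; auto.
    replace (pole s x) with (- (- pole s x))%C by ring. rewrite E. ring.
  - intros z H1 H2. apply in_map_iff in H1, H2.
    destruct H1 as (j & <- & Hj), H2 as (k & E & Hk). apply in_seq in Hj, Hk.
    apply (pole_neq_opp s j k); try (apply Hs; lia). auto.
Qed.

Lemma off_poles_inf : nbinf (off_poles s N).
Proof.
  assert (H : forall k, nbinf (fun z => forall j, (j < k)%nat -> z <> pole s j /\ z <> (- pole s j)%C)).
  { induction k as [|k IH].
    - apply filter_forall. intros z j Hj. lia.
    - generalize (filter_conj _ _ IH (filter_conj _ _ (nbinf_neq (pole s k)) (nbinf_neq (- pole s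
        k)%C))).
      apply filter_imp. intros z (H1 & H2 & H3) j Hj.
      destruct (Nat.eq_dec j k) as [->|]; auto. apply H1. lia. }
  apply H.
Qed.

Lemma not_in_pole_list z : ~ In z pole_list <-> off_poles s N z.
Proof.
  rewrite in_pole_list. split.
  - apply off_poles_of_not.
  - intros H (j & Hj & [E|E]); destruct (H j Hj); contradiction.
Qed.

Lemma meromorphic_extension h : (forall z, off_poles s N z -> cdiff h z) ->
  (forall j, (j < N)%nat ->
     tends (punct (pole s j)) (fun z => ((z - pole s j) * h z)%C) (RtoC 0)) ->
  (forall j, (j < N)%nat ->
     tends (punct (- pole s j)%C) (fun z => ((z - - pole s j) * h z)%C) (RtoC 0)) ->
  exists K, (forall z, cdiff K z) /\ (forall z, off_poles s N z -> K z = h z).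
Proof.
  intros Hd H1 H2.
  destruct (removable_finite pole_list h NoDup_pole_list) as (K & K1 & K2).
  - intros z Hz. apply Hd, not_in_pole_list, Hz.
  - intros p Hp. apply in_pole_list in Hp. destruct Hp as (j & Hj & [->| ->]); auto.
  - exists K. split; auto. intros z Hz. now apply K2, not_in_pole_list.
Qed.

Lemma meromorphic_const h l : (forall z, off_poles s N z -> cdiff h z) -> tends nbinf h l ->
  (forall j, (j < N)%nat ->
     tends (punct (pole s j)) (fun z => ((z - pole s j) * h z)%C) (RtoC 0)) ->
  (forall j, (j < N)%nat ->
     tends (punct (- pole s j)%C) (fun z => ((z - - pole s j) * h z)%C) (RtoC 0)) ->
  forall z, off_poles s N z -> h z = l.
Proof.
  intros Hd Hl H1 H2 z Hz.
  destruct (meromorphic_extension h Hd H1 H2) as (K & K1 & K2).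
  rewrite <- K2 by auto. apply (Liouville_except K nil); auto.
  - apply tends_ext_loc with h; auto. generalize off_poles_inf. apply filter_imp.
    intros w Hw. symmetry. auto.
  - intros w. now apply cdiff_cont.
Qed.

(** [H11] and [H12] form the first row of M times the inverse of the known solution, whose
    determinant is 1. The residue relations cancel all poles in them, so Liouville's theorem gives
    the row (1, 0). *)
Lemma dRHP_unique M : (forall j, (j < N)%nat -> c j <> RtoC 0) -> dRHP_sol N s c M ->
  forall z, off_poles s N z -> m12 (M z) = f z.
Proof.
  intros Hc (HM & Hup & Hlow & Hinf).
  set (x1 := fun z => m11 (M z)). set (x2 := fun z => m12 (M z)).
  assert (Hx : forall z, off_poles s N z -> cdiff x1 z /\ cdiff x2 z).
  { intros z Hz. destruct (HM z) as (D1 & D2 & _); auto.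
    intros (j & Hj & [E|E]); destruct (Hz j Hj); contradiction. }
  set (H11 := fun z => (x1 z * g z + x2 z * sch f z)%C).
  set (H12 := fun z => (x2 z * sch g z - x1 z * f z)%C).
  (* The residue relation provides a limit only for the product of [x2] and [c j]; dividing by the
     nonzero [c j] yields one for [x2] itself, tied to the residue of [x1]. *)
  assert (U : forall j, (j < N)%nat -> exists r,
    tends (punct (pole s j)) (fun z => ((z - pole s j) * x1 z)%C) r /\
    tends (punct (pole s j)) x2 (r / c j)%C).
  { intros j Hj. destruct (Hup j Hj) as (Rs & (R1 & _) & (R2 & _)).
    cbn [m11 m12 m21 m22 mscal mmul] in R1, R2. exists (m11 Rs). split; [exact R1|].
    apply (tends_ext (F := punct (pole s j)) (fun z => ((m11 (M z) * RtoC 0 + m12 (M z) * c j) / c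
        j)%C)).
    - intros z. unfold x2. field. auto.
    - apply (tends_div (F := punct (pole s j))); auto. apply (tends_const (F := punct (pole s j))). }
  assert (Lw : forall j, (j < N)%nat -> exists r,
    tends (punct (- pole s j)%C) (fun z => ((z - - pole s j) * x2 z)%C) r /\
    tends (punct (- pole s j)%C) x1 (- r / Cconj (c j))%C).
  { intros j Hj. destruct (Hlow j Hj) as (Rs & (_ & R1 & _) & (_ & R2 & _)).
    cbn [m11 m12 m21 m22 mscal mmul] in R1, R2. exists (m12 Rs). split; [exact R1|].
    assert (Hcc : Cconj (c j) <> RtoC 0).
    { apply Cmod_gt_0. rewrite Cmod_conj. apply Cmod_gt_0. auto. }
    apply (tends_ext (F := punct (- pole s j)%C) (fun z => (- (m11 (M z) * - Cconj (c j) + m12 (M z)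
        * RtoC 0) / Cconj (c j))%C)).
    - intros z. unfold x1. field. auto.
    - apply (tends_div (F := punct (- pole s j)%C)); auto.
      + now apply tends_opp.
      + apply (tends_const (F := punct (- pole s j)%C)). }
  assert (I1 : tends nbinf x1 (RtoC 1)) by apply Hinf.
  assert (I2 : tends nbinf x2 (RtoC 0)) by apply Hinf.
  destruct HS as [hf hg hfi hgi hdet hrg hrf].
  assert (J1 := sch_infty _ _ hfi). assert (J2 := sch_infty _ _ hgi).
  assert (E11 : forall z, off_poles s N z -> H11 z = RtoC 1).
  { apply meromorphic_const.
    - intros z Hz. destruct (Hx z Hz).
      apply cdiff_plus; apply cdiff_mult; auto; [now apply hg, off_poles_low|].
      now apply cdiff_sch, hf, off_low_conj.
    - apply tends_eq with (RtoC 1 * RtoC 1 + RtoC 0 * Cconj (RtoC 0))%C; [|ring].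
      apply tends_plus; apply tends_mult; auto.
    - intros j Hj. destruct (U j Hj) as (r & R1 & R2).
      apply (tends_ext (F := punct (pole s j)) (fun z => ((z - pole s j) * x1 z * g z + x2 z * ((z -
          pole s j) * sch f z))%C)).
      + intros z. unfold H11. ring.
      + apply tends_eq with (r * g (pole s j) + r / c j * - (c j * g (pole s j)))%C.
        * apply tends_plus; apply tends_mult; auto. now apply g_at_pole.
        * field. auto.
    - intros j Hj. destruct (Lw j Hj) as (r & R1 & R2).
      apply (tends_ext (F := punct (- pole s j)%C) (fun z => (x1 z * ((z - - pole s j) * g z) + (z -
          - pole s j) * x2 z * sch f z)%C)).
      + intros z. unfold H11. ring.
      + apply tends_eq with (- r / Cconj (c j) * (Cconj (c j) * Cconj (f (pole s j))) + r * Cconj (f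
          (pole s j)))%C.
        * apply tends_plus; apply tends_mult; auto; [now apply g_res_low|now apply schf_at_low].
        * field. apply Cmod_gt_0. rewrite Cmod_conj. apply Cmod_gt_0. auto. }
  assert (E12 : forall z, off_poles s N z -> H12 z = RtoC 0).
  { apply meromorphic_const.
    - intros z Hz. destruct (Hx z Hz).
      apply cdiff_minus; apply cdiff_mult; auto; [|now apply hf, off_poles_low].
      now apply cdiff_sch, hg, off_low_conj.
    - apply tends_eq with (RtoC 0 * Cconj (RtoC 1) - RtoC 1 * RtoC 0)%C; [|ring].
      apply tends_minus; apply tends_mult; auto.
    - intros j Hj. destruct (U j Hj) as (r & R1 & R2).
      apply (tends_ext (F := punct (pole s j)) (fun z => (x2 z * ((z - pole s j) * sch g z) - (z -
          pole s j) * x1 z * f z)%C)).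
      + intros z. unfold H12. ring.
      + apply tends_eq with (r / c j * (c j * f (pole s j)) - r * f (pole s j))%C.
        * apply tends_minus; apply tends_mult; auto. now apply f_at_pole.
        * field. auto.
    - intros j Hj. destruct (Lw j Hj) as (r & R1 & R2).
      apply (tends_ext (F := punct (- pole s j)%C) (fun z => ((z - - pole s j) * x2 z * sch g z - x1
          z * ((z - - pole s j) * f z))%C)).
      + intros z. unfold H12. ring.
      + apply tends_eq with (r * Cconj (g (pole s j)) - - r / Cconj (c j) * - (Cconj (c j) * Cconj (g
          (pole s j))))%C.
        * apply tends_minus; apply tends_mult; auto; [now apply schg_at_low|now apply f_res_low].
        * field. apply Cmod_gt_0. rewrite Cmod_conj. apply Cmod_gt_0. auto. }
  intros z Hz. change (m12 (M z)) with (x2 z).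
  transitivity (f z * H11 z + g z * H12 z)%C.
  - unfold H11, H12. rewrite <- (Cmult_1_r (x2 z)) at 1. rewrite <- (hdet z Hz). ring.
  - rewrite E11, E12 by auto. ring.
Qed.

Lemma recover_dRHP L : (forall j, (j < N)%nat -> c j <> RtoC 0) ->
  tends nbinf (fun z => (z * f z)%C) L ->
  recover_val (dRHP_sol N s c) = (RtoC 2 * (Ci * L))%C.
Proof.
  intros Hc HL. apply (recover_val_eq _ sol_matrix); auto.
  - apply sol_matrix_dRHP.
  - intros M' HM'. generalize off_poles_inf. apply filter_imp. intros z Hz. simpl.
    now apply dRHP_unique.
Qed.

End Pole_problem.

(** * Comparison of two pole problems *)

Fixpoint rsum (f : nat -> R) (n : nat) : R :=
  match n with O => 0 | S n' => rsum f n' + f n' end.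

Lemma rsum_nonneg f n : (forall j, (j < n)%nat -> 0 <= f j) -> 0 <= rsum f n.
Proof.
  induction n as [|n IH]; intros H; simpl; [lra|].
  generalize (IH ltac:(auto)) (H n ltac:(lia)). lra.
Qed.

Lemma exp_ge_1 x : 0 <= x -> 1 <= exp x.
Proof. intros H. generalize (exp_ineq1_le x). lra. Qed.

Lemma exp_le x y : x <= y -> exp x <= exp y.
Proof. intros [H| ->]; [left; now apply exp_increasing|right; reflexivity]. Qed.

Lemma Cmod_Cminus_le (a b : C) : Cmod (a - b) <= Cmod a + Cmod b.
Proof. unfold Cminus. rewrite <- (Cmod_opp b). apply Cmod_triangle. Qed.

(** For [|z| >= 1/2] both denominators have modulus at least 1/4, so each quotient differs from 1 by
    at most [2 * a / (1/4) = 8 * a]. Written as an exponential, the bound on a product depends on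
    the sum of the parameters and not on their number. *)
Lemma factor_bound (a : R) (z : C) : 0 < a <= / 4 -> / 2 <= Cmod z ->
  Cmod ((z - Ci * RtoC a) / (z + Ci * RtoC a)) <= exp (8 * a) /\
  Cmod ((z + Ci * RtoC a) / (z - Ci * RtoC a)) <= exp (8 * a).
Proof.
  intros Ha Hz. set (p := (Ci * RtoC a)%C).
  assert (Hp : Cmod p = a).
  { unfold p. rewrite Cmod_mult, Cmod_Ci, Cmod_R, Rabs_right; lra. }
  assert (K : forall x y : C, / 4 <= Cmod y -> Cmod (x - y) <= 2 * a ->
    Cmod (x / y) <= exp (8 * a)).
  { intros x y Hy Hxy.
    assert (Y0 : y <> RtoC 0) by (apply Cmod_gt_0; lra).
    rewrite Cmod_div by auto. apply Rle_trans with (1 + 8 * a); [|apply exp_ineq1_le].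
    apply Rmult_le_reg_r with (Cmod y); [lra|]. unfold Rdiv.
    rewrite Rmult_assoc, Rinv_l, Rmult_1_r by lra.
    generalize (Cmod_le_minus x y). nra. }
  assert (P2 : Cmod (p + p) <= 2 * a).
  { eapply Rle_trans; [apply Cmod_triangle|]. lra. }
  split; apply K.
  - generalize (Cmod_Cminus_le (z + p)%C p).
    replace (z + p - p)%C with z by ring. lra.
  - replace (z - p - (z + p))%C with (- (p + p))%C by ring.
    now rewrite Cmod_opp.
  - generalize (Cmod_triangle (z - p)%C p).
    replace (z - p + p)%C with z by ring. lra.
  - now replace (z + p - (z - p))%C with (p + p)%C by ring.
Qed.

Lemma off_poles_large s N z : (forall j, (j < N)%nat -> 0 < s j <= / 4) -> / 2 <= Cmod z ->
  off_poles s N z.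
Proof.
  intros Hs Hz j Hj. specialize (Hs j Hj).
  split; intros ->; [|rewrite Cmod_opp in Hz]; rewrite Cmod_pole, Rabs_right in Hz; lra.
Qed.

Lemma bl_bound s N z : (forall j, (j < N)%nat -> 0 < s j <= / 4) -> / 2 <= Cmod z ->
  Cmod (bl s N z) <= exp (8 * rsum s N) /\ Cmod (/ bl s N z) <= exp (8 * rsum s N).
Proof.
  induction N as [|N IH]; intros Hs Hz.
  - unfold bl, cprod; simpl. rewrite Rmult_0_r, exp_0.
    replace (/ RtoC 1)%C with (RtoC 1) by field. rewrite Cmod_1. lra.
  - assert (Hoff := off_poles_large s (S N) z Hs Hz).
    assert (Hoff' : off_poles s N z) by (intros j Hj; apply Hoff; lia).
    destruct (IH ltac:(auto) Hz) as (I1 & I2).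
    destruct (factor_bound (s N) z (Hs N ltac:(lia)) Hz) as (F1 & F2).
    fold (pole s N) in F1, F2.
    destruct (Hoff N ltac:(lia)) as (Z1 & Z2).
    assert (A1 := Cminus_neq_0 _ _ Z1). assert (A2 := Cplus_neq_0 _ _ Z2).
    assert (B := bl_neq_0 s N z Hoff').
    simpl rsum. rewrite Rmult_plus_distr_l, exp_plus, bl_S.
    split.
    + rewrite Cmod_mult. apply Rmult_le_compat; auto; apply Cmod_ge_0.
    + replace (/ (bl s N z * ((z - pole s N) / (z + pole s N))))%C
        with (/ bl s N z * ((z + pole s N) / (z - pole s N)))%C
        by (field; auto).
      rewrite Cmod_mult. apply Rmult_le_compat; auto; apply Cmod_ge_0.
Qed.

(** With [x = i * a / z] the factor is [(1 - x) / (1 + x)], which agrees with exp(-2x) up to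
    quadratic terms. The remainder [2 * x^2 / (1 + x)] costs [16 * a ^ 2], that of the exponential
    [128 * a ^ 2]. *)
Lemma factor_exp (a : R) (z : C) : 0 < a <= / 8 -> / 2 <= Cmod z ->
  Cmod ((z - Ci * RtoC a) / (z + Ci * RtoC a) - cexp (RtoC (-2 * a) * (Ci / z))%C) <= 144 * a ^ 2.
Proof.
  intros Ha Hz. assert (Z0 : z <> RtoC 0) by (apply Cmod_gt_0; lra).
  set (x := (RtoC a * (Ci / z))%C).
  assert (Hx : Cmod x <= 2 * a).
  { unfold x. rewrite Cmod_mult, Cmod_R, Rabs_right, Cmod_div, Cmod_Ci by (auto; lra).
    assert (/ Cmod z <= 2).
    { replace 2 with (/ / 2) by field. apply Rinv_le_contravar; lra. }
    unfold Rdiv. nra. }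
  assert (Hx2 : Cmod x ^ 2 <= 4 * a ^ 2) by (generalize (Cmod_ge_0 x); nra).
  assert (D : / 2 <= Cmod (RtoC 1 + x)).
  { generalize (Cmod_Cminus_le (RtoC 1 + x)%C x).
    replace (RtoC 1 + x - x)%C with (RtoC 1) by ring. rewrite Cmod_1. lra. }
  assert (D0 : (RtoC 1 + x)%C <> RtoC 0) by (apply Cmod_gt_0; lra).
  replace ((z - Ci * RtoC a) / (z + Ci * RtoC a))%C
    with ((RtoC 1 - x) / (RtoC 1 + x))%C.
  2: { assert (E : (z + Ci * RtoC a)%C = (z * (RtoC 1 + x))%C)
         by (unfold x; field; auto).
       assert (E2 : (z - Ci * RtoC a)%C = (z * (RtoC 1 - x))%C)
         by (unfold x; field; auto).
       rewrite E, E2. field. auto. }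
  set (y := (RtoC (-2) * x)%C).
  replace (RtoC (-2 * a) * (Ci / z))%C with y by (unfold y, x; rewrite RtoC_mult; ring).
  assert (Hy : Cmod y = 2 * Cmod x).
  { unfold y. rewrite Cmod_mult, Cmod_R, Rabs_left; lra. }
  assert (E1 := cexp_second_order y ltac:(lra)).
  eapply Rle_trans; [apply (Cmod_minus_le _ (RtoC 1 + y)%C)|].
  rewrite (Cmod_minus_sym _ (cexp y)).
  replace ((RtoC 1 - x) / (RtoC 1 + x) - (RtoC 1 + y))%C
    with (RtoC 2 * (x * x) / (RtoC 1 + x))%C.
  - rewrite Cmod_div, !Cmod_mult, Cmod_R, Rabs_right by (auto; lra).
    assert (/ Cmod (RtoC 1 + x) <= 2).
    { replace 2 with (/ / 2) by field. apply Rinv_le_contravar; lra. }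
    assert (2 * (Cmod x * Cmod x) / Cmod (RtoC 1 + x) <= 4 * Cmod x ^ 2).
    { unfold Rdiv. generalize (pow2_ge_0 (Cmod x)). nra. }
    rewrite Hy in E1. nra.
  - unfold y. replace (RtoC (-2)) with (- RtoC 2)%C by (apply injective_projections; simpl; ring).
    replace (RtoC 2) with (RtoC 1 + RtoC 1)%C by (apply injective_projections; simpl; ring).
    field. auto.
Qed.

Lemma Cmod_cexp_le (w : C) m : Cmod w <= m -> Cmod (cexp w) <= exp m.
Proof.
  intros H. rewrite Cmod_cexp. apply exp_le.
  generalize (Rabs_fst_le w) (Rle_abs (fst w)). lra.
Qed.

Lemma Cmod_Ci_div z : / 2 <= Cmod z -> Cmod (Ci / z) <= 2.
Proof.
  intros Hz. rewrite Cmod_div, Cmod_Ci by (apply Cmod_gt_0; lra).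
  unfold Rdiv. rewrite Rmult_1_l. replace 2 with (/ / 2) by field. apply Rinv_le_contravar; lra.
Qed.

(** Telescoping by [U u - V v = U (u - v) + (U - V) v]: one factor is exchanged at a time, and the
    exponential bounds on both products keep the accumulated constant at [exp (8 * rsum s N)]. *)
Lemma bl_exp s N z : (forall j, (j < N)%nat -> 0 < s j <= / 8) -> / 2 <= Cmod z ->
  Cmod (bl s N z - cexp (RtoC (-2 * rsum s N) * (Ci / z))%C) <=
  exp (8 * rsum s N) * (144 * rsum (fun j => s j ^ 2) N).
Proof.
  induction N as [|N IH]; intros Hs Hz.
  - unfold bl, cprod; simpl rsum. simpl fold_right. rewrite !Rmult_0_r.
    replace (RtoC 0 * (Ci / z))%C with (RtoC 0) by ring. rewrite cexp_0.
    replace (RtoC 1 - RtoC 1)%C with (RtoC 0) by ring. rewrite Cmod_0. lra.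
  - assert (Hs' : forall j, (j < N)%nat -> 0 < s j <= / 8) by auto.
    specialize (IH Hs' Hz). assert (HN := Hs N ltac:(lia)).
    assert (F := factor_exp (s N) z HN Hz). fold (pole s N) in F.
    destruct (bl_bound s N z) as (B & _); auto.
    { intros j Hj. generalize (Hs' j Hj). lra. }
    change (rsum s (S N)) with (rsum s N + s N).
    change (rsum (fun j => s j ^ 2) (S N)) with (rsum (fun j => s j ^ 2) N + s N ^ 2).
    replace (RtoC (-2 * (rsum s N + s N)) * (Ci / z))%C with
      (RtoC (-2 * rsum s N) * (Ci / z) + RtoC (-2 * s N) * (Ci / z))%C
      by (rewrite Rmult_plus_distr_l, RtoC_plus; ring).
    rewrite cexp_plus, bl_S.
    set (u := ((z - pole s N) / (z + pole s N))%C) in *.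
    set (v := cexp (RtoC (-2 * s N) * (Ci / z))%C) in *.
    set (U := bl s N z) in *.
    set (V := cexp (RtoC (-2 * rsum s N) * (Ci / z))%C) in *.
    replace (U * u - V * v)%C with
      (U * (u - v) + (U - V) * v)%C by ring.
    eapply Rle_trans; [apply Cmod_triangle|]. rewrite !Cmod_mult.
    assert (Hv : Cmod v <= exp (8 * s N)).
    { apply Cmod_cexp_le. rewrite Cmod_mult, Cmod_R, Rabs_left by lra.
      generalize (Cmod_Ci_div z Hz) (Cmod_ge_0 (Ci / z)%C). nra. }
    rewrite Rmult_plus_distr_l, exp_plus.
    assert (H1 : 1 <= exp (8 * s N)) by (apply exp_ge_1; lra).
    assert (H2 : 0 < exp (8 * rsum s N)) by apply exp_pos.
    set (e1 := exp (8 * s N)) in *. set (e2 := exp (8 * rsum s N)) in *.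
    assert (Hq : 0 <= rsum (fun j => s j ^ 2) N) by (apply rsum_nonneg; intros; apply pow2_ge_0).
    apply Rle_trans with (e2 * (144 * s N ^ 2) + e2 * (144 * rsum (fun j => s j ^ 2) N) * e1).
    + apply Rplus_le_compat.
      * apply Rmult_le_compat; auto; apply Cmod_ge_0.
      * apply Rmult_le_compat; auto; apply Cmod_ge_0.
    + assert (0 <= s N ^ 2) by apply pow2_ge_0.
      assert (0 <= e2 * s N ^ 2) by (apply Rmult_le_pos; lra).
      assert (0 <= e2 * s N ^ 2 * (e1 - 1)) by (apply Rmult_le_pos; lra). lra.
Qed.

(** The two ways in which [bl] can deviate from its limit: the quadratic remainders of the factors,
    and the deviation of the sum from 2. *)
Definition defect (s : nat -> R) (N : nat) : R :=
  rsum (fun j => s j ^ 2) N + Rabs (rsum s N - 2).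

Lemma defect_nonneg s N : 0 <= defect s N.
Proof.
  unfold defect. generalize (Rabs_pos (rsum s N - 2)).
  assert (0 <= rsum (fun j => s j ^ 2) N) by (apply rsum_nonneg; intros; apply pow2_ge_0). lra.
Qed.

(** The bound 1/8 on the parameters is the one [factor_exp] requires; 1/8 on the sum gives
    [|y| <= 1/2] in [small_bl_blinf], the range of the second-order estimate of [cexp]. *)
Definition small (s : nat -> R) (N : nat) : Prop :=
  pos_distinct s N /\ (forall j, (j < N)%nat -> s j <= / 8) /\ Rabs (rsum s N - 2) <= / 8.

(* The limit of bl when the s_j shrink to 0 with sum 2. *)
Definition blinf (z : C) : C := cexp (RtoC (-4) * (Ci / z))%C.

(** Under [small] the sum is at most 17/8, so the product bound is at most exp 17, and
    [|4 i / z| <= 8] for [|z| >= 1/2]; one constant covers both. *)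
Definition Kbl : R := exp 24.

Lemma Kbl_ge_1 : 1 <= Kbl.
Proof. apply exp_ge_1. lra. Qed.

Lemma small_le s N : small s N -> forall j, (j < N)%nat -> 0 < s j <= / 4.
Proof. intros (H1 & H2 & _) j Hj. split; [now apply H1|]. generalize (H2 j Hj). lra. Qed.

Lemma small_bl_bound s N z : small s N -> / 2 <= Cmod z ->
  Cmod (bl s N z) <= Kbl /\ Cmod (/ bl s N z) <= Kbl.
Proof.
  intros Hs Hz. destruct (bl_bound s N z) as (B1 & B2); auto; [now apply small_le|].
  assert (HR : exp (8 * rsum s N) <= Kbl).
  { apply exp_le. destruct Hs as (_ & _ & H). apply Rabs_le_between in H. lra. }
  lra.
Qed.

Lemma blinf_bound z : / 2 <= Cmod z -> Cmod (blinf z) <= Kbl /\ Cmod (/ blinf z) <= Kbl.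
Proof.
  intros Hz. unfold blinf. rewrite <- cexp_opp.
  assert (Hm : Cmod (RtoC (-4) * (Ci / z)) <= 24).
  { rewrite Cmod_mult, Cmod_R, Rabs_left by lra. generalize (Cmod_Ci_div z Hz). lra. }
  split; apply Cmod_cexp_le; rewrite ?Cmod_opp; auto.
Qed.

Lemma small_bl_blinf s N z : small s N -> / 2 <= Cmod z ->
  Cmod (bl s N z - blinf z) <= 144 * Kbl * defect s N.
Proof.
  intros Hs Hz. destruct (Hs) as ((Hp & _) & H1 & H2).
  assert (E := bl_exp s N z ltac:(auto) Hz).
  assert (HR : exp (8 * rsum s N) <= exp 23).
  { apply exp_le. apply Rabs_le_between in H2. lra. }
  assert (HK : exp 23 <= Kbl) by (apply exp_le; lra).
  set (S := rsum s N) in *. set (q := rsum (fun j => s j ^ 2) N) in *.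
  assert (Hq : 0 <= q) by (apply rsum_nonneg; intros; apply pow2_ge_0).
  unfold defect. fold q S.
  eapply Rle_trans; [apply (Cmod_minus_le _ (cexp (RtoC (-2 * S) * (Ci / z))%C))|].
  set (y := (RtoC (-2 * (S - 2)) * (Ci / z))%C).
  replace (RtoC (-2 * S) * (Ci / z))%C with (RtoC (-4) * (Ci / z) + y)%C in *.
  2: { unfold y. replace (-2 * S) with (-4 + -2 * (S - 2)) by ring. rewrite RtoC_plus. ring. }
  rewrite cexp_plus in *. fold (blinf z) in *.
  replace (blinf z * cexp y - blinf z)%C with
    (blinf z * (cexp y - (RtoC 1 + y) + y))%C by ring.
  assert (Hy : Cmod y <= 4 * Rabs (S - 2)).
  { unfold y. rewrite Cmod_mult, Cmod_R, Rabs_mult, (Rabs_left (-2)) by lra.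
    generalize (Cmod_Ci_div z Hz) (Rabs_pos (S - 2)) (Cmod_ge_0 (Ci / z)%C). nra. }
  assert (E2 := cexp_second_order y ltac:(lra)).
  assert (E3 : Cmod (cexp y - (RtoC 1 + y) + y) <= 20 * Rabs (S - 2)).
  { eapply Rle_trans; [apply Cmod_triangle|]. generalize (Cmod_ge_0 y). nra. }
  destruct (blinf_bound z Hz) as (B & _).
  rewrite Cmod_mult.
  assert (E4 : Cmod (blinf z) * Cmod (cexp y - (RtoC 1 + y) + y) <=
     Kbl * (20 * Rabs (S - 2))).
  { apply Rmult_le_compat; auto; apply Cmod_ge_0. }
  assert (E5 : exp (8 * S) * (144 * q) <= Kbl * (144 * q)) by (apply Rmult_le_compat_r; lra).
  generalize (Rabs_pos (S - 2)) Kbl_ge_1. intros.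
  assert (0 <= Kbl * Rabs (S - 2)) by (apply Rmult_le_pos; lra). lra.
Qed.

Lemma small_bl_inv_blinf s N z : small s N -> / 2 <= Cmod z ->
  Cmod (/ bl s N z - / blinf z) <= 144 * Kbl ^ 3 * defect s N.
Proof.
  intros Hs Hz. assert (H := small_bl_blinf s N z Hs Hz).
  destruct (small_bl_bound s N z Hs Hz) as (_ & B1). destruct (blinf_bound z Hz) as (_ & B2).
  assert (A1 : bl s N z <> RtoC 0).
  { apply bl_neq_0, off_poles_large; auto. now apply small_le. }
  assert (A2 : blinf z <> RtoC 0) by apply cexp_neq_0.
  replace (/ bl s N z - / blinf z)%C with
    (- (bl s N z - blinf z) * (/ bl s N z * / blinf z))%C
    by (field; auto).
  rewrite Cmod_mult, Cmod_opp, Cmod_mult.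
  replace (144 * Kbl ^ 3 * defect s N) with (144 * Kbl * defect s N * (Kbl * Kbl)) by ring.
  apply Rmult_le_compat; try apply Cmod_ge_0; auto.
  - apply Rmult_le_pos; apply Cmod_ge_0.
  - apply Rmult_le_compat; auto; apply Cmod_ge_0.
Qed.

(* om plays the role of exp(2iQ). *)
Record phase (om : C -> C) (Om : R) : Prop := {
  ph_diff : forall z, cdiff om z;
  ph_nz : forall z, om z <> RtoC 0;
  ph_sch : forall z, sch om z = (/ om z)%C;
  ph_bd : forall z, Cmod z <= 2 -> Cmod (om z) <= Om /\ Cmod (/ om z) <= Om }.

Lemma phase_ge_1 om Om : phase om Om -> 1 <= Om.
Proof.
  intros Hom. destruct (ph_bd _ _ Hom (RtoC 0)) as (O1 & O2); [rewrite Cmod_0; lra|].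
  rewrite Cmod_inv in O2 by apply Hom.
  assert (Hp : 0 < Cmod (om (RtoC 0))) by (apply Cmod_gt_0, Hom).
  destruct (Rle_lt_dec 1 (Cmod (om (RtoC 0)))); [lra|].
  assert (/ 1 < / Cmod (om (RtoC 0))) by (apply Rinv_lt_contravar; lra). lra.
Qed.

(** Its residue at [pole s j] is [om (pole s j) * rho s N j], the negative of the residue constant
    in [sol], and it tends to 0 at the lower poles. *)
Definition phi (om : C -> C) (s : nat -> R) (N : nat) (z : C) : C := (om z / bl s N z)%C.

Record sol (om : C -> C) (s : nat -> R) (N : nat) (f g : C -> C) (L : C) : Prop := {
  sol_data : soldata s N (fun j => (- (om (pole s j) * rho s N j))%C) f g;
  sol_coef : tends nbinf (fun z => (z * f z)%C) L;
  sol_bd : forall z, / 2 <= Cmod z -> Cmod (f z) <= Kbl /\ Cmod (g z) <= Kbl }.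

Lemma sol_exists om s N : small s N -> exists f g L, sol om s N f g L.
Proof.
  intros Hs. destruct (soldata_exists s N (fun j => om (pole s j)) (proj1 Hs))
    as (f & g & L & H1 & H2 & H3 & H4).
  exists f, g, L. constructor; auto. intros z Hz.
  assert (Hoff : off_poles s N z) by (apply off_poles_large; auto; now apply small_le).
  generalize Kbl_ge_1. intros HK.
  destruct (Rle_lt_dec 0 (snd z)) as [Hi|Hi].
  - destruct (H3 z Hi). lra.
  - destruct (H4 z Hoff ltac:(lra)) as (B1 & B2).
    destruct (small_bl_bound s N (Cconj z) Hs ltac:(now rewrite Cmod_conj)) as (_ & B3).
    rewrite Cmod_inv in B3 by (apply bl_neq_0; now apply off_poles_conj). lra.
Qed.

(** * Removing the poles inside the circle *)

Section Interior.
Context (om : C -> C) (Om : R) (Hom : phase om Om).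
Context (s : nat -> R) (N : nat) (f g : C -> C) (L : C).
Context (Hs : pos_distinct s N) (HS : sol om s N f g L).

Lemma bl_pole j : (j < N)%nat -> bl s N (pole s j) = RtoC 0.
Proof.
  intros Hj. unfold bl.
  rewrite (cprod_remove (fun i => ((pole s j - pole s i) / (pole s j + pole s i))%C) N j Hj).
  replace (pole s j - pole s j)%C with (RtoC 0) by ring. unfold Cdiv. ring.
Qed.

Lemma inv_bl_low j : (j < N)%nat ->
  tends (punct (- pole s j)%C) (fun z => (/ bl s N z)%C) (RtoC 0).
Proof.
  intros Hj. apply (tends_ext_loc (F := punct (- pole s j)%C) (sch (bl s N))).
  - generalize (off_poles_pnb s N (- pole s j)%C). apply filter_imp. intros z Hz.
    unfold sch. now apply bl_conj.
  - rewrite <- (RtoC_conj 0). apply tends_punct_conj. rewrite Cconj_opp_pole.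
    rewrite <- (bl_pole j Hj). apply tends_nb_pnb, cdiff_cont, cdiff_bl.
    intros k Hk. apply pole_neq_opp; now apply Hs.
Qed.

(** At an upper pole the residue of [u] is opposite to that of [phi * v]; at a lower pole [v] may
    have a simple pole, but [phi] vanishes in the limit. In both cases the singularity is
    removable. *)
Lemma interior_extension (u v : C -> C) :
  (forall z, off_poles s N z -> cdiff u z /\ cdiff v z) ->
  (forall j, (j < N)%nat -> exists l,
     tends (punct (pole s j)) (fun z => ((z - pole s j) * u z)%C)
       (om (pole s j) * rho s N j * - l)%C /\
     tends (punct (pole s j)) v l) ->
  (forall j, (j < N)%nat -> exists l l',
     tends (punct (- pole s j)%C) u l' /\
     tends (punct (- pole s j)%C) (fun z => ((z - - pole s j) * v z)%C) l) ->
  exists h, (forall z, cdiff h z) /\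
    forall z, off_poles s N z -> h z = (u z + phi om s N z * v z)%C.
Proof.
  intros Hd Hu Hl. apply (meromorphic_extension s N Hs).
  - intros z Hz. destruct (Hd z Hz). apply cdiff_plus; auto. apply cdiff_mult; auto.
    apply cdiff_div; [now apply bl_neq_0|apply Hom|now apply cdiff_bl, off_poles_low].
  - intros j Hj. destruct (Hu j Hj) as (l & L1 & L2).
    assert (C0 : tends (punct (pole s j)) om (om (pole s j)))
      by apply tends_nb_pnb, cdiff_cont, Hom.
    apply (tends_ext (F := punct (pole s j)) (fun z => ((z - pole s j) * u z + om z * ((z - pole s j)
        / bl s N z) * v z)%C)).
    + intros z. unfold phi, Cdiv. ring.
    + eapply tends_eq; [apply tends_plus; [exact L1|apply tends_mult; [|exact L2]];
        apply tends_mult; [exact C0|apply rho_limit; auto]|]. ring.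
  - intros j Hj. destruct (Hl j Hj) as (l & l' & L1 & L2).
    assert (C0 : tends (punct (- pole s j)%C) om (om (- pole s j)%C))
      by apply tends_nb_pnb, cdiff_cont, Hom.
    apply (tends_ext (F := punct (- pole s j)%C) (fun z => ((z - - pole s j) * u z + om z * / bl s N
        z * ((z - - pole s j) * v z))%C)).
    + intros z. unfold phi, Cdiv. ring.
    + eapply tends_eq; [apply tends_plus; [exact (tends_shift_0 _ _ _ L1)|apply tends_mult; [|exact
        L2]];
        apply tends_mult; [exact C0|now apply inv_bl_low]|]. ring.
Qed.

(** (l, k) is the first column of the solution times the matrix with rows (1, -1/phi) and (phi, 1).
    The second column of that product consists of [- sch k] and [sch l], so reflection supplies
    it. *)
Lemma interior_lk : exists l k, (forall z, cdiff l z) /\ (forall z, cdiff k z) /\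
  forall z, off_poles s N z ->
    l z = (sch g z + phi om s N z * f z)%C /\
    k z = (phi om s N z * g z - sch f z)%C.
Proof.
  destruct HS as [HD _ _].
  assert (Hds : forall h, (forall z, off_low s N z -> cdiff h z) -> forall z, off_poles s N z ->
    cdiff (sch h) z).
  { intros h Hh z Hz. now apply cdiff_sch, Hh, off_low_conj. }
  destruct (interior_extension (sch g) f) as (l & L1 & L2).
  - intros z Hz. split; [now apply Hds; [apply (sd_g _ _ _ _ _ HD)|]|
      now apply (sd_f _ _ _ _ _ HD), off_poles_low].
  - intros j Hj. exists (f (pole s j)). split.
    + eapply tends_eq; [apply (sd_resg _ _ _ _ _ HD j Hj)|]. ring.
    + now apply (f_at_pole s N _ f g Hs HD).
  - intros j Hj. do 2 eexists. split.
    + now apply (schg_at_low s N _ f g Hs HD).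
    + now apply (f_res_low s N _ f g HD).
  - destruct (interior_extension (fun z => (- sch f z)%C) g) as (k & K1 & K2).
    + intros z Hz. split; [now apply cdiff_opp, Hds; [apply (sd_f _ _ _ _ _ HD)|]|
        now apply (sd_g _ _ _ _ _ HD), off_poles_low].
    + intros j Hj. exists (g (pole s j)). split.
      * apply (tends_ext (F := punct (pole s j)) (fun z => (- ((z - pole s j) * sch f z))%C)).
        -- intros z. ring.
        -- eapply tends_eq; [apply tends_opp, (sd_resf _ _ _ _ _ HD j Hj)|]. ring.
      * now apply (g_at_pole s N _ f g Hs HD).
    + intros j Hj. do 2 eexists. split.
      * apply tends_opp. now apply (schf_at_low s N _ f g Hs HD).
      * now apply (g_res_low s N _ f g HD).
    + exists l, k. split; [exact L1|split; [exact K1|]]. intros z Hz. rewrite L2, K2 by auto.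
      split; ring.
Qed.

Lemma phi_sch z : off_poles s N z -> sch (phi om s N) z = (/ phi om s N z)%C.
Proof.
  intros Hz. unfold sch, phi. rewrite Cdiv_conj by now apply bl_neq_0, off_poles_conj.
  rewrite bl_conj by auto. change (Cconj (om (Cconj z))) with (sch om z).
  rewrite (ph_sch _ _ Hom). assert (A1 := ph_nz _ _ Hom z). assert (A2 := bl_neq_0 s N z Hz).
  field. auto.
Qed.

Lemma phi_neq_0 z : off_poles s N z -> phi om s N z <> RtoC 0.
Proof.
  intros Hz. apply Cmult_neq_0; [apply Hom|]. apply Cmod_gt_0.
  rewrite Cmod_inv by now apply bl_neq_0. now apply Rinv_0_lt_compat, Cmod_gt_0, bl_neq_0.
Qed.

End Interior.

Lemma Cmod_ker_le w : 3 / 4 <= Cmod w -> forall z, Cmod z = / 2 -> Cmod (ker w z) <= 3 / 2 / Cmod w.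
Proof.
  intros Hw z Hz. assert (Hn : (z - w)%C <> RtoC 0) by (apply Cminus_neq_0; intros ->; lra).
  unfold ker. rewrite Cmod_div, Hz by auto.
  assert (H1 : Cmod w / 3 <= Cmod (z - w)).
  { generalize (Cmod_le_minus w z). rewrite Cmod_minus_sym. lra. }
  replace (3 / 2 / Cmod w) with (/ 2 * / (Cmod w / 3)) by (field; lra).
  apply Rmult_le_compat_l; [lra|]. apply Rinv_le_contravar; lra.
Qed.

(** Cauchy's formula outside expresses [l - eo w] by the mean of [eo * ker w]. The interior function
    has mean 0 against the same kernel, since the kernel vanishes at 0, and may be subtracted. The
    bound is [4 * PI * J * (3/2) / |w|] divided by [2 * PI]. *)
Lemma exterior_estimate eo ei l J w : 0 <= J -> 3 / 4 <= Cmod w -> tends nbinf eo l ->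
  (forall z, / 2 <= Cmod z -> cdiff eo z) -> (forall z, cdiff ei z) ->
  (forall z, Cmod z = / 2 -> Cmod (eo z - ei z) <= J) ->
  Cmod (eo w - l) <= 3 * J / Cmod w.
Proof.
  intros HJ Hw Hl Ho Hi Hj.
  assert (HP := PI_RGT_0).
  assert (E1 := Cauchy_exterior eo (/ 2) w l ltac:(lra) Hl Ho).
  assert (Hk : forall z, Cmod z <= / 2 -> cdiff (ker w) z).
  { intros z Hz. apply cdiff_ker. intros ->. lra. }
  assert (E2 : Cm (fun z => (ei z * ker w z)%C) (/ 2) = RtoC 0).
  { rewrite (Cm_center _ nil); try lra.
    - unfold ker, Cdiv. ring.
    - intros z Hz. apply ccont_mult; apply cdiff_cont; auto.
    - intros z Hz _ _. apply cdiff_mult; auto. }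
  assert (C1 : circ_cont (fun z => (eo z * ker w z)%C) (/ 2)).
  { intros z Hz. apply ccont_mult; apply cdiff_cont; [apply Ho|apply Hk]; lra. }
  assert (C2 : circ_cont (fun z => (ei z * ker w z)%C) (/ 2)).
  { intros z Hz. apply ccont_mult; apply cdiff_cont; [apply Hi|apply Hk]; lra. }
  assert (B : Cmod ((l - eo w) * RtoC (2 * PI)) <= 4 * PI * (J * (3 / 2 / Cmod w))).
  { rewrite <- E1. replace (Cm (fun z => (eo z * ker w z)%C) (/ 2)) with
      (Cm (fun z => (eo z * ker w z - ei z * ker w z)%C) (/ 2)).
    - apply Cm_bound; [lra| |].
      + intros z Hz. apply ccont_minus; [now apply C1|now apply C2].
      + intros z Hz. replace (eo z * ker w z - ei z * ker w z)%C
          with ((eo z - ei z) * ker w z)%C by ring.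
        rewrite Cmod_mult. apply Rmult_le_compat; try apply Cmod_ge_0; auto.
        now apply Cmod_ker_le.
    - rewrite Cm_minus, E2 by (auto; lra). ring. }
  rewrite Cmod_mult, Cmod_R, Rabs_right, Cmod_minus_sym in B by lra.
  replace (4 * PI * (J * (3 / 2 / Cmod w))) with (3 * J / Cmod w * (2 * PI)) in B by (field; lra).
  apply Rmult_le_reg_r with (2 * PI); lra.
Qed.

Lemma Cmod_mult_le a b A B : Cmod a <= A -> Cmod b <= B -> Cmod (a * b) <= A * B.
Proof.
  intros Ha Hb. rewrite Cmod_mult. apply Rmult_le_compat; auto; apply Cmod_ge_0.
Qed.

Lemma Cmod_plus_le a b A B : Cmod a <= A -> Cmod b <= B -> Cmod (a + b) <= A + B.
Proof. intros Ha Hb. eapply Rle_trans; [apply Cmod_triangle|]. lra. Qed.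

Lemma phi_bounds om Om s N z : phase om Om -> small s N -> / 2 <= Cmod z <= 2 ->
  Cmod (phi om s N z) <= Om * Kbl /\ Cmod (/ phi om s N z) <= Om * Kbl.
Proof.
  intros Hom Hs Hz. destruct (ph_bd _ _ Hom z ltac:(lra)) as (O1 & O2).
  destruct (small_bl_bound s N z Hs ltac:(lra)) as (B1 & B2).
  assert (A1 := ph_nz _ _ Hom z).
  assert (A2 : bl s N z <> RtoC 0).
  { apply bl_neq_0, off_poles_large; [now apply small_le|lra]. }
  split; [now apply Cmod_mult_le|].
  replace (/ phi om s N z)%C with (/ om z * bl s N z)%C.
  - now apply Cmod_mult_le.
  - unfold phi. field. auto.
Qed.

Section Comparison.
Context (om : C -> C) (Om : R) (Hom : phase om Om).
Context (s s' : nat -> R) (N N' : nat) (f g f' g' : C -> C) (L L' : C).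
Context (Hs : small s N) (HS : sol om s N f g L) (Hs' : small s' N') (HS' : sol om s' N' f' g' L').

Lemma phi_close z : / 2 <= Cmod z <= 2 ->
  Cmod (phi om s N z - phi om s' N' z) <= Om * (144 * Kbl ^ 3 * (defect s N + defect s' N')) /\
  Cmod (/ phi om s N z - / phi om s' N' z) <=
    Om * (144 * Kbl ^ 3 * (defect s N + defect s' N')).
Proof.
  intros Hz. destruct (ph_bd _ _ Hom z ltac:(lra)) as (O1 & O2).
  assert (A1 := ph_nz _ _ Hom z).
  assert (A2 : bl s N z <> RtoC 0).
  { apply bl_neq_0, off_poles_large; [now apply small_le|lra]. }
  assert (A3 : bl s' N' z <> RtoC 0).
  { apply bl_neq_0, off_poles_large; [now apply small_le|lra]. }
  assert (I1 := small_bl_inv_blinf s N z Hs ltac:(lra)).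
  assert (I2 := small_bl_inv_blinf s' N' z Hs' ltac:(lra)).
  assert (J1 := small_bl_blinf s N z Hs ltac:(lra)).
  assert (J2 := small_bl_blinf s' N' z Hs' ltac:(lra)).
  assert (HK := Kbl_ge_1).
  assert (HK3 : Kbl <= Kbl ^ 3) by nra.
  assert (D1 := defect_nonneg s N). assert (D2 := defect_nonneg s' N').
  split.
  - replace (phi om s N z - phi om s' N' z)%C with
      (om z * (/ bl s N z - / bl s' N' z))%C by (unfold phi, Cdiv; ring).
    apply Cmod_mult_le; auto. eapply Rle_trans; [apply (Cmod_minus_le _ (/ blinf z)%C)|].
    rewrite (Cmod_minus_sym (/ blinf z)%C). lra.
  - replace (/ phi om s N z - / phi om s' N' z)%C with
      (/ om z * (bl s N z - bl s' N' z))%C by (unfold phi; field; auto).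
    apply Cmod_mult_le; auto. eapply Rle_trans; [apply (Cmod_minus_le _ (blinf z))|].
    rewrite (Cmod_minus_sym (blinf z)).
    assert (144 * Kbl * (defect s N + defect s' N') <= 144 * Kbl ^ 3 * (defect s N + defect s' N'))
      by (apply Rmult_le_compat_r; lra). lra.
Qed.

(** In the proof below [J = 288 * Om ^ 2 * Kbl ^ 6 * eta]; two terms [3 * J / |w| * Kbl] give
    [6 * 288 = 1728] and one more power of [Kbl]. *)
Definition Kcmp : R := 1728 * Om ^ 2 * Kbl ^ 7.

(** [(e1, e2)] is the first row of M times the inverse of M' outside the circle, [(i1, i2)] the same
    quotient of the interior matrices. If both problems had the same [phi], the common right factor
    would cancel and the two rows would agree on the circle; the jump is therefore controlled by
    differences of the two functions [phi]. *)
Lemma comparison w : 3 / 4 <= Cmod w ->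
  Cmod (f w - f' w) <= Kcmp * (defect s N + defect s' N') / Cmod w /\
  Cmod (g w - g' w) <= Kcmp * (defect s N + defect s' N') / Cmod w.
Proof.
  set (eta := defect s N + defect s' N').
  set (K := Om * Kbl). set (d := Om * (144 * Kbl ^ 3 * eta)).
  assert (HK1 := Kbl_ge_1).
  destruct (interior_lk om Om Hom s N f g L (proj1 Hs) HS) as (l & k & Dl & Dk & Elk).
  destruct (interior_lk om Om Hom s' N' f' g' L' (proj1 Hs') HS') as (l' & k' & Dl' & Dk' & Elk').
  assert (Off : forall z, / 2 <= Cmod z -> off_poles s N z)
    by (intros z Hz; apply off_poles_large; auto; now apply small_le).
  assert (Off' : forall z, / 2 <= Cmod z -> off_poles s' N' z)
    by (intros z Hz; apply off_poles_large; auto; now apply small_le).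
  destruct HS as [HD _ HB], HS' as [HD' _ HB'].
  assert (Hb : forall z, / 2 <= Cmod z -> Cmod (sch f z) <= Kbl /\ Cmod (sch g z) <= Kbl /\
     Cmod (sch f' z) <= Kbl /\ Cmod (sch g' z) <= Kbl).
  { intros z Hz. unfold sch. rewrite !Cmod_conj.
    destruct (HB (Cconj z)), (HB' (Cconj z)); rewrite ?Cmod_conj; auto. }
  assert (Hd : forall z, / 2 <= Cmod z -> (cdiff f z /\ cdiff g z) /\ (cdiff f' z /\ cdiff g' z) /\
     (cdiff (sch f) z /\ cdiff (sch g) z) /\ (cdiff (sch f') z /\ cdiff (sch g') z)).
  { intros z Hz. assert (O1 := Off z Hz). assert (O2 := Off' z Hz).
    assert (O3 := off_low_conj s N z O1). assert (O4 := off_low_conj s' N' z O2).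
    apply off_poles_low in O1, O2.
    repeat split; try (now apply HD); try (now apply HD'); apply cdiff_sch; now (apply HD || apply
        HD'). }
  set (e1 := fun z => (sch g z * g' z + f z * sch f' z)%C).
  set (e2 := fun z => (f z * sch g' z - sch g z * f' z)%C).
  (* The interior matrices have determinant 2, so inverting one of them produces the factor 1/2. *)
  set (i1 := fun z => (RtoC (/ 2) * (l z * sch l' z + sch k z * k' z))%C).
  set (i2 := fun z => (RtoC (/ 2) * (l z * sch k' z - sch k z * l' z))%C).
  assert (Hsl : forall h, (forall z, cdiff h z) -> forall z, cdiff (sch h) z)
    by (intros h Hh z; apply cdiff_sch, Hh).
  assert (T1 : tends nbinf e1 (RtoC 1)).
  { apply tends_eq with (Cconj (RtoC 1) * RtoC 1 + RtoC 0 * Cconj (RtoC 0))%C.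
    - apply tends_plus; apply tends_mult; try apply HD'; try apply HD; apply sch_infty;
        [apply HD|apply HD'].
    - rewrite !RtoC_conj. ring. }
  assert (T2 : tends nbinf e2 (RtoC 0)).
  { apply tends_eq with (RtoC 0 * Cconj (RtoC 1) - Cconj (RtoC 1) * RtoC 0)%C.
    - apply tends_minus; apply tends_mult; try apply HD'; try apply HD; apply sch_infty;
        [apply HD'|apply HD].
    - rewrite !RtoC_conj. ring. }
  assert (HOm := phase_ge_1 om Om Hom).
  assert (Heta : 0 <= eta).
  { generalize (defect_nonneg s N) (defect_nonneg s' N'). unfold eta. lra. }
  assert (Hdp : 0 <= d).
  { unfold d. apply Rmult_le_pos; [lra|]. apply Rmult_le_pos; auto.
    apply Rmult_le_pos; [lra|]. apply pow_le; lra. }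
  assert (HKb : Kbl <= K) by (unfold K; nra).
  set (J := 2 * (Kbl * Kbl * (K * d))).
  assert (HK0 : 1 <= K) by lra.
  assert (HJ : forall z, Cmod z = / 2 ->
     Cmod (e1 z - i1 z) <= J /\ Cmod (e2 z - i2 z) <= J).
  { intros z Hz. assert (Hz' : / 2 <= Cmod z) by lra.
    assert (O1 := Off z Hz'). assert (O2 := Off' z Hz').
    destruct (Elk z O1) as (L1 & L2).
    destruct (Elk' z O2) as (L3 & L4).
    destruct (Elk (Cconj z) (off_poles_conj _ _ _ O1)) as (L5 & L6).
    destruct (Elk' (Cconj z) (off_poles_conj _ _ _ O2)) as (L7 & L8).
    assert (P1 := phi_sch om Om Hom s N z O1). assert (P2 := phi_sch om Om Hom s' N' z O2).
    assert (Q1 := phi_neq_0 om Om Hom s N z O1). assert (Q2 := phi_neq_0 om Om Hom s' N' z O2).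
    assert (S5 : sch k z = (/ phi om s N z * sch g z - f z)%C).
    { unfold sch. rewrite L6, Cminus_conj, Cmult_conj. unfold sch. rewrite !Cconj_conj.
      fold (sch (phi om s N) z). now rewrite P1. }
    assert (S6 : sch k' z = (/ phi om s' N' z * sch g' z - f' z)%C).
    { unfold sch. rewrite L8, Cminus_conj, Cmult_conj. unfold sch. rewrite !Cconj_conj.
      fold (sch (phi om s' N') z). now rewrite P2. }
    assert (S7 : sch l' z = (g' z + / phi om s' N' z * sch f' z)%C).
    { unfold sch. rewrite L7, Cplus_conj, Cmult_conj. unfold sch. rewrite !Cconj_conj.
      fold (sch (phi om s' N') z). now rewrite P2. }
    destruct (phi_bounds om Om s N z Hom Hs ltac:(lra)) as (B1 & B2).
    destruct (phi_bounds om Om s' N' z Hom Hs' ltac:(lra)) as (B3 & B4).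
    destruct (phi_close z ltac:(lra)) as (B5 & B6).
    fold K in B1, B2, B3, B4. fold eta d in B5, B6.
    destruct (HB z Hz') as (C1 & C2). destruct (HB' z Hz') as (C3 & C4).
    destruct (Hb z Hz') as (C5 & C6 & C7 & C8).
    unfold e1, e2, i1, i2. rewrite L1, L3, L4, S5, S6, S7.
    set (F := f z) in *. set (G := g z) in *. set (F' := f' z) in *. set (G' := g' z) in *.
    set (Fs := sch f z) in *. set (Gs := sch g z) in *. set (Fs' := sch f' z) in *.
    set (Gs' := sch g' z) in *. set (p := phi om s N z) in *. set (p' := phi om s' N' z) in *.
    clearbody F G F' G' Fs Gs Fs' Gs' p p'.
    assert (Hd1 : Cmod ((p - p') * / p) <= K * d).
    { rewrite Rmult_comm. now apply Cmod_mult_le. }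
    assert (Hd2 : Cmod ((p' - p) * / p') <= K * d).
    { rewrite Rmult_comm. apply Cmod_mult_le; auto. now rewrite Cmod_minus_sym. }
    assert (Hd3 : Cmod (/ p - / p') <= K * d) by nra.
    assert (Hd4 : Cmod (p' - p) <= K * d) by (rewrite Cmod_minus_sym; nra).
    assert (Hd5 : Cmod (p - p') <= K * d) by nra.
    assert (Hd6 : Cmod (/ p' - / p) <= K * d) by (rewrite Cmod_minus_sym; nra).
    (* On the circle each jump is half a sum of four products: two solution entries times a
       difference of the two [phi] or of their inverses, possibly divided by one of them. *)
    assert (Hh : forall a b c e : C, Cmod a <= Kbl * Kbl * (K * d) -> Cmod b <= Kbl * Kbl * (K * d) ->
       Cmod c <= Kbl * Kbl * (K * d) -> Cmod e <= Kbl * Kbl * (K * d) ->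
       Cmod (RtoC (/ 2) * (a + b + (c + e))) <= J).
    { intros a b c e Ha Hb' Hc He. rewrite Cmod_mult, Cmod_R, Rabs_right by lra.
      assert (T := Cmod_plus_le _ _ _ _ (Cmod_plus_le _ _ _ _ Ha Hb') (Cmod_plus_le _ _ _ _ Hc He)).
      unfold J. lra. }
    assert (H2 : RtoC (/ 2) = (/ RtoC 2)%C) by (rewrite RtoC_inv; auto; lra).
    assert (H20 : RtoC 2 <> RtoC 0) by (intros E; apply RtoC_inj in E; lra).
    assert (E22 : RtoC 2 = (RtoC 1 + RtoC 1)%C) by (apply injective_projections; simpl; ring).
    split.
    - match goal with |- Cmod ?X <= _ => replace X with (RtoC (/ 2) * (Gs * G' * ((p - p') * / p) + F
        * Fs' * ((p' - p) * / p') + (Gs * Fs' * (/ p - / p') + F * G' * (p' - p))))%C end.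
      + apply Hh; (apply Cmod_mult_le; [apply Cmod_mult_le|]); auto.
      + rewrite H2. field. auto.
    - match goal with |- Cmod ?X <= _ => replace X with (RtoC (/ 2) * (F * Gs' * ((p' - p) * / p') +
        Gs * F' * - ((p - p') * / p) + (Gs * Gs' * (/ p - / p') + F * F' * (p - p'))))%C end.
      + apply Hh; (apply Cmod_mult_le; [apply Cmod_mult_le|]); rewrite ?Cmod_opp; auto.
      + rewrite H2. field. auto. }
  assert (HJ0 : 0 <= J).
  { unfold J. apply Rmult_le_pos; [lra|]. apply Rmult_le_pos; [nra|]. apply Rmult_le_pos; lra. }
  assert (X1 : forall w, 3 / 4 <= Cmod w -> Cmod (e1 w - RtoC 1) <= 3 * J / Cmod w).
  { intros z Hz. apply (exterior_estimate e1 i1); auto.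
    - intros y Hy. destruct (Hd y Hy) as ((D1 & D2) & (D3 & D4) & (D5 & D6) & (D7 & D8)).
      apply cdiff_plus; apply cdiff_mult; auto.
    - intros y. apply cdiff_mult; [apply cdiff_const|]. apply cdiff_plus; apply cdiff_mult; auto.
    - intros y Hy. now apply HJ. }
  assert (X2 : forall w, 3 / 4 <= Cmod w -> Cmod (e2 w) <= 3 * J / Cmod w).
  { intros z Hz. replace (e2 z) with (e2 z - RtoC 0)%C by ring.
    apply (exterior_estimate e2 i2); auto.
    - intros y Hy. destruct (Hd y Hy) as ((D1 & D2) & (D3 & D4) & (D5 & D6) & (D7 & D8)).
      apply cdiff_minus; apply cdiff_mult; auto.
    - intros y. apply cdiff_mult; [apply cdiff_const|]. apply cdiff_minus; apply cdiff_mult; auto.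
    - intros y Hy. now apply HJ. }
  assert (EK : forall z, 3 / 4 <= Cmod z ->
     Kcmp * eta / Cmod z = 3 * J / Cmod z * Kbl + 3 * J / Cmod z * Kbl).
  { intros z Hz. unfold Kcmp, J, d, K. field. generalize (Cmod_ge_0 z); lra. }
  intros Hw. assert (Hw2 : / 2 <= Cmod w) by lra.
  split.
  - assert (E : (f w - f' w)%C = ((e1 w - RtoC 1) * f' w + e2 w * g' w)%C).
    { assert (F1 : f w = (e1 w * f' w + e2 w * g' w)%C).
      { unfold e1, e2. rewrite <- (Cmult_1_r (f w)) at 1.
        rewrite <- (sd_det _ _ _ _ _ HD' w (Off' w Hw2)). ring. }
      rewrite F1 at 1. ring. }
    rewrite E, EK by auto. destruct (HB' w Hw2). apply Cmod_plus_le; apply Cmod_mult_le; auto.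
  (* The first row contains [sch g] rather than [g], so the estimate is carried out at the conjugate
     point. *)
  - set (v := Cconj w). assert (Hv : 3 / 4 <= Cmod v) by (unfold v; now rewrite Cmod_conj).
    assert (Hv2 : / 2 <= Cmod v) by lra.
    assert (E0 : Cmod (g w - g' w) = Cmod (sch g v - sch g' v)).
    { unfold sch, v. rewrite !Cconj_conj, <- Cminus_conj, Cmod_conj. reflexivity. }
    assert (E : (sch g v - sch g' v)%C = ((e1 v - RtoC 1) * sch g' v + - e2 v * sch f' v)%C).
    { assert (F1 : sch g v = (e1 v * sch g' v - e2 v * sch f' v)%C).
      { unfold e1, e2. rewrite <- (Cmult_1_r (sch g v)) at 1.
        rewrite <- (sd_det _ _ _ _ _ HD' v (Off' v Hv2)). ring. }
      rewrite F1 at 1. ring. }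
    replace (Cmod w) with (Cmod v) by (unfold v; apply Cmod_conj).
    rewrite E0, E, EK by auto. destruct (Hb v Hv2) as (C5 & C6 & C7 & C8).
    apply Cmod_plus_le; apply Cmod_mult_le; rewrite ?Cmod_opp; auto.
Qed.

End Comparison.

(** * The limiting problem on the unit circle *)

Definition vanishing (b : nat -> R) : Prop :=
  forall eps, 0 < eps -> exists n0, forall n, (n0 <= n)%nat -> b n <= eps.

(** The two-index bound passes to the limit in [m], where [b m] disappears, so the rate [b] is
    inherited without loss. *)
Lemma complete_C (u : nat -> C) (b : nat -> R) : vanishing b ->
  (forall n m, Cmod (u n - u m) <= b n + b m) ->
  exists l, forall n, Cmod (u n - l) <= b n.
Proof.
  intros Hb Hu.
  assert (K : forall p : C -> R, (forall z, Rabs (p z) <= Cmod z) ->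
     (forall x y, p (x - y)%C = p x - p y) -> {l | Un_cv (fun n => p (u n)) l}).
  { intros p P1 P2. apply Rcomplete.R_complete. intros eps He.
    destruct (Hb (eps / 3) ltac:(lra)) as (n0 & Hn0). exists n0. intros n m Hn Hm.
    unfold Rdist. rewrite <- P2. eapply Rle_lt_trans; [apply P1|].
    eapply Rle_lt_trans; [apply Hu|]. generalize (Hn0 n Hn) (Hn0 m Hm). lra. }
  destruct (K fst Rabs_fst_le (fun _ _ => eq_refl)) as (l1 & H1).
  destruct (K snd Rabs_snd_le (fun _ _ => eq_refl)) as (l2 & H2).
  exists (l1, l2). intros n. apply le_epsilon. intros eps He.
  destruct (H1 (eps / 4) ltac:(lra)) as (n1 & N1).
  destruct (H2 (eps / 4) ltac:(lra)) as (n2 & N2).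
  destruct (Hb (eps / 4) ltac:(lra)) as (n3 & N3).
  set (m := max n1 (max n2 n3)).
  specialize (N1 m ltac:(lia)). specialize (N2 m ltac:(lia)). specialize (N3 m ltac:(lia)).
  generalize (Cmod_minus_le (u n) (u m) (l1, l2)) (Hu n m) (Cmod_le_sum (u m - (l1, l2)%R)%C).
  unfold Rdist in N1, N2. simpl. unfold Rminus in *. lra.
Qed.

Lemma uniform_limit (D : C -> Prop) (u : nat -> C -> C) (b : nat -> R) : vanishing b ->
  (forall n m z, D z -> Cmod (u n z - u m z) <= b n + b m) ->
  exists U, forall n z, D z -> Cmod (u n z - U z) <= b n.
Proof.
  intros Hb Hu.
  exists (fun z => epsilon (inhabits (RtoC 0)) (fun l => forall n, Cmod (u n z - l) <= b n)).
  intros n z Hz. revert n. apply epsilon_spec. apply complete_C; auto.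
Qed.

Lemma tends_seq (u : nat -> C) l b : vanishing b -> (forall n, Cmod (u n - l) <= b n) ->
  tends eventually u l.
Proof.
  intros Hb Hu eps He. destruct (Hb (eps / 2) ltac:(lra)) as (n0 & H). exists n0. intros n Hn.
  generalize (Hu n) (H n Hn). lra.
Qed.

Lemma vanishing_scal c b : 0 <= c -> vanishing b -> vanishing (fun n => c * b n).
Proof.
  intros Hc Hb eps He. destruct (Hb (eps / (c + 1)) ltac:(apply Rdiv_lt_0_compat; lra)) as (n0 & H).
  exists n0. intros n Hn. specialize (H n Hn). apply Rle_trans with (c * (eps / (c + 1))).
  - now apply Rmult_le_compat_l.
  - assert (0 < eps / (c + 1)) by (apply Rdiv_lt_0_compat; lra).
    replace eps with ((c + 1) * (eps / (c + 1))) at 2 by (field; lra). lra.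
Qed.

(* The sum over j < m is exactly 2, the limit of the rescaled eigenvalue sums. *)
Definition model (m : nat) (j : nat) : R := 4 * (INR j + 1) / (INR m * (INR m + 1)).

Lemma rsum_le f g n : (forall j, (j < n)%nat -> f j <= g j) -> rsum f n <= rsum g n.
Proof.
  induction n as [|n IH]; intros H; simpl; [lra|].
  generalize (IH ltac:(auto)) (H n ltac:(lia)). lra.
Qed.

Lemma rsum_scal c f n : rsum (fun j => c * f j) n = c * rsum f n.
Proof. induction n as [|n IH]; simpl; [ring|]. rewrite IH. ring. Qed.

Lemma model_sum m n : (0 < m)%nat ->
  rsum (model m) n = 2 * INR n * (INR n + 1) / (INR m * (INR m + 1)).
Proof.
  intros Hm. assert (0 < INR m) by (apply lt_0_INR; lia).
  induction n as [|n IH]; cbn [rsum].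
  - simpl. unfold Rdiv. ring.
  - rewrite IH, S_INR. unfold model. field. lra.
Qed.

(** All parameters are at most [4 / m], hence at most 1/8 from [m = 32] on; as they sum to 2, their
    squares sum to at most [8 / m]. *)
Lemma model_small m : (32 <= m)%nat -> small (model m) m /\ defect (model m) m <= 8 / INR m.
Proof.
  intros Hm.
  assert (H32 : 32 <= INR m) by (change 32 with (IZR (Z.of_nat 32)); rewrite <- INR_IZR_INZ; now
      apply le_INR).
  assert (Hd : 0 < INR m * (INR m + 1)) by nra.
  assert (Hsum : rsum (model m) m = 2) by (rewrite model_sum by lia; field; lra).
  assert (Hle : forall j, (j < m)%nat -> 0 < model m j <= 4 / INR m).
  { intros j Hj. assert (0 <= INR j) by apply pos_INR.
    assert (INR j + 1 <= INR m) by (rewrite <- S_INR; apply le_INR; lia).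
    split; [apply Rdiv_lt_0_compat; lra|].
    apply Rle_trans with (4 * INR m / (INR m * (INR m + 1))).
    - apply Rmult_le_compat_r; [left; now apply Rinv_0_lt_compat|]. lra.
    - replace (4 * INR m / (INR m * (INR m + 1))) with (4 / (INR m + 1)) by (field; lra).
      apply Rmult_le_compat_l; [lra|]. apply Rinv_le_contravar; lra. }
  assert (H8 : 4 / INR m <= / 8).
  { apply Rmult_le_reg_r with (INR m); [lra|]. unfold Rdiv. rewrite Rmult_assoc, Rinv_l by lra. lra. }
  split; [split; [|split]|].
  - split.
    + intros j Hj. now apply Hle.
    + intros j k Hj Hk Hn E. unfold model in E. apply Hn, INR_eq.
      apply Rmult_eq_reg_r in E; [lra|]. apply Rinv_neq_0_compat. lra.
  - intros j Hj. generalize (Hle j Hj). lra.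
  - rewrite Hsum. replace (2 - 2) with 0 by ring. rewrite Rabs_R0. lra.
  - unfold defect. rewrite Hsum. replace (2 - 2) with 0 by ring. rewrite Rabs_R0.
    apply Rle_trans with (rsum (fun j => 4 / INR m * model m j) m + 0).
    + apply Rplus_le_compat_r, rsum_le. intros j Hj. destruct (Hle j Hj). nra.
    + rewrite rsum_scal, Hsum. right. field. lra.
Qed.

Definition phiinf (om : C -> C) (z : C) : C := (om z / blinf z)%C.

(** Exterior data live on [|z| > 3/4], interior data on [|z| < 5/4]. The overlap surrounds the unit
    circle, so boundary values there are ordinary values of continuous functions. [ld_cmp] is the
    form in which the theorem receives the rate of convergence. *)
Record limdata (om : C -> C) (Om : R) (f g l k : C -> C) (L : C) : Prop := {
  ld_f : forall z, 3 / 4 < Cmod z -> cdiff f z;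
  ld_g : forall z, 3 / 4 < Cmod z -> cdiff g z;
  ld_finf : tends nbinf f (RtoC 0);
  ld_ginf : tends nbinf g (RtoC 1);
  ld_coef : tends nbinf (fun z => (z * f z)%C) L;
  ld_det : forall z, 3 / 4 < Cmod z ->
    (f z * sch f z + g z * sch g z)%C = RtoC 1;
  ld_l : forall z, Cmod z < 5 / 4 -> cdiff l z;
  ld_k : forall z, Cmod z < 5 / 4 -> cdiff k z;
  ld_lk : forall z, 3 / 4 < Cmod z < 5 / 4 ->
    l z = (sch g z + phiinf om z * f z)%C /\
    k z = (phiinf om z * g z - sch f z)%C;
  ld_cmp : forall s N f' g' L', small s N -> sol om s N f' g' L' ->
    Cmod (L' - L) <= Kcmp Om * defect s N }.

Lemma coef_close f f' L L' e : tends nbinf (fun z => (z * f z)%C) L ->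
  tends nbinf (fun z => (z * f' z)%C) L' ->
  (forall w, 3 / 4 <= Cmod w -> Cmod (f w - f' w) <= e / Cmod w) ->
  Cmod (L - L') <= e.
Proof.
  intros H H' He.
  apply (tends_Cmod_le (F := nbinf) (fun z => (z * f z - z * f' z)%C)).
  - apply nbinf_proper.
  - now apply tends_minus.
  - exists 1. intros z Hz.
    replace (z * f z - z * f' z)%C with (z * (f z - f' z))%C by ring.
    rewrite Cmod_mult. replace e with (Cmod z * (e / Cmod z)) by (field; lra).
    apply Rmult_le_compat_l; [lra|]. apply He. lra.
Qed.

Lemma nb_Cmod_lt z r : Cmod z < r -> nb z (fun w => Cmod w < r).
Proof.
  intros H. exists (r - Cmod z). split; [lra|]. intros w Hw. generalize (Cmod_le_minus w z). lra.
Qed.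
Lemma nb_Cmod_gt z r : r < Cmod z -> nb z (fun w => r < Cmod w).
Proof.
  intros H. exists (Cmod z - r). split; [lra|]. intros w Hw.
  generalize (Cmod_le_minus z w). rewrite Cmod_minus_sym. lra.
Qed.

Lemma cdiff_uniform_limit (D : C -> Prop) u U b p : vanishing b -> nb p D ->
  (forall n z, D z -> cdiff (u n) z) ->
  (forall n z, D z -> Cmod (u n z - U z) <= b n) -> cdiff U p.
Proof.
  intros Hb (r & Hr & HD) Hu HU. apply Weierstrass with r; auto.
  intros eps He. destruct (Hb eps He) as (n & Hn). exists (u n). split; intros z Hz; [auto|].
  eapply Rle_trans; [apply HU; auto|]. apply Hn. lia.
Qed.

(** On [|z| = 3/2] the kernel of a point of modulus at most 5/4 is at most [(3/2) / (1/4) = 6]; the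
    constants [4 * PI] and [2 * PI] then give 12. It carries an estimate known on a circle beyond
    the poles to the whole disc. *)
Lemma disc_estimate h M w : Cmod w <= 5 / 4 -> (forall z, cdiff h z) ->
  (forall z, Cmod z = 3 / 2 -> Cmod (h z) <= M) -> Cmod (h w) <= 12 * M.
Proof.
  intros Hw Hh HM. assert (HP := PI_RGT_0).
  assert (E := Cauchy_formula h (3 / 2) w ltac:(lra) (fun z _ => Hh z)).
  assert (B : Cmod (h w * RtoC (2 * PI)) <= 4 * PI * (M * 6)).
  { rewrite <- E. apply Cm_bound; [lra| |].
    - intros z Hz. apply ccont_mult; apply cdiff_cont; auto. apply cdiff_ker. intros ->. lra.
    - intros z Hz. apply Cmod_mult_le; auto. unfold ker.
      rewrite Cmod_div by (apply Cminus_neq_0; intros ->; lra). rewrite Hz.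
      replace 6 with (3 / 2 * / (/ 4)) by field. apply Rmult_le_compat_l; [lra|].
      apply Rinv_le_contravar; [lra|]. generalize (Cmod_le_minus z w). lra. }
  rewrite Cmod_mult, Cmod_R, Rabs_right in B by lra.
  apply Rmult_le_reg_r with (2 * PI); lra.
Qed.

Lemma limdata_exists om Om : phase om Om -> exists f g l k L, limdata om Om f g l k L.
Proof.
  intros Hom.
  (* The shift by 32 makes every member of the sequence satisfy [small]. *)
  set (M := fun n : nat => (n + 32)%nat).
  assert (Hsm : forall n, small (model (M n)) (M n) /\ defect (model (M n)) (M n) <= 8 / INR (M n))
    by (intros n; apply model_small; unfold M; lia).
  set (eta := fun n => defect (model (M n)) (M n)).
  assert (Heta : vanishing eta).
  { intros eps He. destruct (archimed_cor1 (eps / 8)) as (n0 & H1 & H2); [lra|].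
    exists n0. intros n Hn. apply Rle_trans with (8 / INR (M n)); [apply Hsm|].
    assert (0 < INR n0) by now apply lt_0_INR.
    assert (INR n0 <= INR (M n)) by (apply le_INR; unfold M; lia).
    assert (/ INR (M n) <= / INR n0) by (apply Rinv_le_contravar; lra). unfold Rdiv. lra. }
  assert (HOm := phase_ge_1 om Om Hom).
  assert (HK1 := Kbl_ge_1).
  assert (HKc : 0 <= Kcmp Om).
  { unfold Kcmp. apply Rmult_le_pos; [|apply pow_le; lra].
    apply Rmult_le_pos; [lra|apply pow_le; lra]. }
  assert (Hch : exists q : nat -> (C -> C) * (C -> C) * C,
    forall n, sol om (model (M n)) (M n) (fst (fst (q n))) (snd (fst (q n))) (snd (q n))).
  { apply (choice (fun n q => sol om (model (M n)) (M n) (fst (fst q)) (snd (fst q)) (snd q))).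
    intros n. destruct (sol_exists om _ _ (proj1 (Hsm n))) as (f & g & L & H).
    exists (f, g, L). exact H. }
  destruct Hch as (q & Hq).
  set (fn := fun n => fst (fst (q n))). set (gn := fun n => snd (fst (q n))).
  set (Ln := fun n => snd (q n)).
  assert (HS : forall n, sol om (model (M n)) (M n) (fn n) (gn n) (Ln n)) by exact Hq.
  clearbody fn gn Ln. clear q Hq.
  assert (Hint : exists q : nat -> (C -> C) * (C -> C), forall n,
    (forall z, cdiff (fst (q n)) z) /\ (forall z, cdiff (snd (q n)) z) /\
    forall z, / 2 <= Cmod z ->
      fst (q n) z = (sch (gn n) z + phi om (model (M n)) (M n) z * fn n z)%C /\
      snd (q n) z = (phi om (model (M n)) (M n) z * gn n z - sch (fn n) z)%C).
  { apply (choice (fun n q => (forall z, cdiff (fst q) z) /\ (forall z, cdiff (snd q) z) /\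
      forall z, / 2 <= Cmod z ->
      fst q z = (sch (gn n) z + phi om (model (M n)) (M n) z * fn n z)%C /\
      snd q z = (phi om (model (M n)) (M n) z * gn n z - sch (fn n) z)%C)).
    intros n. destruct (interior_lk om Om Hom _ _ _ _ _ (proj1 (proj1 (Hsm n))) (HS n))
      as (l & k & D1 & D2 & E). exists (l, k). repeat split; auto; apply E;
      (apply off_poles_large; auto; apply small_le, Hsm). }
  destruct Hint as (q & Hq).
  set (ln := fun n => fst (q n)). set (kn := fun n => snd (q n)).
  assert (Hln : forall n z, cdiff (ln n) z) by (intros n; apply Hq).
  assert (Hkn : forall n z, cdiff (kn n) z) by (intros n; apply Hq).
  assert (Elk : forall n z, / 2 <= Cmod z ->
      ln n z = (sch (gn n) z + phi om (model (M n)) (M n) z * fn n z)%C /\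
      kn n z = (phi om (model (M n)) (M n) z * gn n z - sch (fn n) z)%C)
    by (intros n; apply Hq).
  clearbody ln kn. clear q Hq.
  assert (Hcmp : forall n m w, 3 / 4 <= Cmod w ->
    Cmod (fn n w - fn m w) <= Kcmp Om * (eta n + eta m) / Cmod w /\
    Cmod (gn n w - gn m w) <= Kcmp Om * (eta n + eta m) / Cmod w).
  { intros n m w Hw. apply (comparison om Om Hom (model (M n)) (model (M m)) (M n) (M m)
      _ _ _ _ (Ln n) (Ln m)); auto; apply Hsm. }
  set (b := fun n => Kcmp Om * eta n).
  assert (Hb : vanishing b) by now apply vanishing_scal.
  assert (Hb0 : forall n, 0 <= b n) by (intros n; apply Rmult_le_pos; auto; apply defect_nonneg).
  set (D1 := fun z => 3 / 4 <= Cmod z).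
  (* The limit is taken of [w * h n w], so that the decay [/ Cmod w] of the bound is kept; [Hcoef]
     needs it to control the coefficient at infinity. *)
  assert (Hscale : forall (h : nat -> C -> C),
    (forall n m w, 3 / 4 <= Cmod w -> Cmod (h n w - h m w) <= Kcmp Om * (eta n + eta m) / Cmod w) ->
    exists U, forall n w, D1 w -> Cmod (h n w - U w) <= b n / Cmod w).
  { intros h Hh. destruct (uniform_limit D1 (fun n w => (w * h n w)%C) b Hb) as (U & HU).
    - intros n m w Hw. replace (w * h n w - w * h m w)%C
        with (w * (h n w - h m w))%C by ring.
      rewrite Cmod_mult. unfold D1 in Hw.
      replace (b n + b m) with (Cmod w * (Kcmp Om * (eta n + eta m) / Cmod w)) by (unfold b; field;
          lra).
      apply Rmult_le_compat_l; [lra|]. now apply Hh.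
    - exists (fun w => (U w / w)%C). intros n w Hw. specialize (HU n w Hw). unfold D1 in Hw.
      assert (W0 : w <> RtoC 0) by (apply Cmod_gt_0; lra).
      replace (h n w - U w / w)%C with ((w * h n w - U w) / w)%C
        by (field; auto).
      rewrite Cmod_div by auto. apply Rmult_le_compat_r; auto.
      left. apply Rinv_0_lt_compat. lra. }
  destruct (Hscale fn) as (f & Hf); [intros; now apply Hcmp|].
  destruct (Hscale gn) as (g & Hg); [intros; now apply Hcmp|].
  destruct (complete_C Ln b Hb) as (L & HL).
  { intros n m. unfold b. rewrite <- Rmult_plus_distr_l.
    apply (coef_close (fn n) (fn m)); [apply HS|apply HS|]. intros w Hw. now apply Hcmp. }
  assert (Hf2 : forall n w, D1 w -> Cmod (fn n w - f w) <= 2 * b n).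
  { intros n w Hw. eapply Rle_trans; [now apply Hf|]. unfold D1 in Hw. rewrite Rmult_comm.
    apply Rmult_le_compat_l; auto. replace 2 with (/ / 2) by field. apply Rinv_le_contravar; lra. }
  assert (Hg2 : forall n w, D1 w -> Cmod (gn n w - g w) <= 2 * b n).
  { intros n w Hw. eapply Rle_trans; [now apply Hg|]. unfold D1 in Hw. rewrite Rmult_comm.
    apply Rmult_le_compat_l; auto. replace 2 with (/ / 2) by field. apply Rinv_le_contravar; lra. }
  assert (Hb2 : vanishing (fun n => 2 * b n)) by (apply vanishing_scal; auto; lra).
  assert (Hfl : forall w, D1 w -> tends eventually (fun n => fn n w) (f w)).
  { intros w Hw. apply (tends_seq _ _ _ Hb2). intros n. now apply Hf2. }
  assert (Hgl : forall w, D1 w -> tends eventually (fun n => gn n w) (g w)).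
  { intros w Hw. apply (tends_seq _ _ _ Hb2). intros n. now apply Hg2. }
  assert (Hfs : forall w, D1 w -> tends eventually (fun n => sch (fn n) w) (sch f w)).
  { intros w Hw. apply tends_conj, Hfl. unfold D1. now rewrite Cmod_conj. }
  assert (Hgs : forall w, D1 w -> tends eventually (fun n => sch (gn n) w) (sch g w)).
  { intros w Hw. apply tends_conj, Hgl. unfold D1. now rewrite Cmod_conj. }
  assert (Hpl : forall w, / 2 <= Cmod w ->
    tends eventually (fun n => phi om (model (M n)) (M n) w) (phiinf om w)).
  { intros w Hw. apply tends_mult; [apply tends_const|].
    apply (tends_seq _ _ (fun n => 144 * Kbl ^ 3 * eta n)).
    - apply vanishing_scal; auto. apply Rmult_le_pos; [lra|apply pow_le; lra].
    - intros n. apply small_bl_inv_blinf; auto. apply Hsm. }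
  assert (Hoff : forall n z, / 2 <= Cmod z -> off_poles (model (M n)) (M n) z).
  { intros n z Hz. apply off_poles_large; auto. apply small_le, Hsm. }
  (* The formulas for [ln] and [kn] hold only away from the poles; their differences are estimated
     on [|z| = 3/2] and then carried inward by [disc_estimate]. *)
  assert (HKd : forall n m z, Cmod z = 3 / 2 ->
    Cmod (ln n z - ln m z) <= (2 + 3 * (Om * Kbl)) * (b n + b m) +
       Kbl * (Om * (144 * Kbl ^ 3)) * (eta n + eta m) /\
    Cmod (kn n z - kn m z) <= (2 + 3 * (Om * Kbl)) * (b n + b m) +
       Kbl * (Om * (144 * Kbl ^ 3)) * (eta n + eta m)).
  { intros n m z Hz.
    assert (Hc0 : forall w, Cmod w = 3 / 2 -> Cmod (fn n w - fn m w) <= b n + b m /\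
       Cmod (gn n w - gn m w) <= b n + b m).
    { intros w Hw. destruct (Hcmp n m w ltac:(lra)) as (C1 & C2). rewrite Hw in C1, C2.
      replace (Kcmp Om * (eta n + eta m) / (3 / 2)) with (2 / 3 * (b n + b m)) in C1, C2
        by (unfold b; field).
      generalize (Hb0 n) (Hb0 m). lra. }
    destruct (Hc0 z Hz) as (C1 & C2).
    destruct (Hc0 (Cconj z) ltac:(now rewrite Cmod_conj)) as (C3 & C4).
    assert (C5 : Cmod (sch (fn n) z - sch (fn m) z) <= b n + b m).
    { unfold sch. now rewrite <- Cminus_conj, Cmod_conj. }
    assert (C6 : Cmod (sch (gn n) z - sch (gn m) z) <= b n + b m).
    { unfold sch. now rewrite <- Cminus_conj, Cmod_conj. }
    destruct (Elk n z ltac:(lra)) as (-> & ->). destruct (Elk m z ltac:(lra)) as (-> & ->).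
    destruct (phi_bounds om Om (model (M n)) (M n) z Hom ltac:(apply Hsm) ltac:(lra)) as (B1 & _).
    destruct (phi_close om Om Hom (model (M n)) (model (M m)) (M n) (M m)
      ltac:(apply Hsm) ltac:(apply Hsm) z ltac:(lra)) as (B2 & _).
    destruct (sol_bd _ _ _ _ _ _ (HS m) z ltac:(lra)) as (B3 & B4).
    set (p := phi om (model (M n)) (M n) z) in *. set (p' := phi om (model (M m)) (M m) z) in *.
    fold (eta n) (eta m) in B2.
    assert (0 <= Om * Kbl) by (apply Rmult_le_pos; lra).
    assert (Hbb : 0 <= b n + b m) by (generalize (Hb0 n) (Hb0 m); lra).
    assert (0 <= Om * Kbl * (b n + b m)) by now apply Rmult_le_pos.
    split.
    - replace (sch (gn n) z + p * fn n z - (sch (gn m) z + p' * fn m z))%C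
        with (sch (gn n) z - sch (gn m) z + (p * (fn n z - fn m z) + (p - p') * fn m z))%C by ring.
      eapply Rle_trans; [apply (Cmod_plus_le _ _ _ _ C6 (Cmod_plus_le _ _ _ _
         (Cmod_mult_le _ _ _ _ B1 C1) (Cmod_mult_le _ _ _ _ B2 B3)))|]. lra.
    - replace (p * gn n z - sch (fn n) z - (p' * gn m z - sch (fn m) z))%C
        with (- (sch (fn n) z - sch (fn m) z) + (p * (gn n z - gn m z) + (p - p') * gn m z))%C by ring.
      rewrite <- (Cmod_opp (sch (fn n) z - sch (fn m) z)%C) in C5.
      eapply Rle_trans; [apply (Cmod_plus_le _ _ _ _ C5 (Cmod_plus_le _ _ _ _
         (Cmod_mult_le _ _ _ _ B1 C2) (Cmod_mult_le _ _ _ _ B2 B4)))|]. lra. }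
  set (Ki := 12 * ((2 + 3 * (Om * Kbl)) * Kcmp Om + Kbl * (Om * (144 * Kbl ^ 3)))).
  set (bi := fun n => Ki * eta n).
  assert (HKi : 0 <= Ki).
  { unfold Ki. apply Rmult_le_pos; [lra|]. apply Rplus_le_le_0_compat.
    - apply Rmult_le_pos; auto. assert (0 <= Om * Kbl) by (apply Rmult_le_pos; lra). lra.
    - apply Rmult_le_pos; [lra|]. apply Rmult_le_pos; [lra|]. apply Rmult_le_pos; [lra|apply pow_le;
        lra]. }
  assert (Hbi : vanishing bi) by now apply vanishing_scal.
  set (D2 := fun z => Cmod z <= 5 / 4).
  destruct (uniform_limit D2 ln bi Hbi) as (l & Hl).
  { intros n m z Hz.
    eapply Rle_trans; [apply (disc_estimate (fun z => (ln n z - ln m z)%C)); auto|].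
    - intros w. now apply cdiff_minus.
    - intros w Hw. now apply HKd.
    - right. unfold bi, Ki, b. ring. }
  destruct (uniform_limit D2 kn bi Hbi) as (k & Hk).
  { intros n m z Hz.
    eapply Rle_trans; [apply (disc_estimate (fun z => (kn n z - kn m z)%C)); auto|].
    - intros w. now apply cdiff_minus.
    - intros w Hw. now apply HKd.
    - right. unfold bi, Ki, b. ring. }
  exists f, g, l, k, L.
  assert (Hcoef : tends nbinf (fun z => (z * f z)%C) L).
  { intros eps He. destruct (Hb (eps / 4) ltac:(lra)) as (n & Hn).
    specialize (Hn n (Nat.le_refl n)).
    assert (Hnear : nbinf (fun z => 1 < Cmod z)) by (exists 1; auto).
    generalize (filter_conj _ _ Hnear (sol_coef _ _ _ _ _ _ (HS n) (eps / 4) ltac:(lra))).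
    apply filter_imp. intros z (Z1 & Z2).
    assert (Z3 : Cmod (z * f z - z * fn n z) <= b n).
    { replace (z * f z - z * fn n z)%C with (z * (f z - fn n z))%C by ring.
      rewrite Cmod_mult, Cmod_minus_sym. replace (b n) with (Cmod z * (b n / Cmod z)) by (field; lra).
      apply Rmult_le_compat_l; [lra|]. apply Hf. unfold D1. lra. }
    generalize (Cmod_minus_le (z * f z)%C (z * fn n z)%C L)
      (Cmod_minus_le (z * fn n z)%C (Ln n) L) (HL n). lra. }
  constructor.
  - intros z Hz. apply (cdiff_uniform_limit (fun z => 3 / 4 < Cmod z) fn f (fun n => 2 * b n)); auto.
    + now apply nb_Cmod_gt.
    + intros n w Hw. apply (sd_f _ _ _ _ _ (sol_data _ _ _ _ _ _ (HS n))).
      apply off_poles_low, Hoff. lra.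
    + intros n w Hw. apply Hf2. unfold D1. lra.
  - intros z Hz. apply (cdiff_uniform_limit (fun z => 3 / 4 < Cmod z) gn g (fun n => 2 * b n)); auto.
    + now apply nb_Cmod_gt.
    + intros n w Hw. apply (sd_g _ _ _ _ _ (sol_data _ _ _ _ _ _ (HS n))).
      apply off_poles_low, Hoff. lra.
    + intros n w Hw. apply Hg2. unfold D1. lra.
  - apply tends_ext_loc with (fun z => (/ z * (z * f z))%C).
    + generalize (nbinf_neq (RtoC 0)). apply filter_imp. intros z Hz. field. auto.
    + apply tends_eq with (RtoC 0 * L)%C; [|ring]. apply tends_mult; auto. apply tends_inv_inf.
  - intros eps He. destruct (Hb2 (eps / 4) ltac:(lra)) as (n & Hn).
    specialize (Hn n (Nat.le_refl n)).
    assert (Hnear : nbinf (fun z => 1 < Cmod z)) by (exists 1; auto).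
    generalize (filter_conj _ _ Hnear
      (sd_ginf _ _ _ _ _ (sol_data _ _ _ _ _ _ (HS n)) (eps / 4) ltac:(lra))).
    apply filter_imp. intros z (Z1 & Z2).
    generalize (Hg2 n z ltac:(unfold D1; lra)) (Cmod_minus_le (g z) (gn n z) (RtoC 1)).
    rewrite (Cmod_minus_sym (g z) (gn n z)). lra.
  - exact Hcoef.
  - intros z Hz. assert (Hz' : D1 z) by (unfold D1; lra).
    apply (tends_unique eventually (fun n => (fn n z * sch (fn n) z + gn n z * sch (gn n) z)%C)).
    + apply tends_plus; apply tends_mult; auto.
    + apply tends_ext with (fun _ => RtoC 1); [|apply tends_const]. intros n. symmetry.
      apply (sd_det _ _ _ _ _ (sol_data _ _ _ _ _ _ (HS n))), Hoff. lra.
  - intros z Hz. apply (cdiff_uniform_limit (fun z => Cmod z < 5 / 4) ln l bi); auto.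
    + now apply nb_Cmod_lt.
    + intros n w Hw. apply Hl. unfold D2. lra.
  - intros z Hz. apply (cdiff_uniform_limit (fun z => Cmod z < 5 / 4) kn k bi); auto.
    + now apply nb_Cmod_lt.
    + intros n w Hw. apply Hk. unfold D2. lra.
  - intros z Hz. assert (Hz1 : D1 z) by (unfold D1; lra). assert (Hz2 : D2 z) by (unfold D2; lra).
    split.
    + apply (tends_unique eventually (fun n => ln n z)).
      * apply (tends_seq _ _ _ Hbi). intros n. now apply Hl.
      * apply tends_ext with (fun n => (sch (gn n) z + phi om (model (M n)) (M n) z * fn n z)%C).
        -- intros n. symmetry. apply Elk. lra.
        -- apply tends_plus; auto. apply tends_mult; auto. apply Hpl. lra.
    + apply (tends_unique eventually (fun n => kn n z)).
      * apply (tends_seq _ _ _ Hbi). intros n. now apply Hk.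
      * apply tends_ext with (fun n => (phi om (model (M n)) (M n) z * gn n z - sch (fn n) z)%C).
        -- intros n. symmetry. apply Elk. lra.
        -- apply tends_minus; auto. apply tends_mult; auto. apply Hpl. lra.
  (* The given problem is compared with the [n]-th model, whose own defect can be made arbitrarily
     small; only the defect of [s] remains. *)
  - intros s N f' g' L' Hs' HS'. apply le_epsilon. intros eps He.
    destruct (Hb (eps / 2) ltac:(lra)) as (n & Hn). specialize (Hn n (Nat.le_refl n)).
    assert (Hc : Cmod (L' - Ln n) <= Kcmp Om * (defect s N + eta n)).
    { apply (coef_close f' (fn n)); [apply HS'|apply HS|]. intros w Hw.
      apply (comparison om Om Hom s (model (M n)) N (M n) f' g' (fn n) (gn n) L' (Ln n)); auto.
      apply Hsm. }
    generalize (Cmod_minus_le L' (Ln n) L) (HL n). unfold b in *. lra.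
Qed.

(** The one-sided limits are assumed pointwise on the circle. Their continuity along the circle is
    obtained by replacing a nearby circle point by an interior point on the same radius, where the
    limit at [z] already gives control. *)
Lemma circle_extension (h : C -> C) : (forall z, Cmod z <> 1 -> ccont h z) ->
  (forall z0, Cmod z0 = 1 -> exists l, clim_in (fun z => Cmod z < 1) h z0 l /\
     clim_in (fun z => 1 < Cmod z) h z0 l) ->
  exists H, (forall z, ccont H z) /\ (forall z, Cmod z <> 1 -> H z = h z).
Proof.
  intros Hc Hl.
  set (lim := fun z0 => epsilon (inhabits (RtoC 0)) (fun l => clim_in (fun z => Cmod z < 1) h z0 l /\
     clim_in (fun z => 1 < Cmod z) h z0 l)).
  assert (Hlim : forall z0, Cmod z0 = 1 -> clim_in (fun z => Cmod z < 1) h z0 (lim z0) /\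
     clim_in (fun z => 1 < Cmod z) h z0 (lim z0)).
  { intros z0 Hz0. apply (epsilon_spec (inhabits (RtoC 0)) _ (Hl z0 Hz0)). }
  set (H := fun z => if Req_EM_T (Cmod z) 1 then lim z else h z).
  assert (H1 : forall z, Cmod z = 1 -> H z = lim z).
  { intros z Hz. unfold H. destruct (Req_EM_T (Cmod z) 1); [auto|contradiction]. }
  assert (H2 : forall z, Cmod z <> 1 -> H z = h z).
  { intros z Hz. unfold H. destruct (Req_EM_T (Cmod z) 1); [contradiction|auto]. }
  exists H. split; auto. intros z.
  destruct (Req_dec (Cmod z) 1) as [Hz|Hz].
  - intros eps He. destruct (Hlim z Hz) as (Li & Lo).
    destruct (Li (eps / 2) ltac:(lra)) as (d1 & Hd1 & Li').
    destruct (Lo (eps / 2) ltac:(lra)) as (d2 & Hd2 & Lo').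
    exists (Rmin d1 d2 / 2). split; [apply Rdiv_lt_0_compat; [now apply Rmin_glb_lt|lra]|].
    assert (M1 := Rmin_l d1 d2). assert (M2 := Rmin_r d1 d2).
    intros w Hw. rewrite (H1 z Hz).
    destruct (Rtotal_order (Cmod w) 1) as [Hw1|[Hw1|Hw1]].
    + rewrite H2 by lra. assert (w <> z) by (intros ->; lra).
      assert (B := Li' w Hw1 H0 ltac:(generalize (Cmod_ge_0 (w - z)%C); lra)). lra.
    + rewrite H1 by auto. destruct (Hlim w Hw1) as (Lw & _).
      destruct (Lw (eps / 4) ltac:(lra)) as (d3 & Hd3 & Lw').
      (* Small enough that the interior point [v] lies within [d1] of [z] and within [d3] of [w]. *)
      set (t := Rmin (Rmin (d1 / 2) (d3 / 2)) (/ 2)).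
      assert (T1 : t <= d1 / 2) by (eapply Rle_trans; [apply Rmin_l|apply Rmin_l]).
      assert (T2 : t <= d3 / 2) by (eapply Rle_trans; [apply Rmin_l|apply Rmin_r]).
      assert (T3 : t <= / 2) by apply Rmin_r.
      assert (T0 : 0 < t) by (unfold t; repeat apply Rmin_glb_lt; lra).
      set (v := (RtoC (1 - t) * w)%C).
      assert (Hv : Cmod v = 1 - t).
      { unfold v. rewrite Cmod_mult, Cmod_R, Hw1, Rabs_right; lra. }
      assert (Hvw : Cmod (v - w) = t).
      { replace (v - w)%C with (- (RtoC t * w))%C.
        - rewrite Cmod_opp, Cmod_mult, Cmod_R, Hw1, Rabs_right; lra.
        - unfold v. rewrite RtoC_minus. ring. }
      assert (N1 : v <> w) by (intros E; rewrite E in Hv; lra).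
      assert (N2 : v <> z) by (intros E; rewrite E in Hv; lra).
      assert (B1 := Lw' v ltac:(lra) N1 ltac:(lra)).
      assert (B2 := Li' v ltac:(lra) N2 ltac:(generalize (Cmod_minus_le v w z); lra)).
      generalize (Cmod_minus_le (lim w) (h v) (lim z)). rewrite (Cmod_minus_sym (lim w) (h v)). lra.
    + rewrite H2 by lra. assert (w <> z) by (intros ->; lra).
      assert (B := Lo' w Hw1 H0 ltac:(generalize (Cmod_ge_0 (w - z)%C); lra)). lra.
  - apply ccont_ext_loc with h; [|now apply Hc].
    destruct (Rtotal_order (Cmod z) 1) as [Hz1|[Hz1|Hz1]]; [|contradiction|].
    + generalize (nb_Cmod_lt z 1 Hz1). apply filter_imp. intros w Hw. symmetry. apply H2. lra.
    + generalize (nb_Cmod_gt z 1 Hz1). apply filter_imp. intros w Hw. symmetry. apply H2. lra.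
Qed.

Definition isq2 : C := RtoC (/ sqrt 2).

Lemma isq2_sq : (isq2 * isq2)%C = RtoC (/ 2).
Proof.
  unfold isq2. rewrite <- RtoC_mult. f_equal. rewrite <- Rinv_mult, sqrt_sqrt; lra.
Qed.

(** Lets [field] close the jump relation with [isq2] kept as an atom: after this rewriting both
    sides carry it twice. *)
Lemma isq2_double (x : C) : (isq2 * (isq2 * (x + x)))%C = x.
Proof.
  rewrite Cmult_assoc, isq2_sq. apply injective_projections; simpl; field.
Qed.

(** Inverse of 1/sqrt 2 times the matrix with rows (1, -1/p) and (p, 1), the factor that leads from
    exterior to interior data. *)
Definition jump_of (p : C) : M2 :=
  mk2 isq2 (isq2 * / p)%C (- (isq2 * p))%C isq2.

Section Circle_problem.
Context (Mdeg : nat) (X : R) (T : nat -> R) (om : C -> C) (Om : R) (f g l k : C -> C) (L : C).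
Context (Hom : phase om Om) (HL : limdata om Om f g l k L).
Context (HV : forall z, Cmod z = 1 -> jumpV Mdeg X T z = jump_of (phiinf om z)).

(** The factor [isq2] brings the interior determinant from 2 to 1. On the circle itself the exterior
    branch is taken; [RHP_sol] sees only one-sided limits there. *)
Definition Rmat (z : C) : M2 :=
  if Rlt_dec (Cmod z) 1
  then mscal isq2 (mk2 (l z) (- sch k z)%C (k z) (sch l z))
  else mk2 (sch g z) (f z) (- sch f z)%C (g z).

Lemma Rmat_in z : Cmod z < 1 ->
  Rmat z = mscal isq2 (mk2 (l z) (- sch k z)%C (k z) (sch l z)).
Proof. intros H. unfold Rmat. destruct (Rlt_dec (Cmod z) 1); tauto. Qed.
Lemma Rmat_out z : 1 < Cmod z -> Rmat z = mk2 (sch g z) (f z) (- sch f z)%C (g z).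
Proof. intros H. unfold Rmat. destruct (Rlt_dec (Cmod z) 1); [lra|auto]. Qed.

Lemma phiinf_neq_0 z : phiinf om z <> RtoC 0.
Proof.
  apply Cmult_neq_0; [apply Hom|]. unfold blinf. rewrite <- cexp_opp. apply cexp_neq_0.
Qed.

Lemma phiinf_sch z : z <> RtoC 0 -> sch (phiinf om) z = (/ phiinf om z)%C.
Proof.
  intros Hz. assert (B := fun w => cexp_neq_0 (RtoC (-4) * (Ci / w))%C).
  unfold sch, phiinf, blinf. rewrite Cdiv_conj by apply B.
  change (Cconj (om (Cconj z))) with (sch om z). rewrite (ph_sch _ _ Hom), <- cexp_conj.
  replace (Cconj (RtoC (-4) * (Ci / Cconj z))) with (- (RtoC (-4) * (Ci / z)))%C.
  - rewrite cexp_opp. assert (A1 := ph_nz _ _ Hom z). assert (A2 := B z). field. auto.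
  - rewrite Cmult_conj, Cdiv_conj, Cconj_conj, RtoC_conj.
    + replace (Cconj Ci) with (- Ci)%C by (apply injective_projections; simpl; ring).
      field. auto.
    + apply Cmod_gt_0. rewrite Cmod_conj. now apply Cmod_gt_0.
Qed.

Lemma out_diff z : 3 / 4 < Cmod z ->
  cdiff f z /\ cdiff g z /\ cdiff (sch f) z /\ cdiff (sch g) z.
Proof.
  intros Hz. repeat split; try (now apply HL); apply cdiff_sch;
    [apply (ld_f _ _ _ _ _ _ _ HL)|apply (ld_g _ _ _ _ _ _ _ HL)]; now rewrite Cmod_conj.
Qed.

Lemma in_diff z : Cmod z < 5 / 4 ->
  cdiff l z /\ cdiff k z /\ cdiff (sch l) z /\ cdiff (sch k) z.
Proof.
  intros Hz. repeat split; try (now apply HL); apply cdiff_sch;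
    [apply (ld_l _ _ _ _ _ _ _ HL)|apply (ld_k _ _ _ _ _ _ _ HL)]; now rewrite Cmod_conj.
Qed.

Lemma in_out_relations z : Cmod z = 1 -> let p := phiinf om z in
  l z = (sch g z + p * f z)%C /\
  k z = (p * g z - sch f z)%C /\
  sch l z = (g z + / p * sch f z)%C /\
  sch k z = (/ p * sch g z - f z)%C.
Proof.
  intros Hz p.
  destruct (ld_lk _ _ _ _ _ _ _ HL z ltac:(lra)) as (E1 & E2).
  destruct (ld_lk _ _ _ _ _ _ _ HL (Cconj z) ltac:(rewrite Cmod_conj; lra)) as (E3 & E4).
  assert (Hs : Cconj (phiinf om (Cconj z)) = (/ p)%C)
    by (apply phiinf_sch; apply Cmod_gt_0; lra).
  split; [exact E1|split; [exact E2|]]. unfold sch. rewrite E3, E4, Cplus_conj, Cminus_conj,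
      !Cmult_conj, Hs.
  unfold sch. rewrite !Cconj_conj. auto.
Qed.

Lemma clim_in_ext (D : C -> Prop) (u v : C -> C) p q : (forall z, D z -> u z = v z) ->
  ccont u p -> u p = q -> clim_in D v p q.
Proof.
  intros E Hu <-. intros eps He. destruct (Hu eps He) as (d & Hd & H). exists d. split; auto.
  intros z Hz _ Hd'. rewrite <- E by auto. auto.
Qed.

Lemma Rmat_RHP : RHP_sol Mdeg X T Rmat.
Proof.
  split; [|split].
  - intros z Hz. destruct (Rtotal_order (Cmod z) 1) as [H|[H|H]]; [|contradiction|].
    + destruct (in_diff z ltac:(lra)) as (D1 & D2 & D3 & D4).
      assert (N : nb z (fun w => mscal isq2 (mk2 (l w) (- sch k w)%C (k w) (sch l w)) = Rmat w)).
      { generalize (nb_Cmod_lt z 1 H). apply filter_imp. intros w Hw. now rewrite Rmat_in. }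
      split; [|split; [|split]].
      * apply cdiff_ext_loc with (fun w => (isq2 * l w)%C).
        -- generalize N. apply filter_imp. intros w <-. reflexivity.
        -- apply cdiff_mult; auto. apply cdiff_const.
      * apply cdiff_ext_loc with (fun w => (isq2 * - sch k w)%C).
        -- generalize N. apply filter_imp. intros w <-. reflexivity.
        -- apply cdiff_mult; [apply cdiff_const|]. now apply cdiff_opp.
      * apply cdiff_ext_loc with (fun w => (isq2 * k w)%C).
        -- generalize N. apply filter_imp. intros w <-. reflexivity.
        -- apply cdiff_mult; auto. apply cdiff_const.
      * apply cdiff_ext_loc with (fun w => (isq2 * sch l w)%C).
        -- generalize N. apply filter_imp. intros w <-. reflexivity.
        -- apply cdiff_mult; auto. apply cdiff_const.
    + destruct (out_diff z ltac:(lra)) as (D1 & D2 & D3 & D4).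
      assert (N : nb z (fun w => mk2 (sch g w) (f w) (- sch f w)%C (g w) = Rmat w)).
      { generalize (nb_Cmod_gt z 1 H). apply filter_imp. intros w Hw. now rewrite Rmat_out. }
      split; [|split; [|split]].
      * apply cdiff_ext_loc with (sch g); auto.
        generalize N. apply filter_imp. intros w <-. reflexivity.
      * apply cdiff_ext_loc with f; auto.
        generalize N. apply filter_imp. intros w <-. reflexivity.
      * apply cdiff_ext_loc with (fun w => (- sch f w)%C).
        -- generalize N. apply filter_imp. intros w <-. reflexivity.
        -- now apply cdiff_opp.
      * apply cdiff_ext_loc with g; auto.
        generalize N. apply filter_imp. intros w <-. reflexivity.
  - intros z0 Hz0.
    exists (mscal isq2 (mk2 (l z0) (- sch k z0)%C (k z0) (sch l z0))),
           (mk2 (sch g z0) (f z0) (- sch f z0)%C (g z0)).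
    destruct (in_diff z0 ltac:(lra)) as (D1 & D2 & D3 & D4).
    destruct (out_diff z0 ltac:(lra)) as (D5 & D6 & D7 & D8).
    split; [|split].
    + split; [|split; [|split]].
      * apply clim_in_ext with (fun w => (isq2 * l w)%C).
        -- intros w Hw. now rewrite Rmat_in.
        -- apply cdiff_cont, cdiff_mult; auto. apply cdiff_const.
        -- reflexivity.
      * apply clim_in_ext with (fun w => (isq2 * - sch k w)%C).
        -- intros w Hw. now rewrite Rmat_in.
        -- apply cdiff_cont, cdiff_mult; [apply cdiff_const|]. now apply cdiff_opp.
        -- reflexivity.
      * apply clim_in_ext with (fun w => (isq2 * k w)%C).
        -- intros w Hw. now rewrite Rmat_in.
        -- apply cdiff_cont, cdiff_mult; auto. apply cdiff_const.
        -- reflexivity.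
      * apply clim_in_ext with (fun w => (isq2 * sch l w)%C).
        -- intros w Hw. now rewrite Rmat_in.
        -- apply cdiff_cont, cdiff_mult; auto. apply cdiff_const.
        -- reflexivity.
    + split; [|split; [|split]].
      * apply clim_in_ext with (sch g); [|now apply cdiff_cont|reflexivity].
        intros w Hw. now rewrite Rmat_out.
      * apply clim_in_ext with f; [|now apply cdiff_cont|reflexivity].
        intros w Hw. now rewrite Rmat_out.
      * apply clim_in_ext with (fun w => (- sch f w)%C); [|now apply cdiff_cont, cdiff_opp|reflexivity].
        intros w Hw. now rewrite Rmat_out.
      * apply clim_in_ext with g; [|now apply cdiff_cont|reflexivity].
        intros w Hw. now rewrite Rmat_out.
    + rewrite HV by auto. destruct (in_out_relations z0 Hz0) as (-> & -> & -> & ->).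
      assert (P0 := phiinf_neq_0 z0). set (p := phiinf om z0) in *.
      unfold mmul, jump_of, mscal; cbn [m11 m12 m21 m22].
      f_equal; match goal with |- ?x = _ => rewrite <- (isq2_double x) at 1 end; field; auto.
  - assert (N : nbinf (fun w => mk2 (sch g w) (f w) (- sch f w)%C (g w) = Rmat w)).
    { exists 1. intros z Hz. now rewrite Rmat_out. }
    assert (Tf := ld_finf _ _ _ _ _ _ _ HL). assert (Tg := ld_ginf _ _ _ _ _ _ _ HL).
    split; [|split; [|split]].
    + apply (tends_ext_loc (F := nbinf) (sch g)).
      * generalize N. apply filter_imp. intros w <-. reflexivity.
      * simpl. rewrite <- (RtoC_conj 1). now apply sch_infty.
    + apply (tends_ext_loc (F := nbinf) f); auto.
      generalize N. apply filter_imp. intros w <-. reflexivity.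
    + apply (tends_ext_loc (F := nbinf) (fun w => (- sch f w)%C)).
      * generalize N. apply filter_imp. intros w <-. reflexivity.
      * apply tends_eq with (- Cconj (RtoC 0))%C; [|rewrite RtoC_conj; simpl; ring].
        apply tends_opp. now apply sch_infty.
    + apply (tends_ext_loc (F := nbinf) g); auto.
      generalize N. apply filter_imp. intros w <-. reflexivity.
Qed.

(** As in the pole problem, the first row of M is multiplied by the inverse of the known solution,
    giving [o1], [o2] outside and [i1], [i2] inside. Both matrices have the same jump, so the two
    pieces fit together continuously across the circle. *)
Lemma RHP_unique M : RHP_sol Mdeg X T M -> forall z, 1 < Cmod z -> m12 (M z) = f z.
Proof.
  intros (HM & Hj & Hi).
  set (x1 := fun z => m11 (M z)). set (x2 := fun z => m12 (M z)).
  assert (Hx : forall z, Cmod z <> 1 -> cdiff x1 z /\ cdiff x2 z).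
  { intros z Hz. destruct (HM z Hz) as (D1 & D2 & _). auto. }
  set (inn := fun z => Cmod z < 1).
  set (o1 := fun z => (x1 z * g z + x2 z * sch f z)%C).
  set (o2 := fun z => (x2 z * sch g z - x1 z * f z)%C).
  set (i1 := fun z => (isq2 * (x1 z * sch l z - x2 z * k z))%C).
  set (i2 := fun z => (isq2 * (x1 z * sch k z + x2 z * l z))%C).
  (* The glued function is continuous everywhere but known to be differentiable only off the circle,
     the situation of [Liouville_except] with exceptional radius 1. *)
  assert (Key : forall o i lim, tends nbinf o lim ->
    (forall z, 1 < Cmod z -> cdiff o z) -> (forall z, Cmod z < 1 -> cdiff i z) ->
    (forall z0, Cmod z0 = 1 -> exists v, tends (pnb (fun z => Cmod z < 1) z0) i v /\
       tends (pnb (fun z => 1 < Cmod z) z0) o v) ->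
    forall z, 1 < Cmod z -> o z = lim).
  { intros o i lim Hlim Ho Hii Hv.
    set (h := fun z => if Rlt_dec (Cmod z) 1 then i z else o z).
    assert (h_in : forall z, Cmod z < 1 -> i z = h z).
    { intros z Hz. unfold h. destruct (Rlt_dec (Cmod z) 1); tauto. }
    assert (h_out : forall z, 1 < Cmod z -> o z = h z).
    { intros z Hz. unfold h. destruct (Rlt_dec (Cmod z) 1); [lra|auto]. }
    assert (Hd : forall z, Cmod z <> 1 -> cdiff h z).
    { intros z Hz. destruct (Rtotal_order (Cmod z) 1) as [H|[H|H]]; [|contradiction|].
      - apply cdiff_ext_loc with i; auto. generalize (nb_Cmod_lt z 1 H). apply filter_imp. auto.
      - apply cdiff_ext_loc with o; auto. generalize (nb_Cmod_gt z 1 H). apply filter_imp. auto. }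
    destruct (circle_extension h) as (H & H1 & H2).
    - intros z Hz. now apply cdiff_cont, Hd.
    - intros z0 Hz0. destruct (Hv z0 Hz0) as (v & V1 & V2). exists v. split.
      + apply (tends_ext_loc (F := pnb (fun z => Cmod z < 1) z0) i); auto.
        exists 1. split; [lra|]. auto.
      + apply (tends_ext_loc (F := pnb (fun z => 1 < Cmod z) z0) o); auto.
        exists 1. split; [lra|]. auto.
    - intros z Hz. rewrite h_out, <- H2 by lra.
      apply (Liouville_except H (1 :: nil)); auto.
      + apply tends_ext_loc with o; auto. exists 1. intros w Hw. rewrite H2 by lra. auto.
      + intros w Hw. assert (Hw1 : Cmod w <> 1) by (intros E; apply Hw; now left).
        apply cdiff_ext_loc with h; [|now apply Hd].
        destruct (Rtotal_order (Cmod w) 1) as [G|[G|G]]; [|contradiction|].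
        * generalize (nb_Cmod_lt w 1 G). apply filter_imp. intros y Hy. symmetry. apply H2. lra.
        * generalize (nb_Cmod_gt w 1 G). apply filter_imp. intros y Hy. symmetry. apply H2. lra.
      + intros [E|[]]. lra. }
  assert (Hcirc : forall z0, Cmod z0 = 1 -> exists a b,
    tends (pnb (fun z => Cmod z < 1) z0) x1 a /\ tends (pnb (fun z => Cmod z < 1) z0) x2 b /\
    tends (pnb (fun z => 1 < Cmod z) z0) x1
      (isq2 * (a - b * phiinf om z0))%C /\
    tends (pnb (fun z => 1 < Cmod z) z0) x2
      (isq2 * (a * / phiinf om z0 + b))%C).
  { intros z0 Hz0. destruct (Hj z0 Hz0) as (Rm & Rp & (A1 & A2 & _) & (B1 & B2 & _) & E).
    rewrite HV in E by auto. exists (m11 Rm), (m12 Rm). rewrite E in B1, B2.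
    unfold mmul, jump_of in B1, B2. cbn [m11 m12 m21 m22] in B1, B2.
    repeat split; auto.
    - eapply tends_eq; [exact B1|]. ring.
    - eapply tends_eq; [exact B2|]. ring. }
  assert (Tf := ld_finf _ _ _ _ _ _ _ HL). assert (Tg := ld_ginf _ _ _ _ _ _ _ HL).
  assert (I1 : tends nbinf x1 (RtoC 1)) by apply Hi.
  assert (I2 : tends nbinf x2 (RtoC 0)) by apply Hi.
  assert (J1 := sch_infty _ _ Tf). assert (J2 := sch_infty _ _ Tg).
  assert (Hcont : forall D z0 h, cdiff h z0 -> tends (pnb D z0) h (h z0)).
  { intros D z0 h Hh. now apply tends_nb_pnb, cdiff_cont. }
  assert (E1 : forall z, 1 < Cmod z -> o1 z = RtoC 1).
  { apply (Key o1 i1).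
    - apply tends_eq with (RtoC 1 * RtoC 1 + RtoC 0 * Cconj (RtoC 0))%C; [|ring].
      apply tends_plus; apply tends_mult; auto.
    - intros z Hz. destruct (Hx z ltac:(lra)). destruct (out_diff z ltac:(lra)) as (D1 & D2 & D3 & D4).
      apply cdiff_plus; apply cdiff_mult; auto.
    - intros z Hz. destruct (Hx z ltac:(lra)). destruct (in_diff z ltac:(lra)) as (D1 & D2 & D3 & D4).
      apply cdiff_mult; [apply cdiff_const|]. apply cdiff_minus; apply cdiff_mult; auto.
    - intros z0 Hz0. destruct (Hcirc z0 Hz0) as (a & b & A1 & A2 & A3 & A4).
      destruct (out_diff z0 ltac:(lra)) as (D1 & D2 & D3 & D4).
      destruct (in_diff z0 ltac:(lra)) as (D5 & D6 & D7 & D8).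
      exists (isq2 * (a * sch l z0 - b * k z0))%C. split.
      + apply tends_mult; [apply (tends_const (F := pnb (fun z => Cmod z < 1) z0))|].
        apply tends_minus; apply tends_mult; auto.
      + eapply tends_eq; [apply tends_plus; apply tends_mult; eauto|].
        destruct (in_out_relations z0 Hz0) as (R1 & R2 & R3 & R4). rewrite R2, R3.
        assert (P0 := phiinf_neq_0 z0). field. auto. }
  assert (E2 : forall z, 1 < Cmod z -> o2 z = RtoC 0).
  { apply (Key o2 i2).
    - apply tends_eq with (RtoC 0 * Cconj (RtoC 1) - RtoC 1 * RtoC 0)%C; [|ring].
      apply tends_minus; apply tends_mult; auto.
    - intros z Hz. destruct (Hx z ltac:(lra)). destruct (out_diff z ltac:(lra)) as (D1 & D2 & D3 & D4).
      apply cdiff_minus; apply cdiff_mult; auto.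
    - intros z Hz. destruct (Hx z ltac:(lra)). destruct (in_diff z ltac:(lra)) as (D1 & D2 & D3 & D4).
      apply cdiff_mult; [apply cdiff_const|]. apply cdiff_plus; apply cdiff_mult; auto.
    - intros z0 Hz0. destruct (Hcirc z0 Hz0) as (a & b & A1 & A2 & A3 & A4).
      destruct (out_diff z0 ltac:(lra)) as (D1 & D2 & D3 & D4).
      destruct (in_diff z0 ltac:(lra)) as (D5 & D6 & D7 & D8).
      exists (isq2 * (a * sch k z0 + b * l z0))%C. split.
      + apply tends_mult; [apply (tends_const (F := pnb (fun z => Cmod z < 1) z0))|].
        apply tends_plus; apply tends_mult; auto.
      + eapply tends_eq; [apply tends_minus; apply tends_mult; eauto|].
        destruct (in_out_relations z0 Hz0) as (R1 & R2 & R3 & R4). rewrite R1, R4.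
        assert (P0 := phiinf_neq_0 z0). field. auto. }
  intros z Hz. change (m12 (M z)) with (x2 z).
  transitivity (f z * o1 z + g z * o2 z)%C.
  - unfold o1, o2. rewrite <- (Cmult_1_r (x2 z)) at 1.
    rewrite <- (ld_det _ _ _ _ _ _ _ HL z ltac:(lra)). ring.
  - rewrite E1, E2 by auto. ring.
Qed.

Lemma Psi_eq : Psi Mdeg X T = (RtoC 2 * (Ci * L))%C.
Proof.
  unfold Psi. apply (recover_val_eq _ Rmat).
  - apply Rmat_RHP.
  - apply (tends_ext_loc (F := nbinf) (fun z => (z * f z)%C)).
    + exists 1. intros z Hz. now rewrite Rmat_out.
    + apply HL.
  - intros M' HM'. exists 1. intros z Hz. rewrite Rmat_out by auto. simpl. now apply RHP_unique.
Qed.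

End Circle_problem.

(** * The polynomial phase Q as a function of the spectral variable *)

Lemma cdiff_cpow n z : cdiff (fun z => cpow z n) z.
Proof.
  induction n as [|n IH]; simpl; [apply cdiff_const|]. apply cdiff_mult; auto. apply cdiff_id.
Qed.

Lemma cdiff_csum (F : nat -> C -> C) n z : (forall k, cdiff (F k) z) ->
  cdiff (fun z => csum (fun k => F k z) n) z.
Proof.
  intros H. induction n as [|n IH].
  - apply (cdiff_const (RtoC 0)).
  - apply cdiff_ext with (fun z => (csum (fun k => F k z) n + F n z)%C).
    + intros w. now rewrite csum_S.
    + apply cdiff_plus; auto.
Qed.

Lemma cpow_conj z n : cpow (Cconj z) n = Cconj (cpow z n).
Proof.
  induction n as [|n IH]; simpl; [now rewrite RtoC_conj|]. now rewrite IH, Cmult_conj.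
Qed.

Lemma csum_conj F n : csum (fun k => Cconj (F k)) n = Cconj (csum F n).
Proof.
  induction n as [|n IH]; [unfold csum; simpl; now rewrite RtoC_conj|].
  now rewrite !csum_S, IH, Cplus_conj.
Qed.

Lemma Cmod_cpow z n : Cmod (cpow z n) = Cmod z ^ n.
Proof.
  induction n as [|n IH]; simpl; [apply Cmod_1|]. now rewrite Cmod_mult, IH.
Qed.

Lemma cdiff_Qphase M X T z : cdiff (fun z => Qphase M z X T) z.
Proof.
  apply cdiff_plus.
  - apply cdiff_mult; [apply cdiff_id|apply cdiff_const].
  - apply (cdiff_csum (fun k z => (cpow z (k + 2) * RtoC (T (k + 2)%nat))%C)).
    intros k. apply cdiff_mult; [apply cdiff_cpow|apply cdiff_const].
Qed.

Lemma Qphase_conj M X T z : Qphase M (Cconj z) X T = Cconj (Qphase M z X T).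
Proof.
  unfold Qphase. rewrite Cplus_conj, Cmult_conj, RtoC_conj. f_equal.
  rewrite <- csum_conj. apply csum_ext. intros j _. now rewrite cpow_conj, Cmult_conj, RtoC_conj.
Qed.

(** One [K] serves all (X, T) in the box and all [|z| <= 2]; the uniformity in the theorem rests on
    it. *)
Lemma Qphase_bound M B : 0 < B -> exists K, forall X T z, Rabs X <= B ->
  (forall m, Rabs (T m) <= B) -> Cmod z <= 2 -> Cmod (Qphase M z X T) <= K.
Proof.
  intros HB. exists (2 * B + rsum (fun k => 2 ^ (k + 2) * B) (M - 1)).
  intros X T z HX HT Hz. unfold Qphase. apply Cmod_plus_le.
  - apply Cmod_mult_le; auto. now rewrite Cmod_R.
  - generalize (M - 1)%nat. induction n as [|n IH].
    + unfold csum; simpl. rewrite Cmod_0. lra.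
    + rewrite csum_S. cbn [rsum]. apply Cmod_plus_le; auto. apply Cmod_mult_le.
      * rewrite Cmod_cpow. apply pow_incr. split; auto. apply Cmod_ge_0.
      * now rewrite Cmod_R.
Qed.

Definition omQ (M : nat) (X : R) (T : nat -> R) (z : C) : C :=
  cexp (RtoC 2 * (Ci * Qphase M z X T))%C.

Lemma Cconj_Ci : Cconj Ci = (- Ci)%C.
Proof. apply injective_projections; simpl; ring. Qed.

Lemma phase_omQ M X T K : (forall z, Cmod z <= 2 -> Cmod (Qphase M z X T) <= K) ->
  phase (omQ M X T) (exp (2 * K)).
Proof.
  intros HK. constructor.
  - intros z. apply (cdiff_comp (fun z => (RtoC 2 * (Ci * Qphase M z X T))%C) cexp).
    + apply cdiff_mult; [apply cdiff_const|]. apply cdiff_mult; [apply cdiff_const|].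
      apply cdiff_Qphase.
    + apply cdiff_cexp.
  - intros z. apply cexp_neq_0.
  - intros z. unfold sch, omQ. rewrite <- cexp_conj, <- cexp_opp, !Cmult_conj, Qphase_conj.
    rewrite Cconj_conj, RtoC_conj, Cconj_Ci. f_equal. ring.
  - intros z Hz. unfold omQ. rewrite <- cexp_opp.
    assert (H : Cmod (RtoC 2 * (Ci * Qphase M z X T)) <= 2 * K).
    { rewrite !Cmod_mult, Cmod_Ci, Cmod_R, Rabs_right by lra. generalize (HK z Hz). lra. }
    split; apply Cmod_cexp_le; rewrite ?Cmod_opp; auto.
Qed.

(** [phiinf] is exp(2 i theta): dividing exp(2iQ) by [blinf z], the exponential of -4i/z, adds
    exactly the term 2/z of [theta]. *)
Lemma jumpV_omQ M X T z : z <> RtoC 0 -> jumpV M X T z = jump_of (phiinf (omQ M X T) z).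
Proof.
  intros Hz. unfold jumpV.
  set (th := theta M X T z). set (e := cexp (Ci * th)%C).
  assert (He : e <> RtoC 0) by apply cexp_neq_0.
  assert (Hp : phiinf (omQ M X T) z = (e * e)%C).
  { unfold phiinf, omQ, blinf, Cdiv. rewrite <- cexp_opp, <- cexp_plus. unfold e.
    rewrite <- cexp_plus. f_equal. unfold th, theta.
    replace (RtoC (-4)) with (- (RtoC 2 + RtoC 2))%C by (apply injective_projections; simpl; ring).
    replace (RtoC 2) with (RtoC 1 + RtoC 1)%C by (apply injective_projections; simpl; ring).
    unfold Cdiv. ring. }
  rewrite Hp.
  unfold expsig3. replace (- (- (Ci * th)))%C with (Ci * th)%C by ring.
  rewrite !cexp_opp. fold e. unfold Qinv, mscal, mmul, jump_of. cbn [m11 m12 m21 m22].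
  fold isq2. replace (RtoC (-1)) with (- RtoC 1)%C by (apply injective_projections; simpl; ring).
  f_equal; field; auto.
Qed.

(** * Eigenvalue sums of the potential *)

(** The sum counts the half-integers below [t], and this count is an integer nearest to [t]. The
    alternatives leave both values open at a tie, so weak monotonicity of Phi is enough in the
    application. *)
Lemma count_estimate (t : R) (b : nat -> R) : 0 <= t ->
  (forall j, b j = 1 /\ INR j + / 2 <= t \/ b j = 0 /\ t <= INR j + / 2) ->
  forall n, t <= INR n -> Rabs (t - rsum b n) <= / 2.
Proof.
  intros Ht Hb.
  assert (U : forall n, rsum b n <= INR n /\ rsum b n <= t + / 2).
  { induction n as [|n IH]; [simpl; lra|]. rewrite S_INR. cbn [rsum].
    destruct (Hb n) as [(-> & H)|(-> & H)]; lra. }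
  assert (E : forall n, INR n <= t -> INR n <= rsum b n).
  { induction n as [|n IH]; intros H; [simpl; lra|]. rewrite S_INR in *. cbn [rsum].
    destruct (Hb n) as [(-> & H')|(-> & H')]; [|lra]. generalize (IH ltac:(lra)). lra. }
  assert (L : forall n, Rmin t (INR n) - / 2 <= rsum b n).
  { induction n as [|n IH]; [simpl; generalize (Rmin_r t 0); lra|]. rewrite S_INR. cbn [rsum].
    assert (M1 := Rmin_l t (INR n + 1)). assert (M2 := Rmin_r t (INR n + 1)).
    destruct (Rle_dec (INR n) t) as [Hn|Hn].
    - rewrite (Rmin_right t (INR n)) in IH by lra. specialize (E n Hn).
      destruct (Hb n) as [(-> & H')|(-> & H')]; lra.
    - rewrite (Rmin_left t (INR n)) in IH by lra.
      destruct (Hb n) as [(-> & H')|(-> & H')]; lra. }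
  intros n Hn. specialize (U n). specialize (L n). rewrite Rmin_left in L by auto.
  apply Rabs_le. lra.
Qed.

(** Layer-cake representation: integrating over [s] the number of eigenvalues above [s] gives their
    sum, which is how that sum is compared with the integral of Phi. *)
Definition step (a s : R) : R := if Rlt_dec s a then 1 else 0.

Lemma is_RInt_step a b : 0 <= a <= b -> is_RInt (step a) 0 b a.
Proof.
  intros H. replace a with (plus a 0) at 2 by (unfold plus; simpl; ring).
  apply (is_RInt_Chasles (V := R_NormedModule)) with a.
  - apply (is_RInt_ext (V := R_NormedModule) (fun _ => 1)).
    + intros x. rewrite Rmin_left, Rmax_right by lra. intros Hx. unfold step.
      destruct (Rlt_dec x a); lra.
    + generalize (is_RInt_const (V := R_NormedModule) 0 a 1). unfold scal; simpl; unfold mult; simpl.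
      now rewrite Rmult_1_r, Rminus_0_r.
  - apply (is_RInt_ext (V := R_NormedModule) (fun _ => 0)).
    + intros x. rewrite Rmin_left, Rmax_right by lra. intros Hx. unfold step.
      destruct (Rlt_dec x a); lra.
    + generalize (is_RInt_const (V := R_NormedModule) a b 0). unfold scal; simpl; unfold mult; simpl.
      now rewrite Rmult_0_r.
Qed.

Lemma is_RInt_rsum (F : nat -> R -> R) (I : nat -> R) a b n :
  (forall j, (j < n)%nat -> is_RInt (F j) a b (I j)) ->
  is_RInt (fun x => rsum (fun j => F j x) n) a b (rsum I n).
Proof.
  induction n as [|n IH]; intros H; cbn [rsum].
  - generalize (is_RInt_const (V := R_NormedModule) a b 0). unfold scal; simpl; unfold mult; simpl.
    now rewrite Rmult_0_r.
  - apply (is_RInt_plus (V := R_NormedModule)); auto.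
Qed.

Section Potential.
Context (A u : R -> R) (Xm Xp c0 x0 : R) (HX : Xm < Xp)
  (Hout : forall x, x < Xm \/ Xp < x -> A x = 0)
  (Hform : forall x, Xm <= x <= Xp -> A x = u x * sqrt ((Xp - x) * (x - Xm)))
  (Hc0 : 0 < c0) (Hu : forall x, Xm <= x <= Xp -> c0 <= u x).

Lemma A_ends : A Xm = 0 /\ A Xp = 0.
Proof.
  split; rewrite Hform by lra.
  - replace ((Xp - Xm) * (Xm - Xm)) with 0 by ring. rewrite sqrt_0. ring.
  - replace ((Xp - Xp) * (Xp - Xm)) with 0 by ring. rewrite sqrt_0. ring.
Qed.

Lemma A_pos x : Xm < x < Xp -> 0 < A x.
Proof.
  intros Hx. rewrite Hform by lra. apply Rmult_lt_0_compat.
  - generalize (Hu x ltac:(lra)). lra.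
  - apply sqrt_lt_R0, Rmult_lt_0_compat; lra.
Qed.

Context (Hmax : forall x, x <> x0 -> A x < A x0).

Lemma Amax_pos : 0 < A x0.
Proof.
  assert (H := A_pos ((Xm + Xp) / 2) ltac:(lra)).
  destruct (Req_dec ((Xm + Xp) / 2) x0) as [<-|Hn]; auto. generalize (Hmax _ Hn). lra.
Qed.

Lemma x0_in : Xm < x0 < Xp.
Proof.
  assert (H := Amax_pos). destruct A_ends as (E1 & E2).
  destruct (Rtotal_order Xm x0) as [H1|[H1|H1]].
  - destruct (Rtotal_order x0 Xp) as [H2|[H2|H2]]; auto.
    + rewrite <- H2 in E2. lra.
    + rewrite Hout in H; lra.
  - rewrite H1 in E1. lra.
  - rewrite Hout in H; lra.
Qed.

Context (Hanal : analytic_near_interval u Xm Xp).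

(** Read off from the semicircular form, which includes the end points of the support. Outside the
    support the radicand is negative and [sqrt] returns 0, so one formula holds on the whole
    line. *)
Lemma A_continuous (x : R) : continuous A x.
Proof.
  destruct Hanal as (d & Hd & U & HU1 & HU2).
  set (v := fun x => fst (U (RtoC x))).
  assert (E : forall x, v x * sqrt ((Xp - x) * (x - Xm)) = A x).
  { intros y. destruct (Rle_dec Xm y) as [H1|H1]; [destruct (Rle_dec y Xp) as [H2|H2]|].
    - rewrite Hform by lra. unfold v. rewrite HU2 by lra. reflexivity.
    - rewrite Hout by lra. rewrite sqrt_neg_0; [ring|]. nra.
    - rewrite Hout by lra. rewrite sqrt_neg_0; [ring|]. nra. }
  destruct (Rlt_dec x Xm) as [H1|H1]; [|destruct (Rlt_dec Xp x) as [H2|H2]].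
  - apply (continuous_ext_loc A (fun _ => 0) x); [|apply continuous_R_const].
    assert (Hp : 0 < Xm - x) by lra. exists (mkposreal _ Hp). intros y Hy.
    change (Rabs (y - x) < Xm - x) in Hy. apply Rabs_def2 in Hy. symmetry. apply Hout. lra.
  - apply (continuous_ext_loc A (fun _ => 0) x); [|apply continuous_R_const].
    assert (Hp : 0 < x - Xp) by lra. exists (mkposreal _ Hp). intros y Hy.
    change (Rabs (y - x) < x - Xp) in Hy. apply Rabs_def2 in Hy. symmetry. apply Hout. lra.
  - apply (continuous_ext (fun x => v x * sqrt ((Xp - x) * (x - Xm)))); auto.
    apply (continuous_mult (K := R_AbsRing) v (fun x => sqrt ((Xp - x) * (x - Xm)))).
    + apply (pcont_fst (fun x => U (RtoC x))), (pcont_comp U (fun x => RtoC x)).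
      * apply pcont_pair; [apply continuous_R_id|apply continuous_R_const].
      * apply cdiff_cont, HU1. exists x. split; [lra|].
        replace (RtoC x - RtoC x)%C with (RtoC 0) by ring. now rewrite Cmod_0.
    + apply (continuous_comp (fun x => (Xp - x) * (x - Xm)) sqrt); [|apply continuous_sqrt].
      apply (continuous_mult (K := R_AbsRing)).
      * apply (continuous_minus (K := R_AbsRing) (V := R_NormedModule)); [apply
          continuous_R_const|apply continuous_R_id].
      * apply (continuous_minus (K := R_AbsRing) (V := R_NormedModule)); [apply continuous_R_id|apply
          continuous_R_const].
Qed.

Lemma A_continuity : continuity A.
Proof. intros x. apply continuity_pt_filterlim, A_continuous. Qed.

Lemma A_IVT a b s : a <= b -> (A a <= s <= A b \/ A b <= s <= A a) -> exists x, a <= x <= b /\ A x = s.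
Proof.
  intros Hab Hs. destruct (IVT_gen A a b s A_continuity) as (x & Hx & E).
  - unfold Rmin, Rmax. destruct (Rle_dec (A a) (A b)); lra.
  - exists x. rewrite Rmin_left, Rmax_right in Hx by lra. auto.
Qed.

Context (xm xp : R -> R)
  (Hxpm : forall s, 0 < s < A x0 ->
            xm s < xp s /\ (forall x, A x = s <-> (x = xm s \/ x = xp s))).

(** By the intermediate value theorem [A] takes the value [s] on each side of [x0], and it does so
    at two points in all; a further sign change of [A - s] would produce a third. *)
Lemma turning s : 0 < s < A x0 ->
  Xm <= xm s /\ xm s < x0 < xp s /\ xp s <= Xp /\
  (forall x, xm s < x < xp s -> s < A x) /\ (forall x, x < xm s \/ xp s < x -> A x < s).
Proof.
  intros Hs. destruct (Hxpm s Hs) as (Hlt & Heq). assert (H0 := x0_in).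
  destruct A_ends as (E1 & E2).
  destruct (A_IVT Xm x0 s) as (a & Ha & Ea); [lra|lra|].
  destruct (A_IVT x0 Xp s) as (b & Hb & Eb); [lra|lra|].
  assert (a <> x0) by (intros ->; lra). assert (b <> x0) by (intros ->; lra).
  assert (Ia := proj1 (Heq a) Ea). assert (Ib := proj1 (Heq b) Eb).
  assert (a = xm s /\ b = xp s) by lra.
  assert (Hne : forall x, x <> xm s -> x <> xp s -> A x <> s).
  { intros x N1 N2 E. apply Heq in E. tauto. }
  repeat split; try lra.
  - intros x Hx. destruct (Rtotal_order (A x) s) as [G2|[G2|G2]]; auto.
    + destruct (Rle_dec x x0) as [Hx0|Hx0].
      * destruct (A_IVT x x0 s) as (y & Hy & Ey); [lra|lra|]. apply Heq in Ey. lra.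
      * destruct (A_IVT x0 x s) as (y & Hy & Ey); [lra|lra|]. apply Heq in Ey. lra.
    + apply Hne in G2; lra.
  - intros x Hx. destruct (Rtotal_order (A x) s) as [G2|[G2|G2]]; auto.
    + apply Hne in G2; lra.
    + destruct Hx as [Hx|Hx].
      * assert (Xm <= x) by (apply Rnot_lt_le; intros G3; rewrite Hout in G2; lra).
        destruct (A_IVT Xm x s) as (y & Hy & Ey); [lra|lra|]. apply Heq in Ey. lra.
      * assert (x <= Xp) by (apply Rnot_lt_le; intros G3; rewrite Hout in G2; lra).
        destruct (A_IVT x Xp s) as (y & Hy & Ey); [lra|lra|]. apply Heq in Ey. lra.
Qed.

Notation ph := (Phi_is A xm xp).
Notation J := (RInt A Xm Xp).
Notation w := (Xp - Xm).

Lemma sqrt_A_continuous (s x : R) : continuous (fun x => sqrt (A x ^ 2 - s ^ 2)) x.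
Proof.
  apply (continuous_comp (fun x => A x ^ 2 - s ^ 2) sqrt); [|apply continuous_sqrt].
  apply (continuous_minus (K := R_AbsRing) (V := R_NormedModule)); [|apply continuous_R_const].
  apply (continuous_ext (fun x => A x * A x)); [intros; simpl; ring|].
  apply (continuous_mult (K := R_AbsRing)); apply A_continuous.
Qed.

Lemma ex_RInt_cont (f : R -> R) (a b : R) : (forall x, continuous f x) -> ex_RInt (V :=
    R_NormedModule) f a b.
Proof. intros H. apply (ex_RInt_continuous (V := R_CompleteNormedModule)). auto. Qed.

Context (HA0 : forall x, 0 <= A x).

(* Where A < s the radicand is negative and sqrt returns 0, so the turning points can be
   replaced by the fixed support. *)
Lemma Phi_fixed s : 0 < s < A x0 -> ph s = RInt (fun x => sqrt (A x ^ 2 - s ^ 2)) Xm Xp.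
Proof.
  intros Hs. destruct (turning s Hs) as (T1 & T2 & T3 & _ & T5).
  set (h := fun x => sqrt (A x ^ 2 - s ^ 2)).
  assert (Hz : forall a b, a <= b -> (forall x, a < x < b -> A x < s) -> RInt h a b = 0).
  { intros a b Hab H. rewrite (RInt_ext _ (fun _ => 0)).
    - rewrite RInt_const. unfold scal; simpl; unfold mult; simpl. ring.
    - rewrite Rmin_left, Rmax_right by lra. intros x Hx. apply sqrt_neg_0.
      generalize (HA0 x) (H x Hx). nra. }
  assert (Hex : forall a b, ex_RInt (V := R_NormedModule) h a b) by (intros; apply ex_RInt_cont,
      sqrt_A_continuous).
  assert (C1 := RInt_Chasles (V := R_CompleteNormedModule) h Xm (xm s) Xp (Hex _ _) (Hex _ _)).
  assert (C2 := RInt_Chasles (V := R_CompleteNormedModule) h (xm s) (xp s) Xp (Hex _ _) (Hex _ _)).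
  rewrite Hz in C1; [|lra|intros x Hx; apply T5; lra].
  rewrite (Hz (xp s) Xp) in C2; [|lra|intros x Hx; apply T5; lra].
  unfold Phi_is. fold h. unfold plus in C1, C2; simpl in C1, C2. lra.
Qed.

Lemma sqrt_A_bounds s x : 0 < s -> A x - s <= sqrt (A x ^ 2 - s ^ 2) <= A x.
Proof.
  intros Hs. assert (HA := HA0 x). destruct (Rle_dec (A x) s) as [H|H].
  - rewrite sqrt_neg_0 by nra. lra.
  - split.
    + rewrite <- (sqrt_Rsqr (A x - s)) by lra. apply sqrt_le_1_alt. unfold Rsqr. nra.
    + rewrite <- (sqrt_Rsqr (A x)) at 2 by lra. apply sqrt_le_1_alt. unfold Rsqr. nra.
Qed.

Lemma RInt_le_cont (f g : R -> R) (a b : R) : a <= b -> (forall x, continuous f x) -> (forall x,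
    continuous g x) ->
  (forall x, a < x < b -> f x <= g x) -> RInt f a b <= RInt g a b.
Proof. intros Hab Hf Hg H. apply RInt_le; auto; now apply ex_RInt_cont. Qed.

(** Squeezes Phi to the integral of [A] as [s] tends to 0, which identifies [PhiC 0] later. *)
Lemma Phi_bounds s : 0 < s < A x0 -> J - s * w <= ph s <= J.
Proof.
  intros Hs. rewrite Phi_fixed by auto. split.
  - replace (J - s * w) with (RInt (fun x => A x - s) Xm Xp).
    + apply RInt_le_cont; try lra.
      * intros x. apply (continuous_minus (K := R_AbsRing) (V := R_NormedModule)); [apply
          A_continuous|apply continuous_R_const].
      * apply sqrt_A_continuous.
      * intros x _. apply sqrt_A_bounds; lra.
    + rewrite (RInt_minus (V := R_CompleteNormedModule) A (fun _ => s)).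
      * rewrite RInt_const. unfold minus, plus, opp, scal; simpl; unfold mult; simpl. ring.
      * apply ex_RInt_cont, A_continuous.
      * apply ex_RInt_cont. intros x. apply continuous_R_const.
  - apply RInt_le_cont; try lra.
    + apply sqrt_A_continuous.
    + apply A_continuous.
    + intros x _. apply sqrt_A_bounds; lra.
Qed.

Lemma A_le_max x : A x <= A x0.
Proof. destruct (Req_dec x x0) as [->|H]; [lra|]. left. now apply Hmax. Qed.

Lemma Phi_top s : 0 < s < A x0 -> ph s <= sqrt (A x0 ^ 2 - s ^ 2) * w.
Proof.
  intros Hs. rewrite Phi_fixed by auto.
  replace (sqrt (A x0 ^ 2 - s ^ 2) * w) with (RInt (fun _ => sqrt (A x0 ^ 2 - s ^ 2)) Xm Xp).
  - apply RInt_le_cont; try lra.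
    + apply sqrt_A_continuous.
    + intros x. apply continuous_R_const.
    + intros x _. apply sqrt_le_1_alt. generalize (HA0 x) (A_le_max x). nra.
  - rewrite RInt_const. unfold scal; simpl; unfold mult; simpl. ring.
Qed.

Lemma Phi_decr s s' : 0 < s <= s' -> s' < A x0 -> ph s' <= ph s.
Proof.
  intros Hs Hs'. rewrite !Phi_fixed by lra. apply RInt_le_cont; try lra.
  - apply sqrt_A_continuous.
  - apply sqrt_A_continuous.
  - intros x _. apply sqrt_le_1_alt. nra.
Qed.

Lemma Phi_pos s : 0 < s < A x0 -> 0 < ph s.
Proof.
  intros Hs. destruct (turning s Hs) as (T1 & T2 & T3 & T4 & T5).
  apply RInt_gt_0; [lra| |].
  - intros x Hx. apply sqrt_lt_R0. generalize (T4 x Hx). nra.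
  - intros x _. apply sqrt_A_continuous.
Qed.

Lemma J_pos : 0 < J.
Proof. apply RInt_gt_0; [lra|apply A_pos|]. intros x _. apply A_continuous. Qed.

Lemma int_R_eq : int_R A = J.
Proof.
  unfold int_R. apply is_RInt_gen_unique. intros Q HQ.
  exists (fun a => a < Xm) (fun b => Xp < b).
  - exists Xm. auto.
  - exists Xp. auto.
  - intros a b Ha Hb. exists J. split; [|now apply locally_singleton]. simpl.
    assert (Z : forall a b, a <= b -> (forall x, a < x < b -> A x = 0) -> is_RInt A a b 0).
    { intros p q Hpq H. apply (is_RInt_ext (V := R_NormedModule) (fun _ => 0)).
      - rewrite Rmin_left, Rmax_right by lra. intros x Hx. symmetry. auto.
      - generalize (is_RInt_const (V := R_NormedModule) p q 0). unfold scal; simpl; unfold mult; simpl.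
        now rewrite Rmult_0_r. }
    replace J with (plus 0 (plus J 0)) by (unfold plus; simpl; ring).
    apply (is_RInt_Chasles (V := R_NormedModule)) with Xm.
    + apply Z; [lra|]. intros x Hx. apply Hout. lra.
    + apply (is_RInt_Chasles (V := R_NormedModule)) with Xp.
      * apply (RInt_correct (V := R_CompleteNormedModule)). apply ex_RInt_cont, A_continuous.
      * apply Z; [lra|]. intros x Hx. apply Hout. lra.
Qed.

Context (P : nat) (PhiC : nat -> R)
  (HPhi : forall s, 0 < s < A x0 ->
     RtoC (Phi_is A xm xp s) =
     csum (fun p => (RtoC (PhiC p) * cpow (Ci * RtoC s)%C (2 * p))%C) (S P)).

(** Continues Phi to [s = 0] and [s = A x0], where [xm] and [xp] are unconstrained and [Phi_is]
    carries no information; monotonicity and integration can then use the closed interval. *)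
Definition Fpoly (s : R) : R :=
  fst (csum (fun p => (RtoC (PhiC p) * cpow (Ci * RtoC s)%C (2 * p))%C) (S P)).

Lemma Fpoly_Phi s : 0 < s < A x0 -> Fpoly s = ph s.
Proof. intros Hs. unfold Fpoly. now rewrite <- HPhi. Qed.

Lemma Fpoly_continuous (s : R) : continuous Fpoly s.
Proof.
  apply (pcont_fst (fun s => csum (fun p => (RtoC (PhiC p) * cpow (Ci * RtoC s)%C (2 * p))%C) (S P))).
  apply (pcont_comp (fun z => csum (fun p => (RtoC (PhiC p) * cpow (Ci * z)%C (2 * p))%C) (S P))
    (fun s => RtoC s)).
  - apply pcont_pair; [apply continuous_R_id|apply continuous_R_const].
  - apply cdiff_cont, (cdiff_csum (fun p z => (RtoC (PhiC p) * cpow (Ci * z)%C (2 * p))%C)).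
    intros k. apply cdiff_mult; [apply cdiff_const|].
    apply (cdiff_comp (fun z => (Ci * z)%C) (fun z => cpow z (2 * k))); [|apply cdiff_cpow].
    apply cdiff_mult; [apply cdiff_const|apply cdiff_id].
Qed.

Lemma Fpoly_0 : Fpoly 0 = PhiC 0%nat.
Proof.
  assert (E : forall n, csum (fun p => (RtoC (PhiC p) * cpow (Ci * RtoC 0)%C (2 * p))%C) (S n) =
    RtoC (PhiC 0%nat)).
  { induction n as [|n IH].
    - unfold csum; simpl. ring.
    - rewrite csum_S, IH. replace (2 * S n)%nat with (S (2 * n + 1)) by lia. simpl cpow. ring. }
  unfold Fpoly. now rewrite E.
Qed.

Lemma continuous_eps (f : R -> R) (x eps : R) : continuous f x -> 0 < eps ->
  exists d, 0 < d /\ forall y, Rabs (y - x) < d -> Rabs (f y - f x) < eps.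
Proof.
  intros Hf He. destruct (proj1 (filterlim_locally f (f x)) Hf (mkposreal _ He)) as (d & Hd).
  exists d. split; [apply cond_pos|]. intros y Hy. now apply (Hd y).
Qed.

(** With the definition of [epsN] the constant term is [INR N * eps * PI], so leaving it out of the
    phase changes the norming constants by the sign (-1)^N only. *)
Lemma PhiC_0 : PhiC 0%nat = J.
Proof.
  rewrite <- Fpoly_0. apply Rminus_diag_uniq, Rabs_eq_0.
  apply Rle_antisym; [|apply Rabs_pos]. apply le_epsilon. intros eps He.
  destruct (continuous_eps Fpoly 0 (eps / 2) (Fpoly_continuous 0) ltac:(lra)) as (d & Hd & H).
  assert (HS := Amax_pos).
  set (s := Rmin (Rmin (d / 2) (A x0 / 2)) (eps / (2 * w))).
  assert (S1 : s <= d / 2) by (eapply Rle_trans; [apply Rmin_l|apply Rmin_l]).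
  assert (S2 : s <= A x0 / 2) by (eapply Rle_trans; [apply Rmin_l|apply Rmin_r]).
  assert (S3 : s <= eps / (2 * w)) by apply Rmin_r.
  assert (S0 : 0 < s).
  { unfold s. repeat apply Rmin_glb_lt; try lra. apply Rdiv_lt_0_compat; lra. }
  assert (B := Phi_bounds s ltac:(lra)). rewrite <- Fpoly_Phi in B by lra.
  assert (C := H s ltac:(rewrite Rminus_0_r, Rabs_right; lra)). apply Rabs_def2 in C.
  assert (s * w <= eps / 2).
  { apply Rmult_le_compat_r with (r := w) in S3; [|lra].
    replace (eps / (2 * w) * w) with (eps / 2) in S3 by (field; lra). exact S3. }
  apply Rabs_le. lra.
Qed.

Lemma Fpoly_top : Fpoly (A x0) = 0.
Proof.
  apply Rabs_eq_0. apply Rle_antisym; [|apply Rabs_pos]. apply le_epsilon. intros eps He.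
  assert (HS := Amax_pos). set (S := A x0) in *.
  destruct (continuous_eps Fpoly S (eps / 2) (Fpoly_continuous S) ltac:(lra)) as (d & Hd & H).
  assert (Hg : continuous (fun s => sqrt (S ^ 2 - s ^ 2) * w) S).
  { apply (continuous_mult (K := R_AbsRing)); [|apply continuous_R_const].
    apply (continuous_comp (fun s => S ^ 2 - s ^ 2) sqrt); [|apply continuous_sqrt].
    apply (continuous_minus (K := R_AbsRing) (V := R_NormedModule)); [apply continuous_R_const|].
    apply (continuous_ext (fun x => x * x)); [intros; simpl; ring|].
    apply (continuous_mult (K := R_AbsRing)); apply continuous_R_id. }
  destruct (continuous_eps _ S (eps / 2) Hg ltac:(lra)) as (d2 & Hd2 & H2).
  replace (S ^ 2 - S ^ 2) with 0 in H2 by ring. rewrite sqrt_0 in H2.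
  set (s := S - Rmin (Rmin (d / 2) (S / 2)) (d2 / 2)).
  assert (M1 : Rmin (Rmin (d / 2) (S / 2)) (d2 / 2) <= d / 2) by (eapply Rle_trans; [apply
      Rmin_l|apply Rmin_l]).
  assert (M2 : Rmin (Rmin (d / 2) (S / 2)) (d2 / 2) <= S / 2) by (eapply Rle_trans; [apply
      Rmin_l|apply Rmin_r]).
  assert (M3 : Rmin (Rmin (d / 2) (S / 2)) (d2 / 2) <= d2 / 2) by apply Rmin_r.
  assert (M0 : 0 < Rmin (Rmin (d / 2) (S / 2)) (d2 / 2)) by (repeat apply Rmin_glb_lt; lra).
  assert (Hs : 0 < s < S) by (unfold s; lra).
  assert (D : Rabs (s - S) <= d / 2 /\ Rabs (s - S) <= d2 / 2).
  { rewrite Rabs_left by lra. unfold s. lra. }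
  assert (C1 := H s ltac:(lra)). assert (C2 := H2 s ltac:(lra)).
  apply Rabs_def2 in C1. apply Rabs_def2 in C2.
  assert (T := Phi_top s Hs). assert (Q := Phi_pos s Hs). rewrite <- Fpoly_Phi in T, Q by auto. fold
      S in T.
  apply Rabs_le. lra.
Qed.

Lemma Fpoly_decr s s' : 0 <= s <= s' -> s' <= A x0 -> Fpoly s' <= Fpoly s.
Proof.
  intros Hs Hs'. assert (HS := Amax_pos). assert (HJ := J_pos).
  assert (B : forall t, 0 <= t <= A x0 -> 0 <= Fpoly t <= J).
  { intros t Ht. destruct (Req_dec t 0) as [->|N0]; [rewrite Fpoly_0, PhiC_0; lra|].
    destruct (Req_dec t (A x0)) as [->|N1]; [rewrite Fpoly_top; lra|].
    rewrite Fpoly_Phi by lra. generalize (Phi_pos t ltac:(lra)) (Phi_bounds t ltac:(lra)).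
    assert (0 <= t * w) by (apply Rmult_le_pos; lra). lra. }
  destruct (Req_dec s 0) as [->|N0].
  { rewrite Fpoly_0, PhiC_0. now apply B. }
  destruct (Req_dec s' (A x0)) as [->|N1].
  { rewrite Fpoly_top. apply B. lra. }
  rewrite !Fpoly_Phi by lra. apply Phi_decr; lra.
Qed.

Notation nu := (/ (2 * PI) * RInt (fun s => Phi_is A xm xp s) 0 (A x0)).

Lemma RInt_Phi : RInt (fun s => ph s) 0 (A x0) = RInt Fpoly 0 (A x0).
Proof.
  assert (HS := Amax_pos). apply RInt_ext. rewrite Rmin_left, Rmax_right by lra.
  intros s Hs. symmetry. now apply Fpoly_Phi.
Qed.

Lemma nu_pos : 0 < nu.
Proof.
  assert (HS := Amax_pos). rewrite RInt_Phi. apply Rmult_lt_0_compat.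
  - apply Rinv_0_lt_compat, two_PI_pos.
  - apply RInt_gt_0; auto.
    + intros s Hs. rewrite Fpoly_Phi by auto. now apply Phi_pos.
    + intros s _. apply Fpoly_continuous.
Qed.

Context (st : nat -> nat -> R)
  (Hst : forall N j, (j < N)%nat ->
     0 < st N j < A x0 /\ Phi_is A xm xp (st N j) = (INR j + / 2) * epsN A N * PI).

Lemma epsN_eq N : (0 < N)%nat -> 0 < epsN A N /\ INR N * epsN A N * PI = J.
Proof.
  intros HN. assert (HP := PI_RGT_0). assert (HJ := J_pos).
  assert (0 < INR N) by now apply lt_0_INR.
  unfold epsN. rewrite int_R_eq. split.
  - apply Rmult_lt_0_compat; auto. apply Rinv_0_lt_compat, Rmult_lt_0_compat; lra.
  - field. lra.
Qed.

Lemma st_pos_distinct N : (0 < N)%nat -> pos_distinct (st N) N.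
Proof.
  intros HN. destruct (epsN_eq N HN) as (He & _). assert (HP := PI_RGT_0). split.
  - intros j Hj. now apply Hst.
  - intros j k Hj Hk Hn E. destruct (Hst N j Hj) as (_ & E1). destruct (Hst N k Hk) as (_ & E2).
    rewrite E, E2 in E1. apply Hn, INR_eq.
    assert (E3 : (INR k - INR j) * (epsN A N * PI) = 0) by lra.
    apply Rmult_integral in E3. destruct E3 as [E3|E3]; [lra|].
    assert (0 < epsN A N * PI) by now apply Rmult_lt_0_compat. lra.
Qed.

(** Divided by [e = eps * PI], Phi takes the values [j + 1/2] at the eigenvalues, so the number of
    eigenvalues above [s] is Phi(s)/e rounded. Integrating the pointwise error over [[0, A x0]]
    gives the bound. *)
Lemma eigenvalue_sum N : (0 < N)%nat ->
  Rabs (2 * PI * nu - epsN A N * PI * rsum (st N) N) <= epsN A N * PI * A x0.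
Proof.
  intros HN. destruct (epsN_eq N HN) as (He & HeJ). assert (HP := PI_RGT_0). assert (HS := Amax_pos).
  set (e := epsN A N * PI). assert (He' : 0 < e) by now apply Rmult_lt_0_compat.
  assert (EI : forall r : R, 2 * PI * (/ (2 * PI) * r) = r) by (intros r; field; lra).
  replace (2 * PI * nu) with (RInt Fpoly 0 (A x0))
    by (rewrite RInt_Phi; symmetry; apply EI).
  set (c := fun s => rsum (fun j => step (st N j) s) N).
  assert (Hc : is_RInt c 0 (A x0) (rsum (st N) N)).
  { apply is_RInt_rsum. intros j Hj. apply is_RInt_step. generalize (Hst N j Hj). lra. }
  assert (HF : is_RInt Fpoly 0 (A x0) (RInt Fpoly 0 (A x0))).
  { apply (RInt_correct (V := R_CompleteNormedModule)), ex_RInt_cont, Fpoly_continuous. }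
  assert (HD := is_RInt_minus (V := R_NormedModule) _ _ _ _ _ _ HF
    (is_RInt_scal (V := R_NormedModule) _ _ _ e _ Hc)).
  replace (e * A x0) with ((A x0 - 0) * e) by ring.
  assert (HB : forall s, 0 <= s <= A x0 -> norm (minus (Fpoly s) (scal e (c s))) <= e).
  { intros s Hs. change (Rabs (Fpoly s - e * c s) <= e).
    assert (Hr : 0 <= Fpoly s <= J).
    { split.
      - rewrite <- Fpoly_top. apply Fpoly_decr; lra.
      - rewrite <- PhiC_0, <- Fpoly_0. apply Fpoly_decr; lra. }
    set (t := Fpoly s / e).
    assert (Et : Fpoly s = e * t) by (unfold t; field; lra).
    assert (Ht : 0 <= t) by (apply Rdiv_le_0_compat; lra).
    assert (HtN : t <= INR N).
    { apply Rmult_le_reg_l with e; auto. rewrite <- Et. unfold e. lra. }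
    assert (K : Rabs (t - c s) <= / 2).
    (* Beyond [N] the sequence is continued so that the alternatives of [count_estimate] hold for
       every index; [HtN] permits the count to stop at [N]. *)
    { set (b := fun j => if Compare_dec.lt_dec j N then step (st N j) s else
         if Rle_dec (INR j + / 2) t then 1 else 0).
      replace (c s) with (rsum b N).
      - apply count_estimate; auto. intros j. unfold b. destruct (Compare_dec.lt_dec j N) as [Hj|Hj].
        + destruct (Hst N j Hj) as (S1 & S2).
          assert (EF : Fpoly (st N j) = e * (INR j + / 2)).
          { rewrite Fpoly_Phi, S2 by auto. unfold e. ring. }
          unfold step. destruct (Rlt_dec s (st N j)) as [Hl|Hl]; [left|right]; split; auto.
          * apply Rmult_le_reg_l with e; auto. rewrite <- Et, <- EF. apply Fpoly_decr; lra.
          * apply Rmult_le_reg_l with e; auto. rewrite <- Et, <- EF. apply Fpoly_decr; lra.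
        + destruct (Rle_dec (INR j + / 2) t); [left|right]; split; auto. lra.
      - unfold c. assert (G : forall n, (n <= N)%nat -> rsum b n = rsum (fun j => step (st N j) s) n).
        { induction n as [|n IH]; intros Hn; auto. cbn [rsum]. rewrite IH by lia. f_equal.
          unfold b. destruct (Compare_dec.lt_dec n N); auto. lia. }
        now apply G. }
    rewrite Et. replace (e * t - e * c s) with (e * (t - c s)) by ring.
    rewrite Rabs_mult, (Rabs_right e) by lra.
    assert (e * Rabs (t - c s) <= e * / 2) by (apply Rmult_le_compat_l; lra). lra. }
  exact (norm_RInt_le_const (V := R_NormedModule) _ 0 (A x0) _ e (Rlt_le _ _ HS) HB HD).
Qed.

End Potential.

(** * Norming constants and rescaling *)

Lemma tends_punct_scale (kap : R) (h : C -> C) p l : 0 < kap ->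
  tends (punct (RtoC kap * p)%C) h l -> tends (punct p) (fun z => h (RtoC kap * z)%C) l.
Proof.
  intros Hk H. apply (tends_comp (punct (RtoC kap * p)%C) (fun z => (RtoC kap * z)%C) h); auto.
  intros P (d & Hd & HP). exists (d / kap). split; [now apply Rdiv_lt_0_compat|].
  assert (K0 : RtoC kap <> RtoC 0) by (intros E; apply RtoC_inj in E; lra).
  assert (E : forall z, (RtoC kap * z - RtoC kap * p)%C = (RtoC kap * (z - p))%C)
    by (intros z; ring).
  intros z _ Hz Hzd. apply HP; auto.
  - intros Ez. apply (Cmult_neq_0 _ _ K0 (Cminus_neq_0 _ _ Hz)). rewrite <- E, Ez. ring.
  - rewrite E, Cmod_mult, Cmod_R, Rabs_right by lra.
    apply Rmult_lt_compat_l with (r := kap) in Hzd; auto.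
    replace (kap * (d / kap)) with d in Hzd by (field; lra). exact Hzd.
Qed.

Lemma tends_inf_scale (kap : R) (h : C -> C) l : 0 < kap ->
  tends nbinf h l -> tends nbinf (fun z => h (RtoC kap * z)%C) l.
Proof.
  intros Hk H. apply (tends_comp nbinf (fun z => (RtoC kap * z)%C) h); auto.
  intros P (r & HP). exists (Rabs r / kap). intros z Hz. apply HP.
  rewrite Cmod_mult, Cmod_R, (Rabs_right kap) by lra.
  apply Rmult_lt_compat_l with (r := kap) in Hz; auto.
  replace (kap * (Rabs r / kap)) with (Rabs r) in Hz by (field; lra).
  generalize (Rle_abs r). lra.
Qed.

Section Scaling.
Context (kap : R) (Hk : 0 < kap) (s : nat -> R) (N : nat).

Lemma pole_scale j : pole (fun j => kap * s j)%R j = (RtoC kap * pole s j)%C.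
Proof. unfold pole. rewrite RtoC_mult. ring. Qed.

Lemma kap_inj (a b : C) : (RtoC kap * a)%C = (RtoC kap * b)%C -> a = b.
Proof.
  assert (K0 : RtoC kap <> RtoC 0) by (intros E; apply RtoC_inj in E; lra).
  intros E. replace a with (/ RtoC kap * (RtoC kap * a))%C by (field; auto).
  rewrite E. field. auto.
Qed.

Lemma off_low_scale z : off_low s N z -> off_low (fun j => kap * s j)%R N (RtoC kap * z)%C.
Proof.
  intros H j Hj E. apply (H j Hj), kap_inj. rewrite E, pole_scale. ring.
Qed.

Lemma off_poles_scale z : off_poles s N z -> off_poles (fun j => kap * s j)%R N (RtoC kap * z)%C.
Proof.
  intros H j Hj. destruct (H j Hj). rewrite pole_scale.
  split; intros E; [apply H0|apply H1]; apply kap_inj; rewrite E; ring.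
Qed.

Lemma pos_distinct_scale : pos_distinct s N -> pos_distinct (fun j => kap * s j)%R N.
Proof.
  intros (H1 & H2). split.
  - intros j Hj. apply Rmult_lt_0_compat; auto.
  - intros j k Hj Hk' Hn E. apply (H2 j k Hj Hk' Hn). apply Rmult_eq_reg_l with kap; auto. lra.
Qed.

Lemma bl_scale z : off_low s N z -> bl (fun j => kap * s j)%R N (RtoC kap * z)%C = bl s N z.
Proof.
  intros H. apply cprod_ext. intros j Hj. rewrite pole_scale.
  assert (A := Cplus_neq_0 _ _ (H j Hj)).
  assert (K0 : RtoC kap <> RtoC 0) by (intros E; apply RtoC_inj in E; lra).
  replace (RtoC kap * z + RtoC kap * pole s j)%C with
    (RtoC kap * (z + pole s j))%C by ring.
  field. auto.
Qed.

(* rho is the residue of 1/bl, hence homogeneous of degree one. *)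
Lemma rho_scale n : pos_distinct s N -> (n < N)%nat ->
  rho (fun j => kap * s j)%R N n = (RtoC kap * rho s N n)%C.
Proof.
  intros Hs Hn.
  apply (tends_unique (punct (pole s n)) (fun z => (RtoC kap * ((z - pole s n) / bl s N z))%C)).
  - assert (H := rho_limit _ N n (pos_distinct_scale Hs) Hn). rewrite pole_scale in H.
    apply tends_punct_scale in H; auto.
    apply (tends_ext_loc (F := punct (pole s n)) (fun z => ((RtoC kap * z - RtoC kap * pole s n) / bl
        (fun j => kap * s j)%R N (RtoC kap * z)%C)%C)); auto.
    generalize (off_poles_pnb s N (pole s n)). apply filter_imp. intros z Hz.
    rewrite bl_scale by now apply off_poles_low. unfold Cdiv. ring.
  - apply tends_mult; [apply (tends_const (F := punct (pole s n)))|now apply rho_limit].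
Qed.

(** Besides the dilation, the solution is conjugated by a constant diagonal matrix: [f] acquires the
    unimodular [d] and the residue constants acquire [Cconj d]. This splits off the sign i(-1)^(K+N)
    before the comparison. The division by [kap] is the change of a residue under dilation. *)
Lemma soldata_scale c f g d : (d * Cconj d)%C = RtoC 1 ->
  soldata (fun j => kap * s j)%R N c f g ->
  soldata s N (fun j => (c j * Cconj d / RtoC kap)%C)
    (fun z => (d * f (RtoC kap * z)%C)%C) (fun z => g (RtoC kap * z)%C).
Proof.
  intros Hd [hf hg hfi hgi hdet hrg hrf].
  assert (K0 : RtoC kap <> RtoC 0) by (intros E; apply RtoC_inj in E; lra).
  set (F := fun z => (d * f (RtoC kap * z)%C)%C). set (G := fun z => g (RtoC kap * z)%C).
  assert (HG : forall z, sch G z = sch g (RtoC kap * z)%C).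
  { intros z. unfold sch, G. now rewrite Cmult_conj, RtoC_conj. }
  assert (HF : forall z, sch F z = (Cconj d * sch f (RtoC kap * z)%C)%C).
  { intros z. unfold sch, F. now rewrite !Cmult_conj, RtoC_conj. }
  assert (Hc : forall h z, cdiff h (RtoC kap * z)%C -> cdiff (fun z => h (RtoC kap * z)%C) z).
  { intros h z. apply (cdiff_comp (fun z => (RtoC kap * z)%C) h).
    apply cdiff_mult; [apply cdiff_const|apply cdiff_id]. }
  constructor.
  - intros z Hz. apply cdiff_mult; [apply cdiff_const|]. now apply Hc, hf, off_low_scale.
  - intros z Hz. now apply Hc, hg, off_low_scale.
  - apply tends_eq with (d * RtoC 0)%C; [|ring].
    apply tends_mult; [apply tends_const|now apply tends_inf_scale].
  - now apply tends_inf_scale.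
  - intros z Hz. rewrite HF, HG. unfold F, G.
    rewrite <- (hdet (RtoC kap * z)%C) by now apply off_poles_scale.
    replace (d * f (RtoC kap * z)%C * (Cconj d * sch f (RtoC kap * z)%C))%C
      with (d * Cconj d * (f (RtoC kap * z)%C * sch f (RtoC kap * z)%C))%C by ring.
    rewrite Hd. ring.
  - intros j Hj. assert (H := hrg j Hj). rewrite pole_scale in H. apply tends_punct_scale in H; auto.
    apply (tends_ext (F := punct (pole s j)) (fun z => (/ RtoC kap * ((RtoC kap * z - RtoC kap * pole
        s j) * sch g (RtoC kap * z)%C))%C)).
    + intros z. rewrite HG. field. auto.
    + eapply tends_eq; [apply tends_mult; [apply (tends_const (F := punct (pole s j)))|exact H]|].
      unfold F. set (fv := f (RtoC kap * pole s j)%C).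
      replace (c j * Cconj d / RtoC kap * (d * fv))%C
        with (d * Cconj d * (c j * fv / RtoC kap))%C by (field; auto).
      rewrite Hd. field. auto.
  - intros j Hj. assert (H := hrf j Hj). rewrite pole_scale in H. apply tends_punct_scale in H; auto.
    apply (tends_ext (F := punct (pole s j)) (fun z => (Cconj d * / RtoC kap * ((RtoC kap * z - RtoC
        kap * pole s j) * sch f (RtoC kap * z)%C))%C)).
    + intros z. rewrite HF. field. auto.
    + eapply tends_eq; [apply tends_mult; [apply (tends_const (F := punct (pole s j)))|exact H]|].
      unfold G. field. auto.
Qed.

End Scaling.

(** * The phase at the base point and the signs of the norming constants *)

Lemma csum_shift f n : csum f (S n) = ((f 0%nat) + csum (fun k => f (S k)) n)%C.
Proof.
  induction n as [|n IH]; [unfold csum; simpl; ring|].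
  rewrite csum_S, IH, csum_S. ring.
Qed.

Lemma csum_pad f n m : (n <= m)%nat -> (forall k, (n <= k < m)%nat -> f k = RtoC 0) ->
  csum f m = csum f n.
Proof.
  intros Hnm. induction Hnm as [|m Hnm IH]; intros H; auto.
  rewrite csum_S, H, IH by (intros; try apply H; lia). ring.
Qed.

Lemma csum_even_odd f a : csum f (2 * a) =
  (csum (fun q => f (2 * q)%nat) a + csum (fun q => f (2 * q + 1)%nat) a)%C.
Proof.
  induction a as [|a IH]; [unfold csum; simpl; ring|].
  replace (2 * S a)%nat with (S (S (2 * a))) by lia. rewrite !csum_S, IH.
  replace (S (2 * a)) with (2 * a + 1)%nat by lia. ring.
Qed.

Lemma csum_scal c f n : csum (fun k => (c * f k)%C) n = (c * csum f n)%C.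
Proof.
  induction n as [|n IH]; [unfold csum; simpl; ring|]. rewrite !csum_S, IH. ring.
Qed.

Lemma csum_plus f g n : csum (fun k => (f k + g k)%C) n = (csum f n + csum g n)%C.
Proof.
  induction n as [|n IH]; [unfold csum; simpl; ring|]. rewrite !csum_S, IH. ring.
Qed.

Lemma Qphase_plus M z x x' t t' :
  Qphase M z (x + x') (fun m => t m + t' m) = (Qphase M z x t + Qphase M z x' t')%C.
Proof.
  unfold Qphase.
  rewrite (csum_ext (fun k => (cpow z (k + 2) * RtoC (t (k + 2)%nat + t' (k + 2)%nat))%C)
    (fun k => (cpow z (k + 2) * RtoC (t (k + 2)%nat) + cpow z (k + 2) * RtoC (t' (k + 2)%nat))%C)).
  - rewrite csum_plus, RtoC_plus. ring.
  - intros j _. rewrite RtoC_plus. ring.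
Qed.

Lemma Qphase_ext M z x t t' : (forall m, t m = t' m) -> Qphase M z x t = Qphase M z x t'.
Proof. intros H. unfold Qphase. f_equal. apply csum_ext. intros j _. now rewrite H. Qed.

Lemma cpow_scale (kap : R) z n : cpow (RtoC kap * z)%C n = (RtoC (kap ^ n) * cpow z n)%C.
Proof.
  induction n as [|n IH]; simpl; [ring|]. rewrite IH, RtoC_mult. ring.
Qed.

(* The scaling of the statement: with kap = eps/nu the increments of 2Q/eps become 2Q in the
   rescaled spectral variable. *)
Lemma Qphase_scaled M z eps nu X T n : 0 < nu ->
  Qphase M z (eps ^ 2 / nu * X) (evec n (eps ^ (n + 1) / nu ^ n * T)) =
  (RtoC eps * Qphase M (RtoC (eps / nu) * z)%C X (evec n T))%C.
Proof.
  intros Hnu. unfold Qphase. rewrite Cmult_plus_distr_l. f_equal.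
  - replace (eps ^ 2 / nu * X) with (eps * (eps / nu) * X) by (field; lra).
    rewrite !RtoC_mult. ring.
  - rewrite <- csum_scal. apply csum_ext. intros k _. unfold evec.
    destruct (Nat.eqb_spec (k + 2) n) as [E|E]; [|ring].
    rewrite cpow_scale, E.
    replace (eps ^ (n + 1) / nu ^ n * T) with (eps * (eps / nu) ^ n * T).
    + rewrite !RtoC_mult. ring.
    + rewrite Nat.add_1_r. simpl. unfold Rdiv. rewrite Rpow_mult_distr, pow_inv. ring.
Qed.

(** The sum is split by parity: even times rebuild Phi without its constant term, odd times together
    with [x] rebuild Xi. The truncation by [cutP] allows both to be summed to the common length
    [max P Q], whatever the parity of M. *)
Lemma Qphase_circ P Q PhiC XiC K z : (1 <= Q)%nat ->
  (RtoC (-2) * Qphase (Nat.max (2 * P) (2 * Q - 1)) z (xcirc XiC) (tcirc P Q PhiC XiC K))%C =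
  ((csum (fun q => (RtoC (XiC (S q)) * cpow z (2 * S q - 1))%C) Q) + RtoC (2 * IZR K + 1) * ((csum
      (fun p => (RtoC (PhiC p) * cpow z (2 * p))%C) (S P)) - RtoC (PhiC 0%nat)))%C.
Proof.
  intros HQ. set (M := Nat.max (2 * P) (2 * Q - 1)).
  (* Shifted index: [F k] carries the power [k + 1], so even [k] belong to Xi and odd [k] to Phi,
     and [k = 0] is the [x] term. *)
  set (F := fun k => (cpow z (S k) * RtoC (tcirc P Q PhiC XiC K (S k)))%C).
  assert (E1 : Qphase M z (xcirc XiC) (tcirc P Q PhiC XiC K) = csum F M).
  { replace M with (S (M - 1)) at 2 by (unfold M; lia). rewrite csum_shift. unfold Qphase. f_equal.
    - unfold F, tcirc, xcirc, cutP. simpl. destruct Q as [|Q']; [lia|]. simpl. ring.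
    - apply csum_ext. intros k _. unfold F. now replace (k + 2)%nat with (S (S k)) by lia. }
  set (a := Nat.max P Q).
  assert (Codd : forall q, (RtoC (-2) * F (2 * q)%nat)%C = (RtoC (cutP Q XiC (S q)) * cpow z (2 * S q
      - 1))%C).
  { intros q. unfold F, tcirc.
    replace (Nat.even (S (2 * q))) with false by (rewrite Nat.even_succ, Nat.odd_mul; reflexivity).
    replace ((S (2 * q) + 1) / 2)%nat with (S q).
    - replace (2 * S q - 1)%nat with (S (2 * q)) by lia.
      replace (- / 2 * cutP Q XiC (S q)) with (/ -2 * cutP Q XiC (S q)) by field.
      rewrite RtoC_mult, RtoC_inv by lra. field.
    - replace (S (2 * q) + 1)%nat with (S q * 2)%nat by lia. now rewrite Nat.div_mul. }
  assert (Ceven : forall q, (RtoC (-2) * F (2 * q + 1)%nat)%C =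
     (RtoC (2 * IZR K + 1) * (RtoC (cutP P PhiC (S q)) * cpow z (2 * S q)))%C).
  { intros q. unfold F, tcirc. replace (S (2 * q + 1)) with (2 * S q)%nat by lia.
    replace (Nat.even (2 * S q)) with true by (now rewrite Nat.even_mul).
    replace (2 * S q / 2)%nat with (S q) by (rewrite Nat.mul_comm; now rewrite Nat.div_mul).
    replace (- / 2 * (2 * IZR K + 1) * cutP P PhiC (S q)) with
      (/ -2 * ((2 * IZR K + 1) * cutP P PhiC (S q))) by field.
    rewrite RtoC_mult, RtoC_inv, RtoC_mult by lra. field. }
  assert (N2 : RtoC (-2) <> RtoC 0) by (intros E; apply RtoC_inj in E; lra).
  assert (Z2 : forall w, (RtoC (-2) * w)%C = RtoC 0 -> w = RtoC 0).
  { intros w E. replace w with (/ RtoC (-2) * (RtoC (-2) * w))%C by (field; auto).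
    rewrite E. ring. }
  assert (Fz : forall k, (M <= k)%nat -> F k = RtoC 0).
  { intros k Hk. apply Z2. destruct (Nat.Even_or_Odd k) as [(q & ->)|(q & ->)].
    - rewrite Codd. unfold cutP. replace (S q <=? Q)%nat with false; [ring|].
      symmetry. apply Nat.leb_gt. unfold M in Hk. lia.
    - rewrite Ceven. unfold cutP. replace (S q <=? P)%nat with false; [ring|].
      symmetry. apply Nat.leb_gt. unfold M in Hk. lia. }
  rewrite E1, <- (csum_pad F M (2 * a)) by (try (intros; apply Fz); unfold M, a in *; lia).
  rewrite csum_even_odd, Cmult_plus_distr_l, <- !csum_scal. f_equal.
  - rewrite (csum_ext _ _ a (fun q _ => Codd q)).
    rewrite (csum_pad _ Q a) by (try (unfold a; lia); intros k Hk; unfold cutP;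
      replace (S k <=? Q)%nat with false by (symmetry; apply Nat.leb_gt; lia); ring).
    apply csum_ext. intros q Hq. unfold cutP.
    now replace (S q <=? Q)%nat with true by (symmetry; apply Nat.leb_le; lia).
  - rewrite (csum_ext _ _ a (fun q _ => Ceven q)), csum_scal. f_equal.
    rewrite csum_shift. simpl (2 * 0)%nat. simpl (cpow z 0).
    rewrite (csum_pad _ P a) by (try (unfold a; lia); intros k Hk; unfold cutP;
      replace (S k <=? P)%nat with false by (symmetry; apply Nat.leb_gt; lia); ring).
    rewrite (csum_ext _ (fun k => (RtoC (PhiC (S k)) * cpow z (2 * S k))%C)).
    + ring.
    + intros q Hq. unfold cutP.
      now replace (S q <=? P)%nat with true by (symmetry; apply Nat.leb_le; lia).
Qed.

Lemma cexp_nat_PI n : cexp (0, INR n * PI)%R = RtoC ((-1) ^ n).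
Proof.
  induction n as [|n IH].
  - simpl INR. rewrite Rmult_0_l. exact cexp_0.
  - rewrite S_INR. replace (0, (INR n + 1) * PI)%R with ((0, INR n * PI)%R + (0, PI)%R)%C.
    + rewrite cexp_plus, IH. unfold cexp; simpl. rewrite exp_0, cos_PI, sin_PI.
      apply injective_projections; simpl; ring.
    + apply injective_projections; simpl; ring.
Qed.

Lemma cexp_IZR_PI m : cexp (0, IZR m * PI)%R = RtoC (powerRZ (-1) m).
Proof.
  destruct m as [|p|p].
  - rewrite Rmult_0_l. exact cexp_0.
  - simpl powerRZ. rewrite <- cexp_nat_PI. now rewrite INR_IPR.
  - simpl powerRZ. rewrite RtoC_inv, <- cexp_nat_PI, <- cexp_opp by (apply pow_nonzero; lra).
    f_equal. apply injective_projections; simpl; [ring|].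
    change (IZR (Z.neg p)) with (- IPR p). rewrite INR_IPR. ring.
Qed.

Lemma powerRZ_m1_even l : powerRZ (-1) (2 * l) = 1.
Proof.
  replace (2 * l)%Z with (l + l)%Z by lia. rewrite powerRZ_add, <- powerRZ_mult by lra.
  replace (-1 * -1) with 1 by ring. apply powerRZ_R1.
Qed.

Lemma cexp_half_PI : cexp (0, - (PI / 2))%R = (- Ci)%C.
Proof.
  unfold cexp; simpl. rewrite exp_0, cos_neg, sin_neg, cos_PI2, sin_PI2.
  apply injective_projections; simpl; ring.
Qed.

(* The alternating signs of the norming constants are absorbed by the phase
   exp(-i(2K+1)(Phi(i s_j) - Phi(0))/eps). *)
Lemma sign_identity (j N : nat) (K : Z) :
  (RtoC ((-1) ^ (j + 1)) * (cexp (0, - ((2 * IZR K + 1) * ((INR j + / 2) * PI - INR N * PI)))%R))%C =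
  (Ci * RtoC (powerRZ (-1) (K + Z.of_nat N)))%C.
Proof.
  (* The angle equals [m * PI - PI / 2]. Together with the sign (-1)^(j+1) the exponent is
     [K + N + 1 + 2 * l], so [l] drops out by parity. *)
  set (l := (- K * (Z.of_nat j - Z.of_nat N) - K)%Z).
  set (m := (K + Z.of_nat N + 2 * l - Z.of_nat j)%Z).
  replace (0, - ((2 * IZR K + 1) * ((INR j + / 2) * PI - INR N * PI)))%R
    with ((0, IZR m * PI)%R + (0, - (PI / 2))%R)%C.
  - rewrite cexp_plus, cexp_IZR_PI, cexp_half_PI.
    rewrite pow_powerRZ.
    assert (E : powerRZ (-1) (Z.of_nat (j + 1)) * powerRZ (-1) m = - powerRZ (-1) (K + Z.of_nat N)).
    { rewrite <- powerRZ_add by lra.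
      replace (Z.of_nat (j + 1) + m)%Z with ((K + Z.of_nat N) + (1 + 2 * l))%Z by (unfold m; lia).
      rewrite (powerRZ_add _ (K + Z.of_nat N) (1 + 2 * l)), (powerRZ_add _ 1 (2 * l)),
          powerRZ_m1_even by lra. simpl (powerRZ (-1) 1). ring. }
    rewrite Cmult_assoc, <- RtoC_mult, E, RtoC_opp. ring.
  - apply injective_projections; simpl; [ring|].
    unfold m, l. rewrite !minus_IZR, !plus_IZR, !mult_IZR, !minus_IZR, !mult_IZR, opp_IZR,
        !minus_IZR, <- !INR_IZR_INZ.
    field.
Qed.

Lemma rsum_const c n : rsum (fun _ => c) n = INR n * c.
Proof.
  induction n as [|n IH]; [simpl; ring|]. rewrite S_INR. cbn [rsum]. rewrite IH. ring.
Qed.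

(** The right-hand side is the form in which [soldata_scale] delivers the residue constants for
    [d = sg]. The shift [t0] cancels between [tcirc_n] and [evec]. *)
Lemma norming_constant (A : R -> R) (xm xp : R -> R) (P Q : nat) (PhiC XiC : nat -> R) (K : Z)
  (n N j : nat) (t0 X T eps nu : R) (s : nat -> R) :
  (1 <= Q)%nat -> 0 < nu -> 0 < eps -> pos_distinct s N -> (j < N)%nat ->
  RtoC (Phi_is A xm xp (s j)) =
    csum (fun p => (RtoC (PhiC p) * cpow (Ci * RtoC (s j))%C (2 * p))%C) (S P) ->
  RtoC (Xi_is A xm xp (s j)) =
    (Ci * (csum (fun q => (RtoC (XiC (S q)) * cpow (Ci * RtoC (s j))%C (2 * S q - 1))%C) Q))%C ->
  Phi_is A xm xp (s j) = (INR j + / 2) * eps * PI -> PhiC 0%nat = INR N * eps * PI ->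
  let Mdeg := Nat.max (2 * P) (2 * Q - 1) in
  let kap := eps / nu in
  let sg := (Ci * RtoC (powerRZ (-1) (K + Z.of_nat N)))%C in
  cnorm Mdeg N eps (Xi_is A xm xp) s (xcirc XiC + eps ^ 2 / nu * X)
    (fun m => tcirc_n P Q PhiC XiC K n t0 m + evec n (t0 + eps ^ (n + 1) / nu ^ n * T) m) j =
  (- (omQ Mdeg X (evec n T) (pole (fun j => kap * s j)%R j) * rho (fun j => kap * s j)%R N j) * Cconj
      sg / RtoC kap)%C.
Proof.
  intros HQ Hnu He Hs Hj HPhi HXi HPj HP0 Mdeg kap sg.
  assert (Hk : 0 < kap) by now apply Rdiv_lt_0_compat.
  assert (K0 : RtoC kap <> RtoC 0) by (intros E; apply RtoC_inj in E; lra).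
  assert (E0 : RtoC eps <> RtoC 0) by (intros E; apply RtoC_inj in E; lra).
  rewrite rho_scale, pole_scale by auto.
  unfold cnorm. fold (pole s j).
  change (cprod _ N / cprod_ne _ N j)%C with (rho s N j).
  set (p := pole s j) in *.
  rewrite (Qphase_ext _ _ _ _ (fun m => tcirc P Q PhiC XiC K m + evec n (eps ^ (n + 1) / nu ^ n * T)
      m)).
  2: { intros m. unfold tcirc_n, evec. destruct (m =? n)%nat; ring. }
  rewrite Qphase_plus, Qphase_scaled by auto. fold kap.
  assert (HQ1 := Qphase_circ P Q PhiC XiC K p HQ). fold Mdeg in HQ1.
  set (Q1 := Qphase Mdeg p (xcirc XiC) (tcirc P Q PhiC XiC K)) in *.
  set (Q2 := Qphase Mdeg (RtoC kap * p)%C X (evec n T)).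
  change (Ci * RtoC (s j))%C with p in HPhi, HXi. rewrite <- HPhi in HQ1.
  set (S1 := csum (fun q => (RtoC (XiC (S q)) * cpow p (2 * S q - 1))%C) Q) in *.
  set (xi := Xi_is A xm xp (s j)) in *.
  rewrite HPj, HP0, <- RtoC_minus, <- RtoC_mult in HQ1.
  set (a := (INR j + / 2) * PI - INR N * PI).
  (* A real part from Xi, a pure phase from Phi, and the part depending on (X, T), which is already
     expressed in the rescaled variable. *)
  assert (E1 : (RtoC 2 * (Ci * (Q1 + RtoC eps * Q2)) / RtoC eps)%C =
    (RtoC (- (xi / eps)) + (0, - ((2 * IZR K + 1) * a))%R + RtoC 2 * (Ci * Q2))%C).
  { transitivity (- Ci * (RtoC (-2) * Q1) / RtoC eps + RtoC 2 * (Ci * Q2))%C.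
    - replace (RtoC (-2)) with (- RtoC 2)%C by (apply injective_projections; simpl; ring).
      field. auto.
    - f_equal. rewrite HQ1.
      replace (- Ci * (S1 + (RtoC ((2 * IZR K + 1) * ((INR j + / 2) * eps * PI - INR N * eps * PI)))))%C
        with ((RtoC (- (xi / eps)) + (0, - ((2 * IZR K + 1) * a))%R) * RtoC eps)%C.
      + field. auto.
      + replace (- Ci * (S1 + (RtoC ((2 * IZR K + 1) * ((INR j + / 2) * eps * PI - INR N * eps *
          PI)))))%C
          with (- (Ci * S1) - Ci * (RtoC ((2 * IZR K + 1) * ((INR j + / 2) * eps * PI - INR N * eps *
              PI))))%C by ring.
        rewrite <- HXi. apply injective_projections; simpl; unfold a; field; lra. }
  rewrite E1, !cexp_plus.
  assert (E2 : cexp (RtoC (- (xi / eps))) = RtoC (/ exp (xi / eps))).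
  { unfold cexp; simpl. rewrite cos_0, sin_0, exp_Ropp. apply injective_projections; simpl; ring. }
  fold (omQ Mdeg X (evec n T) (RtoC kap * p)%C). unfold Q2.
  fold (omQ Mdeg X (evec n T) (RtoC kap * p)%C).
  set (om := omQ Mdeg X (evec n T) (RtoC kap * p)%C).
  rewrite E2.
  assert (Hsg : Cconj sg = (- sg)%C).
  { unfold sg. rewrite Cmult_conj, Cconj_Ci, RtoC_conj. ring. }
  rewrite Hsg.
  transitivity (RtoC ((-1) ^ (j + 1)) * (cexp (0, - ((2 * IZR K + 1) * a))%R) * RtoC (exp (xi / eps)
      * / exp (xi / eps)) * (rho s N j * om))%C.
  - rewrite !RtoC_mult. ring.
  - rewrite Rinv_r by (apply Rgt_not_eq, exp_pos). unfold a. rewrite sign_identity. fold sg.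
    field. auto.
Qed.

(** * Uniform estimate for the rescaled ensemble *)

Lemma omQ_neq_0 M X T z : omQ M X T z <> RtoC 0.
Proof. apply cexp_neq_0. Qed.

Theorem theorem4
  (A u : R -> R) (Xm Xp c0 x0 : R) (xm xp : R -> R)
  (P Q : nat) (PhiC XiC : nat -> R) (K : Z) (n : nat) (t0 : R)
  (st : nat -> nat -> R)
  (* semicircular Klaus--Shaw potential *)
  (HX : Xm < Xp)
  (HA0 : forall x, 0 <= A x)
  (Hout : forall x, x < Xm \/ Xp < x -> A x = 0)
  (Hform : forall x, Xm <= x <= Xp -> A x = u x * sqrt ((Xp - x) * (x - Xm)))
  (Hc0 : 0 < c0)
  (Hu : forall x, Xm <= x <= Xp -> c0 <= u x)
  (Hanal : analytic_near_interval u Xm Xp)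
  (HL1 : ex_RInt_gen (fun x => Rabs (A x)) (Rbar_locally m_infty) (Rbar_locally p_infty))
  (HC2 : forall x, x <> Xm -> x <> Xp ->
           ex_derive_n A 2 x /\ continuous (Derive_n A 2) x)
  (Hmax : forall x, x <> x0 -> A x < A x0)
  (Hdd : Derive_n A 2 x0 < 0)
  (Hxpm : forall s, 0 < s < A x0 ->
            xm s < xp s /\ (forall x, A x = s <-> (x = xm s \/ x = xp s)))
  (* Phi and Xi are polynomials of exact degrees 2P and 2Q-1 *)
  (HPhi : forall s, 0 < s < A x0 ->
     RtoC (Phi_is A xm xp s) =
     csum (fun p => Cmult (RtoC (PhiC p)) (cpow (Cmult Ci (RtoC s)) (2 * p))) (S P))
  (HXi : forall s, 0 < s < A x0 ->
     RtoC (Xi_is A xm xp s) =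
     Cmult Ci (csum (fun q => Cmult (RtoC (XiC (S q))) (cpow (Cmult Ci (RtoC s)) (2 * S q - 1))) Q))
  (HPdeg : PhiC P <> 0)
  (HQ1 : (1 <= Q)%nat)
  (HQdeg : XiC Q <> 0)
  (* flow index *)
  (Hn : (2 <= n <= Nat.max (2 * P) (2 * Q - 1))%nat)
  (* the eigenvalues i s~_n of the N-th ensemble *)
  (Hst : forall N j, (j < N)%nat ->
     0 < st N j < A x0 /\ Phi_is A xm xp (st N j) = (INR j + / 2) * epsN A N * PI) :
  let Mdeg := Nat.max (2 * P) (2 * Q - 1) in
  let nu := / (2 * PI) * RInt (fun s => Phi_is A xm xp s) 0 (A x0) in
  forall B, 0 < B -> exists C0 : R, exists N0 : nat, forall N : nat, (N0 <= N)%nat ->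
  forall X T : R, Rabs X <= B -> Rabs T <= B ->
    let eps := epsN A N in
    Cmod (Cminus
      (psi_flow A xm xp Mdeg N (st N) P Q PhiC XiC K n t0
         (xcirc XiC + eps ^ 2 / nu * X) (t0 + eps ^ (n + 1) / nu ^ n * T))
      (Cmult (Cmult Ci (RtoC (powerRZ (-1) (K + Z.of_nat N) * (nu / eps))))
             (Psi Mdeg X (evec n T)))) <= C0.
Proof.
  intros Mdeg nu B HB.
  assert (HP := PI_RGT_0).
  assert (HS := Amax_pos A u Xm Xp c0 x0 HX Hform Hc0 Hu Hmax).
  assert (HJ := J_pos A u Xm Xp c0 HX Hout Hform Hc0 Hu Hanal).
  assert (Hnu : 0 < nu)
    by exact (nu_pos A u Xm Xp c0 x0 HX Hout Hform Hc0 Hu Hmax Hanal xm xp Hxpm P PhiC HPhi).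
  assert (HP0 := PhiC_0 A u Xm Xp c0 x0 HX Hout Hform Hc0 Hu Hmax Hanal xm xp Hxpm HA0 P PhiC HPhi).
  assert (Heps := epsN_eq A u Xm Xp c0 HX Hout Hform Hc0 Hu Hanal).
  assert (Hpd := st_pos_distinct A u Xm Xp c0 x0 HX Hout Hform Hc0 Hu Hanal xm xp st Hst).
  assert (Hsum := eigenvalue_sum A u Xm Xp c0 x0 HX Hout Hform Hc0 Hu Hmax Hanal xm xp
    Hxpm HA0 P PhiC HPhi st Hst).
  fold nu in Hsum.
  set (J := RInt A Xm Xp : R) in *. set (S := A x0) in *.
  destruct (Qphase_bound Mdeg B HB) as (KB & HKB).
  set (Om := exp (2 * KB)).
  (* Every rescaled eigenvalue is at most [kap * S], so the defect is at most
     [INR N * (kap * S) ^ 2 + kap * S]; with [INR N * eps * PI = J] this equals [eps * D]. *)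
  set (D := J / PI * (S / nu) ^ 2 + S / nu).
  (* Beyond this index [8 * kap * S <= 1], which [small] requires both for the single eigenvalues
     and for their sum. *)
  destruct (INR_unbounded (8 * J * S / (PI * nu))) as (N1 & HN1).
  (* The final error is [2 / kap] times [Kcmp Om * (eps * D)], and [eps / kap = nu]. The successor
     guarantees a nonempty ensemble. *)
  exists (2 * nu * (Kcmp Om * D)), (Datatypes.S N1). intros N HN X T HXB HTB eps.
  assert (HNpos : (0 < N)%nat) by lia.
  destruct (Heps N HNpos) as (He & HeJ). fold eps in He, HeJ.
  specialize (Hsum N HNpos). fold eps in Hsum. specialize (Hpd N HNpos).
  set (kap := eps / nu). assert (Hk : 0 < kap) by now apply Rdiv_lt_0_compat.
  assert (HNR : 8 * J * S / (PI * nu) <= INR N).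
  { left. eapply Rlt_le_trans; [exact HN1|]. apply le_INR. lia. }
  assert (HNR0 : 0 < INR N) by now apply lt_0_INR.
  assert (Hsm8 : kap * S <= / 8).
  { assert (H1 : 8 * J * S <= INR N * (PI * nu)).
    { apply Rmult_le_compat_r with (r := PI * nu) in HNR; [|apply Rmult_le_pos; lra].
      unfold Rdiv in HNR. rewrite Rmult_assoc, Rinv_l, Rmult_1_r in HNR; auto.
      apply Rgt_not_eq, Rmult_lt_0_compat; lra. }
    rewrite <- HeJ in H1.
    assert (H2 : 8 * eps * S <= nu).
    { apply Rmult_le_reg_l with (INR N * PI); [now apply Rmult_lt_0_compat|]. lra. }
    unfold kap. apply Rmult_le_reg_r with nu; auto.
    replace (eps / nu * S * nu) with (eps * S) by (field; lra). lra. }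
  set (sig := fun j => kap * st N j).
  assert (Hsig : forall j, (j < N)%nat -> 0 < sig j <= kap * S).
  { intros j Hj. destruct (Hst N j Hj) as (H1 & _). unfold sig. fold S in H1.
    split; [apply Rmult_lt_0_compat; lra|]. apply Rmult_le_compat_l; lra. }
  (* Dividing [Hsum] by [PI * nu] turns the target [2 * PI * nu] into 2; this normalization of the
     sum is what singles out the scale [nu]. *)
  assert (Hs2 : Rabs (rsum sig N - 2) <= kap * S).
  { unfold sig. rewrite rsum_scal.
    replace (kap * rsum (st N) N - 2) with
      (- (/ (PI * nu) * (2 * PI * nu - eps * PI * rsum (st N) N))) by (unfold kap; field; lra).
    assert (Hpn : 0 < / (PI * nu)) by (apply Rinv_0_lt_compat, Rmult_lt_0_compat; lra).
    rewrite Rabs_Ropp, Rabs_mult, (Rabs_right (/ (PI * nu))) by lra.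
    replace (kap * S) with (/ (PI * nu) * (eps * PI * S)) by (unfold kap; field; lra).
    apply Rmult_le_compat_l; lra. }
  assert (Hsmall : small sig N).
  { split; [now apply pos_distinct_scale|]. split; [|lra].
    intros j Hj. generalize (Hsig j Hj). lra. }
  assert (Hdef : defect sig N <= eps * D).
  { unfold defect. apply Rle_trans with (INR N * (kap * S) ^ 2 + kap * S).
    - apply Rplus_le_compat; auto. rewrite <- rsum_const. apply rsum_le. intros j Hj.
      apply pow_incr. generalize (Hsig j Hj). lra.
    - right. unfold D. rewrite <- HeJ. unfold kap. field. lra. }
  set (om := omQ Mdeg X (evec n T)).
  (* [om] varies with (X, T), while [Om] was fixed before them and depends on [B] alone. *)
  assert (Hom : phase om Om).
  { apply phase_omQ. intros z Hz. apply HKB; auto. intros m. unfold evec.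
    destruct (m =? n)%nat; auto. rewrite Rabs_R0. lra. }
  destruct (sol_exists om sig N Hsmall) as (f & g & L & HS1).
  destruct (limdata_exists om Om Hom) as (f' & g' & l & k & L' & HL').
  assert (HPsi : Psi Mdeg X (evec n T) = (RtoC 2 * (Ci * L'))%C).
  { apply (Psi_eq Mdeg X (evec n T) om Om f' g' l k L' Hom HL').
    intros z Hz. apply jumpV_omQ, Cmod_gt_0. lra. }
  assert (HLL := ld_cmp _ _ _ _ _ _ _ HL' sig N f g L Hsmall HS1).
  set (r := powerRZ (-1) (K + Z.of_nat N)).
  set (sg := (Ci * RtoC r)%C).
  assert (Hr : r * r = 1).
  { unfold r. rewrite <- powerRZ_mult. replace (-1 * -1) with 1 by ring. apply powerRZ_R1. }
  assert (Hsg : (sg * Cconj sg)%C = RtoC 1).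
  { unfold sg. rewrite Cmult_conj, Cconj_Ci, RtoC_conj.
    transitivity (RtoC (r * r)); [apply injective_projections; simpl; ring|now rewrite Hr]. }
  assert (Hsd := soldata_scale kap Hk (st N) N _ f g sg Hsg (sol_data _ _ _ _ _ _ HS1)).
  cbv beta in Hsd.
  assert (K0 : RtoC kap <> RtoC 0) by (intros E; apply RtoC_inj in E; lra).
  (* Undoing the dilation divides the coefficient at infinity by [kap], which is the amplitude
     [nu / eps], and undoing the diagonal conjugation multiplies it by [sg]. *)
  assert (Hpsi : psi_flow A xm xp Mdeg N (st N) P Q PhiC XiC K n t0
         (xcirc XiC + eps ^ 2 / nu * X) (t0 + eps ^ (n + 1) / nu ^ n * T) =
     (RtoC 2 * (Ci * (sg / RtoC kap * L)))%C).
  { unfold psi_flow, psi_tilde. fold eps.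
    set (cn := cnorm Mdeg N eps (Xi_is A xm xp) (st N) (xcirc XiC + eps ^ 2 / nu * X)
      (fun m => tcirc_n P Q PhiC XiC K n t0 m + evec n (t0 + eps ^ (n + 1) / nu ^ n * T) m)).
    assert (Hcn : forall j, (j < N)%nat -> cn j =
      (- (om (pole sig j) * rho sig N j) * Cconj sg / RtoC kap)%C).
    { intros j Hj. destruct (Hst N j Hj) as (S1 & S2).
      apply (norming_constant A xm xp P Q PhiC XiC K n N j t0 X T eps nu (st N)); auto.
      rewrite HP0. now rewrite <- HeJ. }
    apply (recover_dRHP (st N) N cn (fun z => (sg * f (RtoC kap * z)%C)%C)
      (fun z => g (RtoC kap * z)%C) Hpd).
    - destruct Hsd as [hf hg hfi hgi hdet hrg hrf]. constructor; auto.
      + intros j Hj. rewrite Hcn by auto. now apply hrg.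
      + intros j Hj. rewrite Hcn by auto. now apply hrf.
    - intros j Hj. rewrite Hcn by auto.
      assert (Hsgc : Cconj sg <> RtoC 0).
      { intros E. rewrite E in Hsg. replace (sg * RtoC 0)%C with (RtoC 0) in Hsg by ring.
        apply RtoC_inj in Hsg. lra. }
      apply Cmult_neq_0.
      + apply Cmult_neq_0; auto. apply Cmod_gt_0. rewrite Cmod_opp. apply Cmod_gt_0.
        apply Cmult_neq_0; [apply omQ_neq_0|apply rho_neq_0; auto; apply Hsmall].
      + apply Cmod_gt_0. rewrite Cmod_inv by auto. now apply Rinv_0_lt_compat, Cmod_gt_0.
    - assert (HC := tends_inf_scale kap _ _ Hk (sol_coef _ _ _ _ _ _ HS1)).
      apply (tends_ext (F := nbinf) (fun z => (sg / RtoC kap * (RtoC kap * z * f (RtoC kap * z)%C))%C)).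
      + intros z. field. auto.
      + apply tends_mult; [apply tends_const|exact HC]. }
  rewrite Hpsi, HPsi. fold r.
  replace (RtoC 2 * (Ci * (sg / RtoC kap * L)) - Ci * RtoC (r * (nu / eps)) * (RtoC 2 * (Ci * L')))%C
      with
    (RtoC (2 * / kap) * (Ci * (sg * (L - L'))))%C.
  - assert (Hsg1 : Cmod sg = 1).
    { unfold sg. rewrite Cmod_mult, Cmod_Ci, Cmod_R.
      generalize (Rabs_pos r). assert (Rabs r * Rabs r = 1) by (rewrite <- Rabs_mult, Hr; apply
          Rabs_R1). nra. }
    rewrite !Cmod_mult, Cmod_Ci, Hsg1, Cmod_R, Rabs_right.
    + replace (2 * nu * (Kcmp Om * D)) with (2 * / kap * (1 * (1 * (Kcmp Om * (eps * D)))))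
        by (unfold kap; field; lra).
      apply Rmult_le_compat_l.
      * assert (0 < / kap) by now apply Rinv_0_lt_compat. lra.
      * rewrite !Rmult_1_l. eapply Rle_trans; [exact HLL|]. apply Rmult_le_compat_l; auto.
        unfold Kcmp. apply Rmult_le_pos; [|apply pow_le; generalize Kbl_ge_1; lra].
        apply Rmult_le_pos; [lra|apply pow2_ge_0].
    + assert (0 < / kap) by now apply Rinv_0_lt_compat. lra.
  - rewrite !RtoC_mult. unfold sg.
    replace (RtoC (nu / eps)) with (/ RtoC kap)%C.
    + rewrite RtoC_inv by lra. field. auto.
    + rewrite <- RtoC_inv by lra. f_equal. unfold kap. field. lra.
Qed.
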